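(* Let $\mathbf{k}$ be an algebraically closed field of characteristic $\neq 2$, let $\mathcal{C}$ be a symmetric tensor category over $\mathbf{k}$, and let $R$ be a simple (ind-)algebra in $\mathcal{C}$. (i) Suppose $V\in\mathcal{C}$ is equipped with a non-degenerate skew-symmetric bilinear form $B$, and that $S^pV=0$ (hence $S^iV=0$ for $i\geq p$) if $p=\operatorname{char}(\mathbf{k})>0$. Then the algebra $A_R(V):=R\otimes A(V)$ is simple. (ii) Suppose $V=W\oplus W^*$ for some $W\in\mathcal{C}$, with the skew-symmetric form defined by the pairing between $W$ and $W^*$, and that $S^pW=S^pW^*=0$ (hence $S^iW=S^iW^*=0$ for $i\ge p$) if $p=\operatorname{char}(\mathbf{k})>0$. Then the algebra $A_R(V):=R\otimes A(V)$ is simple.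
   Context: A symmetric tensor category over $\mathbf{k}$ is a $\mathbf{k}$-linear abelian category with objects of finite length and finite-dimensional Hom spaces, with a rigid symmetric monoidal structure (braiding $c$) with $\mathbf{k}$-bilinear tensor product and $\operatorname{End}(\mathbf{1})=\mathbf{k}$. Ind-algebras are algebras in the ind-completion. An (ind-)algebra is simple if it is nonzero and has no two-sided ideals other than $0$ and itself. A bilinear form $B:V\otimes V\to\mathbf{1}$ is skew-symmetric if $B\circ c_{V,V}=-B$, and non-degenerate if it induces an isomorphism $V\to V^*$. For a skew-symmetric form $B$, the Weyl algebra $A(V)$ is the quotient of the tensor algebra $T(V)$ by the two-sided ideal generated by the image of $(\mathrm{id}-c_{V,V})-B:V\otimes V\to T(V)$. The symmetric algebra $SV=\bigoplus_i S^iV$ is the quotient of $T(V)$ by the ideal generated by the image of $\mathrm{id}-c_{V,V}$ on $V\otimes V$. The tensor product $R\otimes A(V)$ is the usual tensor product of algebras, using the braiding $c$. *)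

(* Defs.v *)
From mathcomp Require Import all_boot all_order all_algebra.

Set Implicit Arguments.
Unset Strict Implicit.
Unset Printing Implicit Defensive.

Import GRing.Theory.
Local Open Scope ring_scope.

Reserved Notation "g \oc f" (at level 40, left associativity).
Reserved Notation "X \oX Y" (at level 40, left associativity).
Reserved Notation "f \ox g" (at level 40, left associativity).

(* Finite-dimensionality of the Hom spaces is built into [vectType]. *)

Record linCat (k : fieldType) := LinCat {
  obj :> Type;
  mor : obj -> obj -> vectType k;
  idm : forall X, mor X X;
  mcomp : forall X Y Z, mor Y Z -> mor X Y -> mor X Z;
  mcompA : forall X Y Z T (h : mor Z T) (g : mor Y Z) (f : mor X Y),
    mcomp h (mcomp g f) = mcomp (mcomp h g) f;
  mcomp1m : forall X Y (f : mor X Y), mcomp (idm Y) f = f;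
  mcompm1 : forall X Y (f : mor X Y), mcomp f (idm X) = f;
  mcompDl : forall X Y Z (g g' : mor Y Z) (f : mor X Y),
    mcomp (g + g') f = mcomp g f + mcomp g' f;
  mcompDr : forall X Y Z (g : mor Y Z) (f f' : mor X Y),
    mcomp g (f + f') = mcomp g f + mcomp g f';
  mcompZl : forall X Y Z (a : k) (g : mor Y Z) (f : mor X Y),
    mcomp (a *: g) f = a *: mcomp g f;
  mcompZr : forall X Y Z (a : k) (g : mor Y Z) (f : mor X Y),
    mcomp g (a *: f) = a *: mcomp g f
}.

Arguments mor {k l} X Y.
Arguments idm {k l} X.
Arguments mcomp {k l X Y Z} g f.
Notation "g \oc f" := (mcomp g f) : ring_scope.

Section LinCatTheory.
Variables (k : fieldType) (C : linCat k).

Definition is_zero_ob (X : C) : Prop := idm X = 0.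

Definition mono (X Y : C) (f : mor X Y) : Prop :=
  forall Z (g h : mor Z X), f \oc g = f \oc h -> g = h.

Definition epi (X Y : C) (f : mor X Y) : Prop :=
  forall Z (g h : mor Y Z), g \oc f = h \oc f -> g = h.

Definition is_iso (X Y : C) (f : mor X Y) : Prop :=
  exists g : mor Y X, g \oc f = idm X /\ f \oc g = idm Y.

Definition is_kernel (K X Y : C) (f : mor X Y) (i : mor K X) : Prop :=
  f \oc i = 0 /\
  forall Z (g : mor Z X), f \oc g = 0 ->
    exists h : mor Z K, i \oc h = g /\ forall h', i \oc h' = g -> h' = h.

Definition is_cokernel (X Y Q : C) (f : mor X Y) (q : mor Y Q) : Prop :=
  q \oc f = 0 /\
  forall Z (g : mor Y Z), g \oc f = 0 ->
    exists h : mor Q Z, h \oc q = g /\ forall h', h' \oc q = g -> h' = h.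

Definition is_simple_ob (S : C) : Prop :=
  ~ is_zero_ob S /\
  forall Y (f : mor Y S), mono f -> is_zero_ob Y \/ is_iso f.

(* Existence of a Jordan-Hoelder filtration. *)
Inductive finite_length : C -> Prop :=
| FinLen0 X : is_zero_ob X -> finite_length X
| FinLenS Y X S (i : mor Y X) (q : mor X S) :
    finite_length Y -> is_kernel q i -> is_cokernel i q -> is_simple_ob S ->
    finite_length X.

Lemma mcomp0l (X Y Z : C) (f : mor X Y) : (0 : mor Y Z) \oc f = 0.
Proof. by rewrite -(scale0r 0) mcompZl scale0r. Qed.

Lemma mcomp0r (X Y Z : C) (g : mor Y Z) : g \oc (0 : mor X Y) = 0.
Proof. by rewrite -(scale0r 0) mcompZr scale0r. Qed.

Lemma mcomp_suml (X Y Z : C) n (g : 'I_n -> mor Y Z) (f : mor X Y) :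
  (\sum_i g i) \oc f = \sum_i g i \oc f.
Proof.
elim/big_rec2: _ => [|i x y _ <-]; first exact: mcomp0l.
exact: mcompDl.
Qed.

Lemma mcomp_sumr (X Y Z : C) n (g : mor Y Z) (f : 'I_n -> mor X Y) :
  g \oc (\sum_i f i) = \sum_i g \oc f i.
Proof.
elim/big_rec2: _ => [|i x y _ <-]; first exact: mcomp0r.
exact: mcompDr.
Qed.

End LinCatTheory.

Record abelianStr (k : fieldType) (C : linCat k) := AbelianStr {
  zero_ob : C;
  zero_obP : is_zero_ob zero_ob;
  bip : C -> C -> C;
  in1 : forall X Y, mor X (bip X Y);
  in2 : forall X Y, mor Y (bip X Y);
  pr1 : forall X Y, mor (bip X Y) X;
  pr2 : forall X Y, mor (bip X Y) Y;
  pr1_in1 : forall X Y, pr1 X Y \oc in1 X Y = idm X;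
  pr2_in2 : forall X Y, pr2 X Y \oc in2 X Y = idm Y;
  pr1_in2 : forall X Y, pr1 X Y \oc in2 X Y = 0;
  pr2_in1 : forall X Y, pr2 X Y \oc in1 X Y = 0;
  bip_id : forall X Y,
    in1 X Y \oc pr1 X Y + in2 X Y \oc pr2 X Y = idm (bip X Y);
  ker : forall X Y, mor X Y -> C;
  ker_in : forall X Y (f : mor X Y), mor (ker f) X;
  kerP : forall X Y (f : mor X Y), is_kernel f (ker_in f);
  coker : forall X Y, mor X Y -> C;
  coker_pr : forall X Y (f : mor X Y), mor Y (coker f);
  cokerP : forall X Y (f : mor X Y), is_cokernel f (coker_pr f);
  mono_normal : forall X Y (f : mor X Y), mono f ->
    exists (Z : C) (g : mor Y Z), is_kernel g f;
  epi_normal : forall X Y (f : mor X Y), epi f ->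
    exists (Z : C) (g : mor Z X), is_cokernel g f
}.

Record symMonStr (k : fieldType) (C : linCat k) := SymMonStr {
  unit_ob : C;
  tens : C -> C -> C;
  tensm : forall X X' Y Y',
    mor X X' -> mor Y Y' -> mor (tens X Y) (tens X' Y');
  tensm1 : forall X Y, tensm (idm X) (idm Y) = idm (tens X Y);
  tensm_comp : forall X X' X'' Y Y' Y'' (f' : mor X' X'') (f : mor X X')
    (g' : mor Y' Y'') (g : mor Y Y'),
    tensm (f' \oc f) (g' \oc g) = tensm f' g' \oc tensm f g;
  tensmDl : forall X X' Y Y' (f f' : mor X X') (g : mor Y Y'),
    tensm (f + f') g = tensm f g + tensm f' g;
  tensmDr : forall X X' Y Y' (f : mor X X') (g g' : mor Y Y'),
    tensm f (g + g') = tensm f g + tensm f g';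
  tensmZl : forall X X' Y Y' (a : k) (f : mor X X') (g : mor Y Y'),
    tensm (a *: f) g = a *: tensm f g;
  tensmZr : forall X X' Y Y' (a : k) (f : mor X X') (g : mor Y Y'),
    tensm f (a *: g) = a *: tensm f g;
  assoc : forall X Y Z, mor (tens (tens X Y) Z) (tens X (tens Y Z));
  assocV : forall X Y Z, mor (tens X (tens Y Z)) (tens (tens X Y) Z);
  assocK : forall X Y Z, assocV X Y Z \oc assoc X Y Z = idm _;
  assocVK : forall X Y Z, assoc X Y Z \oc assocV X Y Z = idm _;
  assoc_nat : forall X X' Y Y' Z Z' (f : mor X X') (g : mor Y Y')
    (h : mor Z Z'),
    assoc X' Y' Z' \oc tensm (tensm f g) h =
    tensm f (tensm g h) \oc assoc X Y Z;
  lunit : forall X, mor (tens unit_ob X) X;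
  lunitV : forall X, mor X (tens unit_ob X);
  lunitK : forall X, lunitV X \oc lunit X = idm _;
  lunitVK : forall X, lunit X \oc lunitV X = idm _;
  lunit_nat : forall X X' (f : mor X X'),
    lunit X' \oc tensm (idm unit_ob) f = f \oc lunit X;
  runit : forall X, mor (tens X unit_ob) X;
  runitV : forall X, mor X (tens X unit_ob);
  runitK : forall X, runitV X \oc runit X = idm _;
  runitVK : forall X, runit X \oc runitV X = idm _;
  runit_nat : forall X X' (f : mor X X'),
    runit X' \oc tensm f (idm unit_ob) = f \oc runit X;
  pentagon : forall X Y Z T,
    assoc X Y (tens Z T) \oc assoc (tens X Y) Z T =
    tensm (idm X) (assoc Y Z T) \oc assoc X (tens Y Z) T
      \oc tensm (assoc X Y Z) (idm T);
  triangle : forall X Y,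
    tensm (idm X) (lunit Y) \oc assoc X unit_ob Y =
    tensm (runit X) (idm Y);
  braid : forall X Y, mor (tens X Y) (tens Y X);
  braid_nat : forall X X' Y Y' (f : mor X X') (g : mor Y Y'),
    braid X' Y' \oc tensm f g = tensm g f \oc braid X Y;
  braid_sym : forall X Y, braid Y X \oc braid X Y = idm _;
  hexagon : forall X Y Z,
    assoc Y Z X \oc braid X (tens Y Z) \oc assoc X Y Z =
    tensm (idm Y) (braid X Z) \oc assoc Y X Z
      \oc tensm (braid X Y) (idm Z)
}.

(* Left duals suffice: the symmetric braiding makes them right duals. *)
Record rigidStr (k : fieldType) (C : linCat k) (M : symMonStr C) := RigidStr {
  dual : C -> C;
  ev : forall X, mor (tens M (dual X) X) (unit_ob M);
  coev : forall X, mor (unit_ob M) (tens M X (dual X));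
  zigzag : forall X,
    runit M X \oc tensm M (idm X) (ev X) \oc assoc M X (dual X) X
      \oc tensm M (coev X) (idm X) = lunit M X;
  zigzag_dual : forall X,
    lunit M (dual X) \oc tensm M (ev X) (idm (dual X))
      \oc assocV M (dual X) X (dual X)
      \oc tensm M (idm (dual X)) (coev X) = runit M (dual X)
}.

Record symTensorCat (k : fieldType) := SymTensorCat {
  stc_cat :> linCat k;
  stc_ab : abelianStr stc_cat;
  stc_mon : symMonStr stc_cat;
  stc_rigid : rigidStr stc_mon;
  stc_finite_length : forall X : stc_cat, finite_length X;
  stc_end_unit : forall f : mor (unit_ob stc_mon) (unit_ob stc_mon),
    exists! a : k, f = a *: idm (unit_ob stc_mon)
}.

Notation "X \oX Y" := (tens (stc_mon _) X Y) : ring_scope.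
Notation "f \ox g" := (tensm (stc_mon _) f g) : ring_scope.

Section SymTensorCatTheory.
Variables (k : fieldType) (C : symTensorCat k).
Local Notation M := (stc_mon C).
Local Notation Ab := (stc_ab C).
Local Notation "'\1'" := (unit_ob M).
Local Notation alpha := (assoc M).
Local Notation alphaV := (assocV M).
Local Notation br := (braid M).
Local Notation "X '^*'" := (dual (stc_rigid C) X).

Lemma tensm0l (X X' Y Y' : C) (g : mor Y Y') : (0 : mor X X') \ox g = 0.
Proof. by rewrite -(scale0r 0) tensmZl scale0r. Qed.

Lemma tensm0r (X X' Y Y' : C) (f : mor X X') : f \ox (0 : mor Y Y') = 0.
Proof. by rewrite -(scale0r 0) tensmZr scale0r. Qed.

Definition skew_form (V : C) (B : mor (V \oX V) \1) : Prop :=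
  B \oc br V V = - B.

(* V = V (x) 1 -> V (x) (V (x) V^* ) = (V (x) V) (x) V^* -> 1 (x) V^* = V^*  *)
Definition form_map (V : C) (B : mor (V \oX V) \1) : mor V (V^*) :=
  lunit M (V^*) \oc (B \ox idm (V^*)) \oc alphaV V V (V^*)
    \oc (idm V \ox coev (stc_rigid C) V) \oc runitV M V.

Definition nondegenerate_form (V : C) (B : mor (V \oX V) \1) : Prop :=
  is_iso (form_map B).

(* The skew form on W (+) W^* vanishing on W (x) W and W^* (x) W^* and equal to
   the pairing on W^* (x) W, hence to minus the pairing on W (x) W^*; the
   opposite sign gives an isometric form (-1 on W). *)
Definition pairing_form (W : C) :
    mor (bip Ab W (W^*) \oX bip Ab W (W^*)) \1 :=
  let p := pr1 Ab W (W^*) in let q := pr2 Ab W (W^*) in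
  let e := ev (stc_rigid C) W in
  e \oc (q \ox p) - e \oc br W (W^*) \oc (p \ox q).

Fixpoint tpow (V : C) (n : nat) : C :=
  if n is n'.+1 then V \oX tpow V n' else \1.

Fixpoint concat (V : C) (a b : nat) : mor (tpow V a \oX tpow V b) (tpow V (a + b)) :=
  match a return mor (tpow V a \oX tpow V b) (tpow V (a + b)) with
  | 0 => lunit M (tpow V b)
  | a'.+1 => (idm V \ox concat V a' b) \oc alpha V (tpow V a') (tpow V b)
  end.

Definition tpow2 (V : C) : mor (V \oX V) (tpow V 2) := idm V \ox runitV M V.

(* The braiding of the factors i and i+1 of V^{(x) n} (counted from 0);
   junk value id when i + 1 >= n. *)
Fixpoint swap (V : C) (n i : nat) : mor (tpow V n) (tpow V n) :=
  match n return mor (tpow V n) (tpow V n) with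
  | 0 => idm _
  | n'.+1 =>
    match i with
    | 0 =>
      match n' return mor (tpow V n'.+1) (tpow V n'.+1) with
      | 0 => idm _
      | m.+1 => alpha V V (tpow V m) \oc (br V V \ox idm (tpow V m))
                  \oc alphaV V V (tpow V m)
      end
    | i'.+1 => idm V \ox swap V n' i'
    end
  end.

Fixpoint copow (X : C) (n : nat) : C :=
  if n is n'.+1 then bip Ab X (copow X n') else zero_ob Ab.

Fixpoint copow_map (X Y : C) (n : nat) : (nat -> mor X Y) -> mor (copow X n) Y :=
  match n return (nat -> mor X Y) -> mor (copow X n) Y with
  | 0 => fun=> 0
  | n'.+1 => fun f => f 0%N \oc pr1 Ab X (copow X n')
      + copow_map n' (fun i => f i.+1) \oc pr2 Ab X (copow X n')
  end.

(* S^n V is the degree n component of T(V) / (im (id - c)): the quotient of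
   V^{(x) n} by the sum of the images of the
   id_{V^{(x) i}} (x) (id - c) (x) id_{V^{(x) n-i-2}}, i < n - 1. *)
Definition sym_pow (V : C) (n : nat) : C :=
  coker Ab (copow_map n.-1 (fun i => idm (tpow V n) - swap V n i)).

(* [bigbip F N] = F 0 (+) ... (+) F N; [tin] and [tpr] vanish for n > N. *)
Fixpoint bigbip (F : nat -> C) (N : nat) : C :=
  if N is N'.+1 then bip Ab (F 0%N) (bigbip (fun n => F n.+1) N') else F 0%N.

Fixpoint tin (F : nat -> C) (N n : nat) {struct N} : mor (F n) (bigbip F N) :=
  match N return mor (F n) (bigbip F N) with
  | 0 => match n return mor (F n) (F 0%N) with 0 => idm _ | _.+1 => 0 end
  | N'.+1 =>
    match n return mor (F n) (bigbip F N'.+1) with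
    | 0 => in1 Ab _ _
    | n'.+1 => in2 Ab _ _ \oc tin (fun n => F n.+1) N' n'
    end
  end.

Fixpoint tpr (F : nat -> C) (N n : nat) {struct N} : mor (bigbip F N) (F n) :=
  match N return mor (bigbip F N) (F n) with
  | 0 => match n return mor (F 0%N) (F n) with 0 => idm _ | _.+1 => 0 end
  | N'.+1 =>
    match n return mor (bigbip F N'.+1) (F n) with
    | 0 => pr1 Ab _ _
    | n'.+1 => tpr (fun n => F n.+1) N' n' \oc pr2 Ab _ _
    end
  end.

Lemma tpr_big F N n : (N < n)%N -> tpr F N n = 0.
Proof.
elim: N F n => [|N IH] F [|n] //= lt.
by rewrite IH // mcomp0l.
Qed.

Lemma tpr_tin F N n : (n <= N)%N -> tpr F N n \oc tin F N n = idm (F n).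
Proof.
elim: N F n => [|N IH] F [|n] //= le; first exact: mcomp1m.
  exact: pr1_in1.
by rewrite mcompA -(mcompA (tpr _ _ _)) pr2_in2 mcompm1 IH.
Qed.

Lemma tpr_tin_neq F N n m : n <> m -> tpr F N n \oc tin F N m = 0.
Proof.
elim: N F n m => [|N IH] F [|n] [|m] //= ne; rewrite ?mcomp0l ?mcomp0r //.
- by rewrite mcompA pr1_in2 mcomp0l.
- by rewrite -mcompA pr2_in1 mcomp0r.
rewrite mcompA -(mcompA (tpr _ _ _)) pr2_in2 mcompm1 IH // => e.
by apply: ne; rewrite e.
Qed.

Lemma tin_tpr_sum F N :
  \sum_(n < N.+1) tin F N n \oc tpr F N n = idm (bigbip F N).
Proof.
elim: N F => [|N IH] F; first by rewrite big_ord1 /= mcomp1m.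
rewrite big_ord_recl /= -[RHS]bip_id; congr (_ + _).
rewrite -[X in X \oc pr2 _ _ _]mcompm1 -(IH (fun n => F n.+1)).
rewrite mcomp_sumr mcomp_suml; apply: eq_bigr => i _.
by rewrite !mcompA.
Qed.

Definition tbip_tr (F : nat -> C) (N N' : nat) : mor (bigbip F N) (bigbip F N') :=
  \sum_(n < N.+1) tin F N' n \oc tpr F N n.

Lemma tpr_tr F N N' n : (N <= N')%N ->
  tpr F N' n \oc tbip_tr F N N' = tpr F N n.
Proof.
move=> leN; rewrite mcomp_sumr; have [le|lt] := leqP n N; last first.
  rewrite (tpr_big F lt) big1 // => i _.
  rewrite mcompA tpr_tin_neq ?mcomp0l // => e.
  by move: (ltn_ord i); rewrite ltnS -e leqNgt lt.
have ltn : (n < N.+1)%N by [].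
rewrite (bigD1 (Ordinal ltn)) //= mcompA tpr_tin ?(leq_trans le) // mcomp1m.
rewrite big1 ?addr0 // => i /eqP ne; rewrite mcompA tpr_tin_neq ?mcomp0l // => e.
by apply: ne; apply: val_inj.
Qed.

Lemma tr_tin F N N' n : (n <= N)%N ->
  tbip_tr F N N' \oc tin F N n = tin F N' n.
Proof.
move=> le; rewrite mcomp_suml; have ltn : (n < N.+1)%N by [].
rewrite (bigD1 (Ordinal ltn)) //= -mcompA tpr_tin // mcompm1.
rewrite big1 ?addr0 // => i /eqP ne; rewrite -mcompA tpr_tin_neq ?mcomp0r // => e.
by apply: ne; apply: val_inj.
Qed.

Lemma tbip_tr_id F N : tbip_tr F N N = idm (bigbip F N).
Proof. exact: tin_tpr_sum. Qed.

Lemma tbip_tr_comp F N1 N2 N3 : (N1 <= N2)%N ->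
  tbip_tr F N2 N3 \oc tbip_tr F N1 N2 = tbip_tr F N1 N3.
Proof.
move=> le; rewrite [X in _ \oc X = _]/tbip_tr mcomp_sumr.
apply: eq_bigr => i _; rewrite mcompA tr_tin //.
by rewrite (leq_trans _ le) // -ltnS ltn_ord.
Qed.

(* Ind-objects are given as inductive systems over nonempty directed preorders;
   general small filtered index categories yield the same category, each of
   them admitting a cofinal functor from a directed set. [tr_id] and [tr_comp] make
   [tr] independent of the proof of [ile i j]. *)

Record indObj := IndObj {
  idx : Type;
  ile : idx -> idx -> Prop;
  ile_refl : forall i, ile i i;
  ile_trans : forall i j l, ile i j -> ile j l -> ile i l;
  ile_directed : forall i j, exists l, ile i l /\ ile j l;
  idx_nonempty : inhabited idx;
  at_ :> idx -> C;
  tr : forall i j, ile i j -> mor (at_ i) (at_ j);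
  tr_id : forall i (h : ile i i), tr h = idm (at_ i);
  tr_comp : forall i j l (hij : ile i j) (hjl : ile j l) (hil : ile i l),
    tr hjl \oc tr hij = tr hil
}.

Arguments ile {X} i j : rename.
Arguments tr {X i j} h : rename.

(* Equality in colim_j Hom(Z, Y_j). *)
Definition germ_eq (Z : C) (Y : indObj) (j j' : idx Y)
    (f : mor Z (Y j)) (f' : mor Z (Y j')) : Prop :=
  exists l (h : ile j l) (h' : ile j' l), tr h \oc f = tr h' \oc f'.

Lemma germ_refl Z (Y : indObj) (j : idx Y) (f : mor Z (Y j)) : germ_eq f f.
Proof. by exists j, (ile_refl j), (ile_refl j). Qed.

Lemma germ_sym Z (Y : indObj) (j j' : idx Y) (f : mor Z (Y j))
  (f' : mor Z (Y j')) : germ_eq f f' -> germ_eq f' f.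
Proof. by case=> l [h [h' e]]; exists l, h', h. Qed.

Lemma germ_trans Z (Y : indObj) (j1 j2 j3 : idx Y) (f1 : mor Z (Y j1))
  (f2 : mor Z (Y j2)) (f3 : mor Z (Y j3)) :
  germ_eq f1 f2 -> germ_eq f2 f3 -> germ_eq f1 f3.
Proof.
case=> l [h1 [h2 e]] [l' [h2' [h3 e']]].
have [m [lm lm']] := ile_directed l l'.
exists m, (ile_trans h1 lm), (ile_trans h3 lm').
rewrite -(tr_comp h1 lm) -(tr_comp h3 lm') -!mcompA e -e' !mcompA.
by congr (_ \oc _); rewrite (tr_comp _ _ (ile_trans h2 lm)) (tr_comp _ _ (ile_trans h2 lm)).
Qed.

Lemma germ_comp Z Z' (Y : indObj) (j j' : idx Y) (f : mor Z (Y j))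
  (f' : mor Z (Y j')) (g : mor Z' Z) :
  germ_eq f f' -> germ_eq (f \oc g) (f' \oc g).
Proof. by case=> l [h [h' e]]; exists l, h, h'; rewrite !mcompA e. Qed.

Lemma germ_tr Z (Y : indObj) (j j' : idx Y) (h : ile j j') (f : mor Z (Y j)) :
  germ_eq (tr h \oc f) f.
Proof.
exists j', (ile_refl j'), h; rewrite mcompA.
by rewrite (tr_comp h (ile_refl j') h).
Qed.

(* Representatives of elements of lim_i colim_j Hom(X_i, Y_j); morphisms of
   ind-objects are these up to [ieq]. *)
Record indHom (X Y : indObj) := IndHom {
  ix : idx X -> idx Y;
  cp : forall i, mor (X i) (Y (ix i));
  cp_compat : forall i i' (h : ile i i'), germ_eq (cp i) (cp i' \oc tr h)
}.

Definition ieq (X Y : indObj) (f g : indHom X Y) : Prop :=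
  forall i, germ_eq (cp f i) (cp g i).

Definition ilevel (X Y : indObj) (phi : idx X -> idx Y)
    (f : forall i, mor (X i) (Y (phi i)))
    (H : forall i i' (h : ile i i'),
       exists h' : ile (phi i) (phi i'), f i' \oc tr h = tr h' \oc f i) :
  indHom X Y.
Proof.
exists phi f => i i' h; have [h' ->] := H i i' h.
exact/germ_sym/germ_tr.
Defined.

Definition iid (X : indObj) : indHom X X.
Proof.
apply: (@ilevel X X id (fun i => idm (X i))) => i i' h; exists h.
by rewrite mcomp1m mcompm1.
Defined.

Definition icomp (X Y Z : indObj) (g : indHom Y Z) (f : indHom X Y) :
  indHom X Z.
Proof.
exists (fun i => ix g (ix f i)) (fun i => cp g (ix f i) \oc cp f i) => i i' h.
have [l [h1 [h2 e]]] := cp_compat f h; rewrite -mcompA.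
apply: germ_trans (germ_comp (cp f i) (cp_compat g h1)) _.
rewrite -mcompA e mcompA.
exact/germ_sym/(germ_comp (cp f i' \oc tr h) (cp_compat g h2)).
Defined.

Definition icst (X : C) : indObj.
Proof.
exists unit (fun _ _ => True) (fun=> X) (fun _ _ _ => idm X) => //.
by move=> *; rewrite mcomp1m.
Defined.

Definition iof (X : C) (Y : indObj) (j : idx Y) (f : mor X (Y j)) :
  indHom (icst X) Y.
Proof.
apply: (@ilevel (icst X) Y (fun=> j) (fun=> f)) => i i' h.
by exists (ile_refl j); rewrite tr_id mcompm1 mcomp1m.
Defined.

Definition izero_hom (X Y : indObj) (f : indHom X Y) : Prop :=
  forall i, exists l (h : ile (ix f i) l), tr h \oc cp f i = 0.

Definition izero_ob (X : indObj) : Prop := izero_hom (iid X).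

Definition imono (X Y : indObj) (f : indHom X Y) : Prop :=
  forall Z (g h : indHom Z X), ieq (icomp f g) (icomp f h) -> ieq g h.

Definition is_iiso (X Y : indObj) (f : indHom X Y) : Prop :=
  exists g : indHom Y X, ieq (icomp g f) (iid X) /\ ieq (icomp f g) (iid Y).

Definition is_icokernel (X Y Q : indObj) (f : indHom X Y) (q : indHom Y Q) :
    Prop :=
  izero_hom (icomp q f) /\
  forall Z (g : indHom Y Z), izero_hom (icomp g f) ->
    exists h : indHom Q Z, ieq (icomp h q) g /\
      forall h', ieq (icomp h' q) g -> ieq h' h.

Definition ifactors (X Y Z : indObj) (f : indHom X Z) (i : indHom Y Z) : Prop :=
  exists g : indHom X Y, ieq (icomp i g) f.

Definition itens (X Y : indObj) : indObj.
Proof.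
exists (idx X * idx Y)%type (fun a b => ile a.1 b.1 /\ ile a.2 b.2)
  (fun a => X a.1 \oX Y a.2)
  (fun a b h => let: conj h1 h2 := h in tr h1 \ox tr h2).
- by move=> a; split; exact: ile_refl.
- by move=> a b c [h1 h2] [h1' h2']; split; [exact: ile_trans h1 h1' | exact: ile_trans h2 h2'].
- move=> [a1 a2] [b1 b2]; have [c1 [? ?]] := ile_directed a1 b1.
  by have [c2 [? ?]] := ile_directed a2 b2; exists (c1, c2).
- by have [a] := idx_nonempty X; have [b] := idx_nonempty Y; exists.
- by move=> a [h1 h2]; rewrite !tr_id tensm1.
- move=> a b c [h1 h2] [h1' h2'] [h1'' h2'']; rewrite -tensm_comp.
  by rewrite (tr_comp _ _ h1'') (tr_comp _ _ h2'').
Defined.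

Definition itensm (X X' Y Y' : indObj) (f : indHom X X') (g : indHom Y Y') :
  indHom (itens X Y) (itens X' Y').
Proof.
exists (fun a : idx (itens X Y) => (ix f a.1, ix g a.2) : idx (itens X' Y'))
  (fun a => cp f a.1 \ox cp g a.2) => a b [h1 h2] /=.
have [c1 [u1 [v1 e1]]] := cp_compat f h1.
have [c2 [u2 [v2 e2]]] := cp_compat g h2.
exists (c1, c2), (conj u1 u2), (conj v1 v2) => /=.
by rewrite -!tensm_comp e1 e2.
Defined.

Definition iassoc (X Y Z : indObj) :
  indHom (itens (itens X Y) Z) (itens X (itens Y Z)).
Proof.
apply: (@ilevel (itens (itens X Y) Z) (itens X (itens Y Z))
  (fun a => (a.1.1, (a.1.2, a.2))) (fun a => alpha _ _ _)).
move=> a b [[h1 h2] h3] /=; exists (conj h1 (conj h2 h3)) => /=.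
exact: assoc_nat.
Defined.

Definition ilunit (X : indObj) : indHom (itens (icst \1) X) X.
Proof.
apply: (@ilevel (itens (icst \1) X) X (fun a => a.2) (fun a => lunit M _)).
move=> a b [h1 h2] /=; exists h2; exact: lunit_nat.
Defined.

Definition irunit (X : indObj) : indHom (itens X (icst \1)) X.
Proof.
apply: (@ilevel (itens X (icst \1)) X (fun a => a.1) (fun a => runit M _)).
move=> a b [h1 h2] /=; exists h1; exact: runit_nat.
Defined.

Definition interchange (X Y Z W : C) :
    mor ((X \oX Y) \oX (Z \oX W)) ((X \oX Z) \oX (Y \oX W)) :=
  alphaV X Z (Y \oX W)
    \oc (idm X \ox (alpha Z Y W \oc (br Y Z \ox idm W) \oc alphaV Y Z W))
    \oc alpha X Y (Z \oX W).

Lemma assocV_nat (X X' Y Y' Z Z' : C) (f : mor X X') (g : mor Y Y')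
  (h : mor Z Z') :
  alphaV X' Y' Z' \oc (f \ox (g \ox h)) =
  ((f \ox g) \ox h) \oc alphaV X Y Z.
Proof.
rewrite -[LHS]mcompm1 -(assocVK M X Y Z) mcompA -(mcompA (alphaV _ _ _)).
by rewrite -assoc_nat mcompA assocK mcomp1m.
Qed.

Lemma interchange_nat (X X' Y Y' Z Z' W W' : C) (f : mor X X') (g : mor Y Y')
  (h : mor Z Z') (l : mor W W') :
  interchange X' Y' Z' W' \oc ((f \ox g) \ox (h \ox l)) =
  ((f \ox h) \ox (g \ox l)) \oc interchange X Y Z W.
Proof.
rewrite /interchange -!mcompA assoc_nat [in RHS]mcompA -assocV_nat -!mcompA.
congr (_ \oc _); rewrite !mcompA -!tensm_comp; congr (_ \oc _).
rewrite mcomp1m mcompm1; congr (_ \ox _).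
rewrite -!mcompA assocV_nat [in RHS]mcompA -assoc_nat -!mcompA; congr (_ \oc _).
by rewrite !mcompA -!tensm_comp braid_nat mcomp1m mcompm1.
Qed.

Definition iinterchange (X Y Z W : indObj) :
  indHom (itens (itens X Y) (itens Z W)) (itens (itens X Z) (itens Y W)).
Proof.
apply: (@ilevel (itens (itens X Y) (itens Z W)) (itens (itens X Z) (itens Y W))
  (fun a => ((a.1.1, a.2.1), (a.1.2, a.2.2)))
  (fun a => interchange _ _ _ _)).
move=> a b [[h1 h2] [h3 h4]] /=.
exists (conj (conj h1 h3) (conj h2 h4)) => /=; exact: interchange_nat.
Defined.

(* Raw multiplication and unit; the axioms are [is_algebra]. *)
Record indAlgData := IndAlgData {
  carrier :> indObj;
  imul : indHom (itens carrier carrier) carrier;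
  iunit : indHom (icst \1) carrier
}.

Definition is_algebra (A : indAlgData) : Prop :=
  [/\ ieq (icomp (imul A) (itensm (imul A) (iid A)))
          (icomp (imul A) (icomp (itensm (iid A) (imul A)) (iassoc A A A))),
      ieq (icomp (imul A) (itensm (iunit A) (iid A))) (ilunit A)
    & ieq (icomp (imul A) (itensm (iid A) (iunit A))) (irunit A)].

Definition is_alg_hom (A B : indAlgData) (f : indHom A B) : Prop :=
  ieq (icomp f (imul A)) (icomp (imul B) (itensm f f)) /\
  ieq (icomp f (iunit A)) (iunit B).

Definition is_ideal (A : indAlgData) (K : indObj) (i : indHom K A) : Prop :=
  [/\ imono i,
      ifactors (icomp (imul A) (itensm (iid A) i)) i
    & ifactors (icomp (imul A) (itensm i (iid A))) i].

Definition simple_algebra (A : indAlgData) : Prop :=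
  [/\ is_algebra A, ~ izero_ob A
    & forall (K : indObj) (i : indHom K A), is_ideal i ->
        izero_ob K \/ is_iiso i].

Definition alg_tens (A B : indAlgData) : indAlgData :=
  @IndAlgData (itens A B)
    (icomp (itensm (imul A) (imul B)) (iinterchange A B A B))
    (icomp (itensm (iunit A) (iunit B))
       (@iof \1 (itens (icst \1) (icst \1)) (tt, tt) (lunitV M \1))).

(* [i : K -> A] is the two-sided ideal generated by the image of [r]. *)
Definition ideal_generated (A : indAlgData) (X K : indObj) (r : indHom X A)
    (i : indHom K A) : Prop :=
  [/\ is_ideal i, ifactors r i
    & forall (K' : indObj) (i' : indHom K' A),
        is_ideal i' -> ifactors r i' -> ifactors i i'].

Definition is_quotient_by (A : indAlgData) (X : indObj) (r : indHom X A)
    (Q : indAlgData) : Prop :=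
  exists (K : indObj) (i : indHom K A) (q : indHom A Q),
    [/\ ideal_generated r i, is_algebra Q, is_alg_hom q & is_icokernel i q].

(* T(V) = (+)_n V^{(x) n} as the inductive system of the partial sums
   1 (+) V (+) ... (+) V^{(x) N}. *)

Section TensorAlgebra.
Variable V : C.
Local Notation F := (tpow V).

Definition talg_ob : indObj.
Proof.
exists nat (fun N N' => (N <= N')%N) (bigbip F) (fun N N' _ => tbip_tr F N N').
- by [].
- by move=> i j l; exact: leq_trans.
- by move=> i j; exists (maxn i j); rewrite leq_maxl leq_maxr.
- exact: (inhabits 0%N).
- by move=> N _; exact: tbip_tr_id.
- by move=> N1 N2 N3 h _ _; exact: tbip_tr_comp.
Defined.

Definition talg_mul_at (N N' : nat) :
    mor (bigbip F N \oX bigbip F N') (bigbip F (N + N')) :=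
  \sum_(a < N.+1) \sum_(b < N'.+1)
    tin F (N + N') (a + b) \oc concat V a b \oc (tpr F N a \ox tpr F N' b).

Lemma talg_mul_nat N1 N2 N1' N2' : (N1 <= N1')%N -> (N2 <= N2')%N ->
  talg_mul_at N1' N2' \oc (tbip_tr F N1 N1' \ox tbip_tr F N2 N2') =
  tbip_tr F (N1 + N2) (N1' + N2') \oc talg_mul_at N1 N2.
Proof.
move=> le1 le2; rewrite mcomp_suml mcomp_sumr.
pose G a b := tin F (N1' + N2') (a + b) \oc concat V a b \oc
                (tpr F N1 a \ox tpr F N2 b).
transitivity (\sum_(a < N1'.+1) \sum_(b < N2'.+1) G a b).
  apply: eq_bigr => a _; rewrite mcomp_suml; apply: eq_bigr => b _.
  by rewrite -mcompA -tensm_comp !tpr_tr.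
transitivity (\sum_(a < N1.+1) \sum_(b < N2.+1) G a b).
  have shrink n n' (Y : C) (H : nat -> mor (bigbip F N1 \oX bigbip F N2) Y) :
    (n <= n')%N -> (forall i, (n < i)%N -> H i = 0) ->
    \sum_(i < n'.+1) H i = \sum_(i < n.+1) H i.
    move=> le0 H0; rewrite [RHS](big_ord_widen n'.+1 H) //.
    rewrite [LHS](bigID (fun i : 'I_n'.+1 => (i < n.+1)%N)) /=.
    rewrite -[RHS]addr0; congr (_ + _).
    by apply: big1 => i; rewrite -leqNgt => /H0.
  rewrite (shrink _ _ _ (fun a => \sum_(b < N2'.+1) G a b) le1).
    apply: eq_bigr => a _; apply: (shrink _ _ _ (G a) le2) => b lt.
    by rewrite /G (tpr_big F lt) tensm0r mcomp0r.
  move=> a lt; apply: big1 => b _.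
  by rewrite /G (tpr_big F lt) tensm0l mcomp0r.
apply: eq_bigr => a _; rewrite mcomp_sumr; apply: eq_bigr => b _.
by rewrite !mcompA tr_tin // leq_add // -ltnS ltn_ord.
Qed.

Definition talg_mul : indHom (itens talg_ob talg_ob) talg_ob.
Proof.
apply: (@ilevel (itens talg_ob talg_ob) talg_ob
  (fun a : nat * nat => (a.1 + a.2)%N) (fun a => talg_mul_at a.1 a.2)).
move=> a b [h1 h2]; exists (leq_add h1 h2); exact: talg_mul_nat.
Defined.

Definition talg : indAlgData :=
  @IndAlgData talg_ob talg_mul (@iof \1 talg_ob 0%N (idm \1)).

End TensorAlgebra.

Definition weyl_rel (V : C) (B : mor (V \oX V) \1) :
    indHom (icst (V \oX V)) (talg V) :=
  @iof (V \oX V) (talg V) 2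
    (tin (tpow V) 2 2 \oc tpow2 V \oc (idm (V \oX V) - br V V)
       - tin (tpow V) 2 0 \oc B).

(* Determines A up to isomorphism of algebras. *)
Definition is_weyl_algebra (V : C) (B : mor (V \oX V) \1) (A : indAlgData) :
    Prop :=
  is_quotient_by (weyl_rel B) A.

End SymTensorCatTheory.

(* Main.v *)
(** Let J be a nonzero ideal of R (x) A(V). Bracketing with V preserves J and lowers the degree
    in V, while the Euler operator x |-> sum_i e_i [e_i^*, x] built from a copairing acts on
    words of degree n as multiplication by n modulo shorter words. As S^p V = 0 in
    characteristic p, only degrees n < p matter, where n is invertible, so J must meet R, and
    then J contains 1 by simplicity of R. For V = W + W^* the same argument is run twice, first
    for the degree in W and then for the degree in W^*. That R (x) A(V) is not zero follows from
    Wick's formula, which gives a morphism A(V) -> 1 preserving units.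

    An ind-object X is handled through its functor of points Z |-> colim_j Hom(Z, X_j);
    ind-subobjects correspond to the subfunctors that satisfy descent along epimorphisms. *)

Require Import Defs.
From mathcomp Require Import all_boot all_order all_algebra.
From mathcomp Require Import boolp.
From HB Require Import structures.
Local Open Scope ring_scope.

Set Implicit Arguments.
Unset Strict Implicit.
Unset Printing Implicit Defensive.

Import GRing.Theory.

(** * Coherence on right-nested tensor products *)

Section Coherence.
Variables (k : fieldType) (C : symTensorCat k).
Local Notation M := (stc_mon C).
Local Notation Ab := (stc_ab C).
Local Notation "'\1'" := (unit_ob M).
Local Notation alpha := (assoc M).
Local Notation alphaV := (assocV M).
Local Notation br := (braid M).
Local Notation "X '^*'" := (dual (stc_rigid C) X).
Implicit Types X Y Z W : C.

(** Objects of C have no elements, so the computation runs on generalized points: a variable v in V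
    becomes a single point w over V, a bracket with V of a point over Z is a point over V (x) Z, and
    the sum over dual bases becomes the insertion of a copairing. Spans and images contain a point
    only after an epimorphism, hence the constant use of descent.

    A is given by a universal property, with no basis of monomials at hand. The degree is therefore
    replaced by an increasing filtration by word length. Letters commute modulo words shorter by
    two, so words of length p factor through S^p V modulo shorter ones; if S^p V = 0, the filtration
    stops growing at p.

    For V = W + W^* the hypothesis does not give S^p V = 0, since S^p V has the summands S^i W (x)
    S^{p-i} W^* with 0 < i < p. This is why the degrees in W and in W^* are lowered separately;
    within W, and within W^*, letters commute exactly.

    Wick's formula contracts with half the form: exchanging two letters contracts them twice. Here
    characteristic 2 is excluded. *)

Lemma rewr_comp X Y Z (f : mor Y Z) (g : mor X Y) (h : mor X Z) :
  f \oc g = h -> forall T (x : mor T X), f \oc (g \oc x) = h \oc x.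
Proof. by move=> <- T x; rewrite mcompA. Qed.

Lemma mcompN X Y Z (g : mor Y Z) (f : mor X Y) : g \oc (- f) = - (g \oc f).
Proof. by rewrite -scaleN1r mcompZr scaleN1r. Qed.

Lemma mcompNl X Y Z (g : mor Y Z) (f : mor X Y) : (- g) \oc f = - (g \oc f).
Proof. by rewrite -scaleN1r mcompZl scaleN1r. Qed.

Lemma tensNr X X' Y Y' (f : mor X X') (g : mor Y Y') : f \ox (- g) = - (f \ox g).
Proof. by rewrite -scaleN1r tensmZr scaleN1r. Qed.

Lemma tensNl X X' Y Y' (f : mor X X') (g : mor Y Y') : (- f) \ox g = - (f \ox g).
Proof. by rewrite -scaleN1r tensmZl scaleN1r. Qed.

Lemma tens1_comp X Y Y' Y'' (g : mor Y' Y'') (f : mor Y Y') :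
  idm X \ox (g \oc f) = (idm X \ox g) \oc (idm X \ox f).
Proof. by rewrite -tensm_comp mcomp1m. Qed.

Lemma tens_comp1 X Y Y' Y'' (g : mor Y' Y'') (f : mor Y Y') :
  (g \oc f) \ox idm X = (g \ox idm X) \oc (f \ox idm X).
Proof. by rewrite -tensm_comp mcomp1m. Qed.

Lemma tens_lr X X' Y Y' (f : mor X X') (g : mor Y Y') :
  f \ox g = (f \ox idm Y') \oc (idm X \ox g).
Proof. by rewrite -tensm_comp mcomp1m mcompm1. Qed.

Lemma tens_rl X X' Y Y' (f : mor X X') (g : mor Y Y') :
  f \ox g = (idm X' \ox g) \oc (f \ox idm Y).
Proof. by rewrite -tensm_comp mcomp1m mcompm1. Qed.

Lemma tens_swap X X' Y Y' (f : mor X X') (g : mor Y Y') :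
  (idm X' \ox g) \oc (f \ox idm Y) = (f \ox idm Y') \oc (idm X \ox g).
Proof. by rewrite -tens_rl -tens_lr. Qed.

Lemma retraction_cancel X Y Z (f : mor Y Z) (f' : mor Z Y) (g h : mor X Y) :
  f' \oc f = idm Y -> f \oc g = f \oc h -> g = h.
Proof. by move=> e eq; rewrite -[g]mcomp1m -e -mcompA eq mcompA e mcomp1m. Qed.

Lemma section_cancel X Y Z (f : mor X Y) (f' : mor Y X) (g h : mor Y Z) :
  f \oc f' = idm Y -> g \oc f = h \oc f -> g = h.
Proof. by move=> e eq; rewrite -[g]mcompm1 -e mcompA eq -mcompA e mcompm1. Qed.

Lemma lunitV_nat X X' (f : mor X X') :
  lunitV M X' \oc f = (idm \1 \ox f) \oc lunitV M X.
Proof.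
apply: (section_cancel (lunitVK M X)).
by rewrite -!mcompA lunitK mcompm1 -lunit_nat mcompA lunitK mcomp1m.
Qed.

Lemma runitV_nat X X' (f : mor X X') :
  runitV M X' \oc f = (f \ox idm \1) \oc runitV M X.
Proof.
apply: (section_cancel (runitVK M X)).
by rewrite -!mcompA runitK mcompm1 -runit_nat mcompA runitK mcomp1m.
Qed.

Lemma tens1_inj X Y (f g : mor X Y) : idm \1 \ox f = idm \1 \ox g -> f = g.
Proof.
by move=> e; apply: (section_cancel (lunitVK M X)); rewrite -!lunit_nat e.
Qed.

Lemma tens1r_inj X Y (f g : mor X Y) : f \ox idm \1 = g \ox idm \1 -> f = g.
Proof.
by move=> e; apply: (section_cancel (runitVK M X)); rewrite -!runit_nat e.
Qed.

Lemma pentagon' X Y Z T :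
  (idm X \ox alpha Y Z T) \oc (alpha X (Y \oX Z) T \oc (alpha X Y Z \ox idm T)) =
  alpha X Y (Z \oX T) \oc alpha (X \oX Y) Z T.
Proof. by rewrite pentagon mcompA. Qed.

Lemma pentagonT X Y Z T S (x : mor S _) :
  (idm X \ox alpha Y Z T) \oc
    (alpha X (Y \oX Z) T \oc ((alpha X Y Z \ox idm T) \oc x)) =
  alpha X Y (Z \oX T) \oc (alpha (X \oX Y) Z T \oc x).
Proof. by rewrite [RHS]mcompA -pentagon' -!mcompA. Qed.

(* Kelly: tensor with 1 on the left and use the pentagon at (1, 1, X, Y) and the triangle. *)
Lemma lunit_assoc X Y : lunit M (X \oX Y) \oc alpha \1 X Y = lunit M X \ox idm Y.
Proof.
apply: tens1_inj; rewrite tens1_comp.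
have e0 : idm (\1 \oX (\1 \oX X \oX Y)) =
   alpha _ _ _ \oc (alpha \1 \1 X \ox idm Y) \oc
     ((alphaV \1 \1 X \ox idm Y) \oc alphaV _ _ _).
  rewrite -!mcompA (rewr_comp (esym (tens_comp1 _ _ _))) assocVK tensm1 mcomp1m.
  by rewrite assocVK.
rewrite -[LHS]mcompm1 -[RHS]mcompm1 e0 !(mcompA _ _ (_ \oc alphaV _ _ _)); congr (_ \oc _).
rewrite -!mcompA pentagon' mcompA triangle.
rewrite -tensm1 -(assoc_nat M (runit M \1) (idm X) (idm Y)).
rewrite mcompA -(assoc_nat M (idm \1) (lunit M X) (idm Y)) -mcompA -tens_comp1.
by rewrite triangle.
Qed.

(** Mirror image of [lunit_assoc], from the pentagon at (X, Y, 1, 1). *)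
Lemma runit_assoc X Y :
  (idm X \ox runit M Y) \oc alpha X Y \1 = runit M (X \oX Y).
Proof.
apply: tens1r_inj; rewrite tens_comp1 -[RHS]triangle.
apply: (retraction_cancel (assocK M _ _ _)).
rewrite mcompA assoc_nat -triangle tens1_comp -!mcompA pentagon'.
by rewrite [RHS]mcompA -tensm1 assoc_nat -mcompA.
Qed.

Lemma lunit_unit : lunit M \1 = runit M \1.
Proof.
apply: tens1r_inj; rewrite -lunit_assoc -triangle.
congr (_ \oc _); apply: (retraction_cancel (lunitK M _)).
by rewrite lunit_nat.
Qed.

Lemma lunitV_assoc X Y : alpha \1 X Y \oc (lunitV M X \ox idm Y) = lunitV M (X \oX Y).
Proof.
apply: (retraction_cancel (lunitK M _)).
by rewrite mcompA lunit_assoc -tens_comp1 !lunitVK tensm1.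
Qed.

Lemma runitV_assoc X Y : alphaV X Y \1 \oc (idm X \ox runitV M Y) = runitV M (X \oX Y).
Proof.
apply: (retraction_cancel (runitK M _)).
rewrite runitVK mcompA -runit_assoc -!mcompA (rewr_comp (assocVK M _ _ _)) mcomp1m.
by rewrite -tens1_comp runitVK tensm1.
Qed.

Lemma triangleV X Y : alpha X \1 Y \oc (runitV M X \ox idm Y) = idm X \ox lunitV M Y.
Proof.
have e : (idm X \ox lunitV M Y) \oc (idm X \ox lunit M Y) = idm _.
  by rewrite -tens1_comp lunitK tensm1.
apply: (retraction_cancel e).
by rewrite mcompA triangle -tens_comp1 -tens1_comp runitVK lunitVK !tensm1.
Qed.

Lemma pentagonV X Y Z T :
  (idm X \ox alphaV Y Z T) \oc alpha X Y (Z \oX T) =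
  alpha X (Y \oX Z) T \oc ((alpha X Y Z \ox idm T) \oc alphaV (X \oX Y) Z T).
Proof.
have e : (idm X \ox alphaV Y Z T) \oc (idm X \ox alpha Y Z T) = idm _.
  by rewrite -tens1_comp assocK tensm1.
have e' : (idm X \ox alpha Y Z T) \oc (idm X \ox alphaV Y Z T) = idm _.
  by rewrite -tens1_comp assocVK tensm1.
apply: (retraction_cancel e); rewrite (rewr_comp e') mcomp1m.
apply: (section_cancel (assocVK M _ _ _)).
by rewrite -!mcompA assocK mcompm1 -pentagon'.
Qed.

(* Structural maps are compared on right-nested products X (x) (Y (x) (Z (x) ...)), where
   associators disappear: [sw] exchanges the first two factors, [ct b] contracts them
   with a form b, and [cz] below inserts a copairing in front. These maps are locked since
   rewriting with [mcompA] would otherwise unfold them. *)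
Fact sw_key : unit. Proof. by []. Qed.
Definition sw X Y Z : mor (X \oX (Y \oX Z)) (Y \oX (X \oX Z)) :=
  locked_with sw_key (alpha Y X Z \oc (br X Y \ox idm Z) \oc alphaV X Y Z).

Lemma sw_nat X X' Y Y' Z Z' (f : mor X X') (g : mor Y Y') (h : mor Z Z') :
  sw X' Y' Z' \oc (f \ox (g \ox h)) = (g \ox (f \ox h)) \oc sw X Y Z.
Proof.
rewrite /sw !locked_withE -!mcompA assocV_nat (rewr_comp (esym (tensm_comp _ _ _ _ _))) braid_nat.
by rewrite mcomp1m -[h in LHS]mcompm1 tensm_comp !mcompA assoc_nat.
Qed.

Lemma sw_sym X Y Z : sw Y X Z \oc sw X Y Z = idm _.
Proof.
rewrite /sw !locked_withE -!mcompA (rewr_comp (assocK M _ _ _)) mcomp1m.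
rewrite (rewr_comp (esym (tens_comp1 _ _ _))).
by rewrite braid_sym tensm1 mcomp1m assocVK.
Qed.

Lemma swE X Y Z : sw X Y Z \oc alpha X Y Z = alpha Y X Z \oc (br X Y \ox idm Z).
Proof. by rewrite /sw !locked_withE -!mcompA assocK mcompm1. Qed.

Fact ic_key : unit. Proof. by []. Qed.
Definition ic X Y Z W := locked_with ic_key (Defs.interchange X Y Z W).

Lemma ic_interchange X Y Z W : ic X Y Z W = Defs.interchange X Y Z W.
Proof. by rewrite /ic locked_withE. Qed.

Lemma icE X Y Z W :
  ic X Y Z W =
  alphaV X Z (Y \oX W) \oc (idm X \ox sw Y Z W) \oc alpha X Y (Z \oX W).
Proof. by rewrite /ic /sw !locked_withE. Qed.

Lemma hexagon_sw X Y Z :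
  alpha Y Z X \oc br X (Y \oX Z) = (idm Y \ox br X Z) \oc sw X Y Z.
Proof.
apply: (section_cancel (assocVK M _ _ _)).
by rewrite hexagon -[in RHS]mcompA swE mcompA.
Qed.

Lemma sw_tail X Y Z T :
  (idm Y \ox alpha X Z T) \oc (alpha Y (X \oX Z) T \oc (sw X Y Z \ox idm T)) =
  sw X Y (Z \oX T) \oc ((idm X \ox alpha Y Z T) \oc alpha X (Y \oX Z) T).
Proof.
have e : (alpha X Y Z \ox idm T) \oc (alphaV X Y Z \ox idm T) = idm _.
  by rewrite -tens_comp1 assocVK tensm1.
apply: (section_cancel e).
rewrite -!mcompA -tens_comp1 swE tens_comp1 (mcompA (alpha _ _ _)) mcompA pentagon'.
rewrite [in RHS]pentagon' [RHS]mcompA swE -!mcompA.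
by rewrite -[idm (Z \oX T)](tensm1 M) assoc_nat.
Qed.

Lemma sw_lunit X Z : lunit M (X \oX Z) \oc sw X \1 Z = idm X \ox lunit M Z.
Proof.
apply: (retraction_cancel (braid_sym M _ _)).
rewrite [RHS]braid_nat -lunit_assoc -mcompA hexagon_sw [RHS]mcompA lunit_nat.
by rewrite -mcompA.
Qed.

Lemma sw_unit Y Z : sw \1 Y Z \oc lunitV M (Y \oX Z) = idm Y \ox lunitV M Z.
Proof.
apply: (retraction_cancel (f := idm Y \ox lunit M Z) (f' := idm Y \ox lunitV M Z)).
  by rewrite -tens1_comp lunitK tensm1.
rewrite -[in LHS]sw_lunit -mcompA (rewr_comp (sw_sym _ _ _)) mcomp1m lunitVK.
by rewrite -tens1_comp lunitVK tensm1.
Qed.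

(** The hexagon once more: passing a product means passing its factors one after the other.
    [sw_tensl] follows by inverting both sides. *)
Lemma sw_tensr X Y Y' Z :
  alpha Y Y' (X \oX Z) \oc sw X (Y \oX Y') Z =
  (idm Y \ox sw X Y' Z) \oc (sw X Y (Y' \oX Z) \oc (idm X \ox alpha Y Y' Z)).
Proof.
apply: (section_cancel (assocVK M _ _ _)).
rewrite -!mcompA swE mcompA -pentagon' -!mcompA -tens_comp1 hexagon_sw tens_comp1.
rewrite (mcompA (alpha _ _ _)) assoc_nat -!mcompA (rewr_comp (esym (tens1_comp _ _ _))).
by rewrite -swE tens1_comp -!mcompA sw_tail.
Qed.

Lemma sw_tensl X X' Y Z :
  (idm Y \ox alpha X X' Z) \oc sw (X \oX X') Y Z =
  sw X Y (X' \oX Z) \oc ((idm X \ox sw X' Y Z) \oc alpha X X' (Y \oX Z)).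
Proof.
apply: (section_cancel (sw_sym _ _ _)).
rewrite -!mcompA sw_tensr sw_sym mcompm1 (rewr_comp (esym (tens1_comp _ _ _))).
by rewrite sw_sym tensm1 mcomp1m (rewr_comp (sw_sym _ _ _)) mcomp1m.
Qed.

Lemma sw_braid X Y :
  (idm Y \ox runit M X) \oc (sw X Y \1 \oc (idm X \ox runitV M Y)) = br X Y.
Proof.
rewrite /sw locked_withE -!mcompA runitV_assoc -runitV_nat mcompA runit_assoc mcompA.
by rewrite runitVK mcomp1m.
Qed.

Fact ct_key : unit. Proof. by []. Qed.
Definition ct X Y (b : mor (X \oX Y) \1) Z : mor (X \oX (Y \oX Z)) Z :=
  locked_with ct_key (lunit M Z \oc (b \ox idm Z) \oc alphaV X Y Z).

Lemma ctE X Y (b : mor (X \oX Y) \1) Z :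
  ct b Z \oc alpha X Y Z = lunit M Z \oc (b \ox idm Z).
Proof. by rewrite /ct locked_withE -!mcompA assocK mcompm1. Qed.

Lemma ct_nat X Y (b : mor (X \oX Y) \1) Z Z' (f : mor Z Z') :
  ct b Z' \oc (idm X \ox (idm Y \ox f)) = f \oc ct b Z.
Proof.
rewrite /ct !locked_withE -!mcompA assocV_nat tensm1 (mcompA (b \ox _)) -tens_lr tens_rl.
by rewrite !mcompA lunit_nat.
Qed.

Lemma ct_braid X Y (b : mor (Y \oX X) \1) Z :
  ct b Z \oc sw X Y Z = ct (b \oc br X Y) Z.
Proof.
apply: (section_cancel (assocVK M _ _ _)).
by rewrite -mcompA swE mcompA !ctE tens_comp1 mcompA.
Qed.

(** Naturality of the braiding with respect to [b], since moving T across the unit object does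
    nothing. *)
Lemma ct_sw X Y (b : mor (X \oX Y) \1) T Z :
  (idm T \ox ct b Z) \oc (sw X T (Y \oX Z) \oc (idm X \ox sw Y T Z)) = ct b (T \oX Z).
Proof.
apply: (section_cancel (assocVK M _ _ _)).
rewrite -!mcompA -sw_tensl (rewr_comp (esym (tens1_comp _ _ _))) ctE tens1_comp -mcompA.
rewrite -sw_nat tensm1 mcompA -sw_lunit -!mcompA.
by rewrite (rewr_comp (sw_sym _ _ _)) mcomp1m ctE.
Qed.

(** Naturality of [sw (X \oX Y) Z] in its first factor, applied to the braiding of X and Y. *)
Lemma yang_baxter X Y Z T :
  (idm Z \ox sw X Y T) \oc (sw X Z (Y \oX T) \oc (idm X \ox sw Y Z T)) =
  sw Y Z (X \oX T) \oc ((idm Y \ox sw X Z T) \oc sw X Y (Z \oX T)).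
Proof.
apply: (section_cancel (assocVK M _ _ _)).
rewrite -!mcompA -sw_tensl (rewr_comp (esym (tens1_comp _ _ _))) !swE tens1_comp -mcompA.
rewrite -sw_nat tensm1 [LHS]mcompA sw_tensl -!mcompA.
by [].
Qed.

Lemma sw_runitV X Y : sw X Y \1 \oc (idm X \ox runitV M Y) = (idm Y \ox runitV M X) \oc br X Y.
Proof. by rewrite -sw_braid (rewr_comp (esym (tens1_comp _ _ _))) runitK tensm1 mcomp1m. Qed.

Lemma ct0 X Y Z : ct (0 : mor (X \oX Y) \1) Z = 0.
Proof. by rewrite /ct locked_withE tensm0l mcomp0r mcomp0l. Qed.

Lemma ctN X Y (b : mor (Y \oX X) \1) Z : ct (- b) Z = - ct b Z.
Proof.
rewrite /ct !locked_withE -!mcompA -scaleN1r tensmZl mcompZl mcompZr.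
by rewrite scaleN1r.
Qed.

Lemma ctD X Y (b b' : mor (Y \oX X) \1) Z : ct (b + b') Z = ct b Z + ct b' Z.
Proof. by rewrite /ct !locked_withE tensmDl mcompDr mcompDl. Qed.

Lemma ct_tail X Y (b : mor (X \oX Y) \1) Z T :
  ct b (Z \oX T) \oc ((idm X \ox alpha Y Z T) \oc alpha X (Y \oX Z) T) =
  ct b Z \ox idm T.
Proof.
apply: (section_cancel (f := alpha X Y Z \ox idm T) (f' := alphaV X Y Z \ox idm T)).
  by rewrite -tens_comp1 assocVK tensm1.
rewrite -!mcompA pentagon' mcompA ctE -tens_comp1 ctE tens_comp1 -lunit_assoc.
by rewrite -!mcompA assoc_nat tensm1.
Qed.

Lemma ct_runit X Y (b : mor (X \oX Y) \1) :
  ct b \1 \oc (idm X \ox runitV M Y) = b.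
Proof.
rewrite /ct locked_withE -!mcompA runitV_assoc lunit_unit mcompA runit_nat -mcompA.
by rewrite runitVK mcompm1.
Qed.

Section Copairing.
Variables (X Y : C) (b : mor (Y \oX X) \1) (eta : mor \1 (X \oX Y)).
Hypothesis zig :
  runit M X \oc (idm X \ox b) \oc alpha X Y X \oc (eta \ox idm X) = lunit M X.

Fact cz_key : unit. Proof. by []. Qed.
Definition cz Z : mor Z (X \oX (Y \oX Z)) :=
  locked_with cz_key (alpha X Y Z \oc (eta \ox idm Z) \oc lunitV M Z).

Lemma czE Z : cz Z = alpha X Y Z \oc (eta \ox idm Z) \oc lunitV M Z.
Proof. by rewrite /cz locked_withE. Qed.

Lemma cz_nat Z Z' (f : mor Z Z') :
  cz Z' \oc f = (idm X \ox (idm Y \ox f)) \oc cz Z.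
Proof.
rewrite !czE -!mcompA lunitV_nat (mcompA (eta \ox _)) -tens_lr tens_rl.
by rewrite -(tensm1 M X Y) !mcompA assoc_nat.
Qed.

(** Right-nested form of [zig]. It is what makes the leading term of the Euler operator give back
    the word itself. *)
Lemma cz_ct Z : (idm X \ox ct b Z) \oc cz (X \oX Z) = idm _.
Proof.
rewrite czE /ct locked_withE !tens1_comp -!mcompA (rewr_comp (pentagonV _ _ _ _)).
rewrite -!mcompA (rewr_comp (esym (assoc_nat _ _ _ _))) -!mcompA (mcompA (idm X \ox lunit M Z)).
rewrite triangle -[in eta \ox _](tensm1 M X Z) (rewr_comp (assocV_nat _ _ _)) -mcompA.
rewrite !(rewr_comp (esym (tens_comp1 _ _ _))) zig.
by rewrite -lunit_assoc -mcompA (rewr_comp (assocVK M _ _ _)) mcomp1m lunitVK.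
Qed.

Lemma cz_sw Z T : 
  sw X T (Y \oX Z) \oc ((idm X \ox sw Y T Z) \oc cz (T \oX Z)) = idm T \ox cz Z.
Proof.
rewrite !czE -!mcompA !(mcompA (idm X \ox _)) (mcompA (sw _ _ _)) -sw_tensl.
rewrite -!mcompA -(tensm1 M T Z) (rewr_comp (sw_nat _ _ _)) -!mcompA sw_unit.
by rewrite !tens1_comp.
Qed.

End Copairing.

End Coherence.

(** * Interchange of factors, duality, and tensoring of epimorphisms *)

Section BraidedCoherence.
Variables (k : fieldType) (C : symTensorCat k).
Local Notation M := (stc_mon C).
Local Notation Ab := (stc_ab C).
Local Notation "'\1'" := (unit_ob M).
Local Notation alpha := (assoc M).
Local Notation alphaV := (assocV M).
Local Notation br := (braid M).
Local Notation Dl X := (dual (stc_rigid C) X).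
Local Notation ev := (ev (stc_rigid C)).
Local Notation coev := (coev (stc_rigid C)).
Implicit Types X Y Z W A S : C.

Lemma assoc_ic X Y Z W :
  alpha X Z (Y \oX W) \oc ic X Y Z W =
  (idm X \ox sw Y Z W) \oc alpha X Y (Z \oX W).
Proof. by rewrite icE -!mcompA (rewr_comp (assocVK M _ _ _)) mcomp1m. Qed.

Lemma ic_assoc_r A1 X2 A2 X3 A3 :
  alpha X2 X3 (A1 \oX (A2 \oX A3)) \oc (sw A1 (X2 \oX X3) (A2 \oX A3) \oc
    (idm A1 \ox ic X2 A2 X3 A3)) =
  (idm X2 \ox (sw A1 X3 (A2 \oX A3) \oc (idm A1 \ox sw A2 X3 A3))) \oc
    (sw A1 X2 (A2 \oX (X3 \oX A3)) \oc (idm A1 \ox alpha X2 A2 (X3 \oX A3))).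
Proof.
rewrite mcompA sw_tensr -!mcompA -tens1_comp assoc_ic tens1_comp.
by rewrite (rewr_comp (sw_nat _ _ _)) -!mcompA tens1_comp -!mcompA.
Qed.

Lemma ic_assoc_l X1 A1 X2 A2 S :
  (idm X1 \ox (idm X2 \ox alpha A1 A2 S)) \oc
  (alpha X1 X2 ((A1 \oX A2) \oX S) \oc
  (alpha (X1 \oX X2) (A1 \oX A2) S \oc (ic X1 A1 X2 A2 \ox idm S))) =
  (idm X1 \ox (sw A1 X2 (A2 \oX S) \oc (idm A1 \ox alpha X2 A2 S))) \oc
  (alpha X1 A1 ((X2 \oX A2) \oX S) \oc alpha (X1 \oX A1) (X2 \oX A2) S).
Proof.
rewrite (mcompA (alpha X1 _ _)) -pentagon' -!mcompA -tens_comp1 assoc_ic.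
rewrite tens_comp1 (rewr_comp (assoc_nat _ _ _ _)) -mcompA.
rewrite !(rewr_comp (esym (tens1_comp _ _ _))) -mcompA sw_tail.
by rewrite !tens1_comp -!mcompA pentagon'.
Qed.

(** The coherence behind associativity of a tensor product of algebras. On right-nested products
    [ic_assoc_r] and [ic_assoc_l] resolve each interchange into moves of single factors. *)
Lemma ic_assoc X1 A1 X2 A2 X3 A3 :
  (alpha X1 X2 X3 \ox alpha A1 A2 A3) \oc
    (ic (X1 \oX X2) (A1 \oX A2) X3 A3 \oc
      (ic X1 A1 X2 A2 \ox idm (X3 \oX A3))) =
  ic X1 A1 (X2 \oX X3) (A2 \oX A3) \oc
    ((idm (X1 \oX A1) \ox ic X2 A2 X3 A3) \oc
      alpha (X1 \oX A1) (X2 \oX A2) (X3 \oX A3)).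
Proof.
apply: (retraction_cancel (assocK M _ _ _)).
rewrite (rewr_comp (assoc_ic _ _ _ _)) -(tensm1 M X1 A1) -!mcompA.
rewrite (rewr_comp (assoc_nat _ _ _ _)).
have e : (idm X1 \ox alphaV X2 X3 (A1 \oX (A2 \oX A3))) \oc
   (idm X1 \ox alpha X2 X3 (A1 \oX (A2 \oX A3))) = idm _.
  by rewrite -tens1_comp assocK tensm1.
apply: (retraction_cancel e).
rewrite -!mcompA !(rewr_comp (esym (tens1_comp _ _ _))) -!mcompA ic_assoc_r.
rewrite [in RHS]tens1_comp -[RHS]mcompA -[in RHS]ic_assoc_l.
rewrite [alpha X1 X2 X3 \ox _]tens_lr -!mcompA pentagonT.
rewrite -(tensm1 M (X1 \oX X2) X3) (rewr_comp (assoc_nat _ _ _ _)) -mcompA.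
rewrite (rewr_comp (assoc_ic _ _ _ _)) -mcompA (rewr_comp (esym (tens1_comp _ _ _))) sw_tensl.
rewrite -(tensm1 M X1 X2) (rewr_comp (assoc_nat _ _ _ _)) -mcompA.
by rewrite (rewr_comp (esym (tens1_comp _ _ _))) -tens1_comp -!mcompA.
Qed.

Lemma ic_1l V X Y :
  (lunit M X \ox idm (V \oX Y)) \oc
    (ic \1 V X Y \oc (lunitV M V \ox idm (X \oX Y))) = sw V X Y.
Proof.
rewrite icE -!mcompA lunitV_assoc -lunitV_nat -lunit_assoc -mcompA.
by rewrite (rewr_comp (assocVK M _ _ _)) mcomp1m mcompA lunitVK mcomp1m.
Qed.

Lemma ic_1r V X Y :
  (runit M X \ox idm (Y \oX V)) \oc
    (ic X Y \1 V \oc (idm (X \oX Y) \ox lunitV M V)) = alpha X Y V.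
Proof.
rewrite icE -!mcompA -(tensm1 M X Y) assoc_nat.
rewrite (rewr_comp (esym (tens1_comp _ _ _))) -[sw _ _ _]mcompm1.
have e : idm Y \ox lunitV M V = sw \1 Y V \oc lunitV M (Y \oX V) by rewrite sw_unit.
rewrite mcompm1 {}e (mcompA (sw _ _ _)) sw_sym mcomp1m -triangle -mcompA.
rewrite (rewr_comp (assocVK M _ _ _)) mcomp1m (rewr_comp (esym (tens1_comp _ _ _))).
by rewrite lunitVK tensm1 mcomp1m.
Qed.

Lemma ic_unitR X Y :
  (idm (X \oX Y) \ox lunit M \1) \oc
    (ic X \1 Y \1 \oc (runitV M X \ox runitV M Y)) = runitV M (X \oX Y).
Proof.
rewrite icE [runitV M X \ox _]tens_lr -!mcompA (rewr_comp (triangleV _ _)).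
rewrite -!tens1_comp (mcompA (sw _ _ _)) sw_unit tens1_comp.
rewrite (rewr_comp (assocV_nat _ _ _)) -mcompA tensm1 (rewr_comp (esym (tens1_comp _ _ _))).
rewrite lunitVK tensm1 mcomp1m -[RHS]runitV_assoc.
by [].
Qed.

Lemma braid_tensl X Y Z :
  br (X \oX Y) Z = sw X Z Y \oc ((idm X \ox br Y Z) \oc alpha X Y Z).
Proof.
apply: (retraction_cancel (braid_sym M _ _)); rewrite braid_sym.
apply: (retraction_cancel (assocK M _ _ _)); rewrite mcompm1 mcompA hexagon_sw -mcompA.
rewrite (rewr_comp (sw_sym _ _ _)) mcomp1m (rewr_comp (esym (tens1_comp _ _ _))).
by rewrite braid_sym tensm1 mcomp1m.
Qed.

Lemma lunit_braid X : lunit M X \oc br X \1 = runit M X.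
Proof.
rewrite -sw_braid mcompA lunit_nat -mcompA (mcompA (lunit M _)) sw_lunit.
by rewrite -tens1_comp lunit_unit runitVK tensm1 mcompm1.
Qed.

Lemma runit_braid X : runit M X \oc br \1 X = lunit M X.
Proof. by rewrite -lunit_braid -mcompA braid_sym mcompm1. Qed.

Lemma epiP X Y (f : mor X Y) :
  (forall Z (g : mor Y Z), g \oc f = 0 -> g = 0) -> epi f.
Proof.
move=> H Z g h e; apply/eqP; rewrite -subr_eq0; apply/eqP/H.
by rewrite mcompDl mcompNl e subrr.
Qed.

(** Transposition for the adjunction between - (x) X and - (x) X^*. *)
Definition curry Y X Z (g : mor (Y \oX X) Z) : mor Y (Z \oX Dl X) :=
  (g \ox idm _) \oc (alphaV Y X (Dl X) \oc ((idm Y \ox coev X) \oc runitV M Y)).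

Lemma curryK Y X Z (g : mor (Y \oX X) Z) :
  runit M Z \oc ((idm Z \ox ev X) \oc (alpha Z (Dl X) X \oc (curry g \ox idm X))) = g.
Proof.
rewrite /curry !tens_comp1 (mcompA (alpha _ _ _)) assoc_nat tensm1 -!mcompA.
rewrite (mcompA (idm Z \ox _)) tens_swap -!mcompA (mcompA (runit _ _)) runit_nat.
rewrite -mcompA -runit_assoc -(tensm1 M Y X) -mcompA (mcompA (alpha Y _ _)) assoc_nat.
rewrite -!mcompA (mcompA (alpha Y _ _)) -pentagon' -!mcompA.
have e : (alpha Y X (Dl X) \ox idm X) \oc (alphaV Y X (Dl X) \ox idm X) = idm _.
  by rewrite -tens_comp1 assocVK tensm1.
rewrite (rewr_comp e) mcomp1m (mcompA (alpha Y _ _)) assoc_nat -mcompA triangleV.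
rewrite -!tens1_comp !mcompA zigzag lunitVK tensm1.
by rewrite mcompm1.
Qed.

Lemma curry_nat Y Y' X Z (g : mor (Y \oX X) Z) (e : mor Y' Y) :
  curry (g \oc (e \ox idm X)) = curry g \oc e.
Proof.
rewrite /curry tens_comp1 -!mcompA; congr (_ \oc _).
rewrite runitV_nat (mcompA _ (e \ox _)) tens_swap -!mcompA -(tensm1 M X (Dl X)).
by rewrite !mcompA assocV_nat.
Qed.

(** The functor - (x) X has a right adjoint, and left adjoints preserve epimorphisms. This makes
    descent compatible with multiplication and with brackets. *)
Lemma epi_tensr X Y Y' (e : mor Y Y') : epi e -> epi (e \ox idm X).
Proof.
move=> he Z g h eq; rewrite -[g]curryK -[h]curryK.
suff -> : curry g = curry h by [].
by apply: he; rewrite -!curry_nat eq.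
Qed.

Lemma epi_tensl X Y Y' (e : mor Y Y') : epi e -> epi (idm X \ox e).
Proof.
move=> he Z g h eq; apply: (section_cancel (braid_sym M X Y')).
apply: (epi_tensr (X := X) he); rewrite -!mcompA.
by rewrite !braid_nat !mcompA eq.
Qed.

Lemma form_mapK V (B : mor (V \oX V) \1) : ev V \oc (form_map B \ox idm V) = B.
Proof.
have -> : form_map B = lunit M _ \oc curry B by rewrite /form_map /curry !mcompA.
rewrite tens_comp1 -lunit_assoc -[RHS]curryK -lunit_unit.
by rewrite [RHS]mcompA lunit_nat -!mcompA.
Qed.

(** The copairing is [coev] transported along the inverse of [form_map B]. *)
Lemma nondegenerate_zig V (B : mor (V \oX V) \1) : nondegenerate_form B ->
  exists eta : mor \1 (V \oX V),
  runit M V \oc (idm V \ox B) \oc alpha V V V \oc (eta \ox idm V) = lunit M V.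
Proof.
case=> psi [e1 e2]; exists ((idm V \ox psi) \oc coev V).
rewrite -[RHS](zigzag (stc_rigid C)) tens_comp1 -!mcompA (mcompA (alpha _ _ _)) assoc_nat.
rewrite -mcompA (mcompA (idm V \ox B)) -tens1_comp -{1}(form_mapK B) -mcompA.
by rewrite -tens_comp1 e2 tensm1 mcompm1.
Qed.

Lemma braid_reverse X Y :
  (idm Y \ox br X Y) \oc (alpha Y X Y \oc ((br X Y \ox idm Y) \oc br Y (X \oX Y))) =
  sw Y Y X \oc (idm Y \ox br X Y).
Proof.
rewrite !mcompA -hexagon -!mcompA hexagon_sw (mcompA (br X _)) braid_nat.
rewrite -mcompA mcompA -swE -mcompA (mcompA (alpha _ _ _)) hexagon_sw.
by rewrite -mcompA sw_sym mcompm1.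
Qed.

(** On W (x) W^* the pairing form is minus the braided evaluation. Its copairing is the braided
    coevaluation with the same sign, so the signs cancel and the braiding reflects [zigzag_dual]
    into the claim. *)
Lemma dual_zig W :
  runit M (Dl W) \oc (idm (Dl W) \ox (- (ev W \oc br W (Dl W)))) \oc
  alpha (Dl W) W (Dl W) \oc ((- (br W (Dl W) \oc coev W)) \ox idm (Dl W)) =
  lunit M (Dl W).
Proof.
set D := Dl W.
rewrite tensNr tensNl !mcompN !mcompNl opprK.
apply: (section_cancel (braid_sym M \1 D)); rewrite lunit_braid -[RHS](zigzag_dual (stc_rigid C)).
rewrite tens1_comp tens_comp1 -!mcompA -braid_nat.
rewrite (mcompA (br W D \ox _)) (mcompA (alpha _ _ _)) (mcompA (idm D \ox br W D)).
rewrite braid_reverse -!mcompA -tens1_comp.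
have -> : sw D D W \oc (idm D \ox (br W D \oc coev W)) =
    br (D \oX W) D \oc (alphaV D W D \oc (idm D \ox coev W)).
  by rewrite braid_tensl -!mcompA (rewr_comp (assocVK M _ _ _)) mcomp1m -tens1_comp.
by rewrite (mcompA (idm D \ox _)) -braid_nat -!mcompA (mcompA (runit M D)) runit_braid.
Qed.

End BraidedCoherence.

(** * Ind-objects through their points *)

Section AbelianFacts.
Variables (k : fieldType) (C : symTensorCat k).
Local Notation Ab := (stc_ab C).
Implicit Types X Y Z : C.

Lemma zero_ob_mor X Y (f : mor X Y) : is_zero_ob X -> f = 0.
Proof. by move=> z; rewrite -[f]mcompm1 z mcomp0r. Qed.

Lemma coker0_epi X Y (f : mor X Y) : is_zero_ob (coker Ab f) -> epi f.
Proof.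
move=> z; apply: epiP => Z g g0.
have [_ /(_ Z g g0) [h [<- _]]] := cokerP Ab f.
by rewrite (zero_ob_mor h z) mcomp0l.
Qed.

Lemma epi_descent X Y Z (e : mor X Y) (x : mor X Z) :
  epi e -> x \oc ker_in Ab e = 0 -> exists y, x = y \oc e.
Proof.
move=> /(epi_normal Ab) [W [g [ge0 uni]]] x0.
have [_ /(_ _ _ ge0) [h [eg _]]] := kerP Ab e.
have [|y [<- _]] := uni _ x; first by rewrite -eg mcompA x0 mcomp0l.
by exists y.
Qed.

Lemma ker_in_mono X Y (f : mor X Y) : mono (ker_in Ab f).
Proof.
move=> Z g h e; have [f0 /(_ Z (ker_in Ab f \oc g))] := kerP Ab f.
rewrite mcompA f0 mcomp0l => /(_ erefl) [u [_ uniq]].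
by rewrite (uniq g erefl) (uniq h (esym e)).
Qed.

Lemma mono_eq0 X Y Z (f : mor Y Z) (g : mor X Y) : mono f -> f \oc g = 0 -> g = 0.
Proof. by move=> mf e; apply: mf; rewrite e mcomp0r. Qed.

(** The image [m] is the kernel of the cokernel of [f]. If g kills [e], then [f] factors through the
    smaller subobject m o ker g, which is the kernel of some h; h kills [f], hence [m], so [m]
    itself factors through m o ker g. Thus ker g is split epi and g = 0. *)
Lemma image_factor X Y (f : mor X Y) :
  exists (I : C) (m : mor I Y) (e : mor X I), [/\ mono m, epi e & f = m \oc e].
Proof.
pose c := coker_pr Ab f; pose m := ker_in Ab c.
have [cf0 cuni] := cokerP Ab f; have [cm0 muni] := kerP Ab c.
have [e [me _]] := muni _ f cf0; exists (ker Ab c), m, e.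
have mm : mono m by exact: ker_in_mono.
split=> //; apply: epiP => Z g ge0.
have [ge kuni] := kerP Ab g; have [e' [ke _]] := kuni _ e ge0.
have mmk : mono (m \oc ker_in Ab g).
  move=> W u v; rewrite -!mcompA => /mm; exact: ker_in_mono.
have [W [h [hmk huni]]] := mono_normal Ab mmk.
have hf : h \oc f = 0.
  by rewrite -[X in h \oc X]me -ke (mcompA m) mcompA hmk mcomp0l.
have [h' [hh' _]] := cuni _ h hf.
have [|t [mt _]] := huni _ m; first by rewrite -hh' -mcompA cm0 mcomp0r.
have kt : ker_in Ab g \oc t = idm _.
  by apply: mm; rewrite mcompA mt mcompm1.
by rewrite -[g]mcompm1 -kt mcompA ge mcomp0l.
Qed.

End AbelianFacts.

(** * The functor of points and its additive structure *)

Section Points.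
Variables (k : fieldType) (C : symTensorCat k).
Implicit Types (X Y : indObj C) (Z W : C).

Definition rawpt X Z := {j : idx X & mor Z (X j)}.
Definition rawpt_eq X Z (a b : rawpt X Z) := germ_eq (projT2 a) (projT2 b).

(* [pts X Z] is colim_j Hom(Z, X_j). *)
Definition pts X Z := {c : rawpt X Z -> Prop | exists a, c = rawpt_eq a}.

HB.instance Definition _ X Z := gen_eqMixin (pts X Z).
HB.instance Definition _ X Z := gen_choiceMixin (pts X Z).

Definition cls X Z (j : idx X) (f : mor Z (X j)) : pts X Z :=
  exist _ (rawpt_eq (existT _ j f)) (ex_intro _ (existT _ j f) erefl).

Lemma clsP X Z (x : pts X Z) : exists j (f : mor Z (X j)), x = cls f.
Proof.
case: x => c ec; have [[j f] e] := ec; exists j, f; exact: eq_exist.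
Qed.

Lemma cls_eq X Z (j j' : idx X) (f : mor Z (X j)) (f' : mor Z (X j')) :
  cls f = cls f' <-> germ_eq f f'.
Proof.
split=> [[] | e].
  move/(congr1 (fun P => P (existT _ j' f'))) => e.
  rewrite -[germ_eq f f']/(rawpt_eq (existT _ j f) (existT _ j' f')) e.
  exact: germ_refl.
apply: eq_exist; apply/funext => a; apply/propext; split; apply: germ_trans => //.
exact: germ_sym.
Qed.

Lemma cls_tr X Z (j j' : idx X) (h : ile j j') (f : mor Z (X j)) :
  cls (tr h \oc f) = cls f.
Proof. exact/cls_eq/germ_tr. Qed.

Lemma clsP2 X Z W (x : pts X Z) (y : pts X W) :
  exists j (f : mor Z (X j)) (g : mor W (X j)), x = cls f /\ y = cls g.
Proof.
have [j [f ->]] := clsP x; have [j' [g ->]] := clsP y.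
have [l [h h']] := ile_directed j j'.
by exists l, (tr h \oc f), (tr h' \oc g); rewrite !cls_tr.
Qed.

Lemma cls_eq_level X Z (j : idx X) (f g : mor Z (X j)) :
  cls f = cls g -> exists l (h : ile j l), tr h \oc f = tr h \oc g.
Proof.
move/cls_eq=> [l [h [h' e]]]; exists l, h; rewrite e; congr (_ \oc _).
by rewrite -[tr h']mcomp1m -(tr_id (ile_refl l)) (tr_comp _ _ h).
Qed.

Definition rep X Z (x : pts X Z) : rawpt X Z :=
  projT1 (cid (let: ex_intro j (ex_intro f e) := clsP x in
    ex_intro (fun a : rawpt X Z => x = cls (projT2 a)) (existT _ j f) e)).

Lemma repK X Z (x : pts X Z) : cls (projT2 (rep x)) = x.
Proof. by rewrite /rep; case: cid => a /= ->. Qed.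

(* [pull] and the operations below are sealed behind opaque witnesses because unfolding
   them makes failed unifications very slow. *)
Fact pull_sig X Z W : {f : pts X Z -> mor W Z -> pts X W |
  forall x g, f x g = cls (projT2 (rep x) \oc g)}.
Proof. by exists (fun x g => cls (projT2 (rep x) \oc g)). Qed.

Definition pull X Z W (x : pts X Z) (g : mor W Z) : pts X W :=
  sval (pull_sig X Z W) x g.

Lemma pullE X Z W (j : idx X) (f : mor Z (X j)) (g : mor W Z) :
  pull (cls f) g = cls (f \oc g).
Proof. by rewrite /pull (svalP (pull_sig _ _ _)); apply/cls_eq/germ_comp/cls_eq; rewrite repK. Qed.

Lemma pull_comp X Z W S (x : pts X Z) (g : mor W Z) (h : mor S W) :
  pull (pull x g) h = pull x (g \oc h).
Proof. by have [j [f ->]] := clsP x; rewrite !pullE mcompA. Qed.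

Lemma pull_id X Z (x : pts X Z) : pull x (idm Z) = x.
Proof. by have [j [f ->]] := clsP x; rewrite !pullE mcompm1. Qed.

Lemma pts_add_ex X Z (x y : pts X Z) :
  exists z, exists j (f g : mor Z (X j)), [/\ x = cls f, y = cls g & z = cls (f + g)].
Proof.
have [j [f [g [-> ->]]]] := clsP2 x y.
by exists (cls (f + g)), j, f, g.
Qed.

Fact pts_add_key : unit. Proof. by []. Qed.
Definition pts_add X Z (x y : pts X Z) : pts X Z :=
  locked_with pts_add_key (projT1 (cid (pts_add_ex x y))).

Lemma pts_addE X Z (j : idx X) (f g : mor Z (X j)) :
  pts_add (cls f) (cls g) = cls (f + g).
Proof.
rewrite /pts_add locked_withE; case: cid => z /= [j' [f' [g' [e1 e2 ->]]]].
move/cls_eq: e1 => [l1 [h1 [h1' e1]]]; move/cls_eq: e2 => [l2 [h2 [h2' e2]]].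
have [l [m1 m2]] := ile_directed l1 l2.
apply/cls_eq; exists l, (ile_trans h1' m1), (ile_trans h1 m1).
rewrite !mcompDr -!(tr_comp _ m1 (ile_trans _ m1)) -!mcompA e1; congr (_ + _).
rewrite !mcompA (tr_comp h1' m1 (ile_trans h2' m2)) (tr_comp h1 m1 (ile_trans h2 m2)).
by rewrite -!(tr_comp _ m2 (ile_trans _ m2)) -!mcompA e2.
Qed.

Fact pts_opp_key : unit. Proof. by []. Qed.
Definition pts_opp X Z (x : pts X Z) : pts X Z :=
  locked_with pts_opp_key (cls (- projT2 (rep x))).

Lemma pts_oppE X Z (j : idx X) (f : mor Z (X j)) : pts_opp (cls f) = cls (- f).
Proof.
rewrite /pts_opp locked_withE; apply/cls_eq.
have /cls_eq [l [h [h' e]]] := repK (cls f).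
by exists l, h, h'; rewrite !mcompN e.
Qed.

Definition some_idx X : idx X := projT1 (cid (let: inhabits j := idx_nonempty X in
  ex_intro (fun=> True) j I)).
Definition pts_zero X Z : pts X Z := cls (0 : mor Z (X (some_idx X))).

Lemma cls0 X Z (j : idx X) : cls (0 : mor Z (X j)) = pts_zero X Z.
Proof.
have [l [h h']] := ile_directed j (some_idx X).
by apply/cls_eq; exists l, h, h'; rewrite !mcomp0r.
Qed.

Fact pts_addA X Z : associative (@pts_add X Z).
Proof.
move=> x y z; have [j [f [g [-> ->]]]] := clsP2 x y.
have [j' [h ->]] := clsP z; have [l [m m']] := ile_directed j j'.
by rewrite -(cls_tr m f) -(cls_tr m g) -(cls_tr m' h) !pts_addE addrA.
Qed.

Fact pts_addC X Z : commutative (@pts_add X Z).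
Proof.
by move=> x y; have [j [f [g [-> ->]]]] := clsP2 x y; rewrite !pts_addE addrC.
Qed.

Fact pts_add0 X Z : left_id (pts_zero X Z) (@pts_add X Z).
Proof. by move=> x; have [j [f ->]] := clsP x; rewrite -(cls0 Z j) pts_addE add0r. Qed.

Fact pts_addN X Z : left_inverse (pts_zero X Z) (@pts_opp X Z) (@pts_add X Z).
Proof.
by move=> x; have [j [f ->]] := clsP x; rewrite pts_oppE pts_addE addNr cls0.
Qed.

HB.instance Definition _ X Z := GRing.isZmodule.Build (pts X Z)
  (@pts_addA X Z) (@pts_addC X Z) (@pts_add0 X Z) (@pts_addN X Z).

Lemma clsD X Z (j : idx X) (f g : mor Z (X j)) : cls (f + g) = cls f + cls g.
Proof. by rewrite -pts_addE. Qed.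

Lemma clsN X Z (j : idx X) (f : mor Z (X j)) : cls (- f) = - cls f.
Proof. by rewrite -pts_oppE. Qed.

Lemma clsB X Z (j : idx X) (f g : mor Z (X j)) : cls (f - g) = cls f - cls g.
Proof. by rewrite clsD clsN. Qed.

Lemma cls_0 X Z (j : idx X) : cls (0 : mor Z (X j)) = 0.
Proof. exact: cls0. Qed.

Lemma cls_eq0 X Z (j : idx X) (f : mor Z (X j)) :
  cls f = 0 <-> exists l (h : ile j l), tr h \oc f = 0.
Proof.
split=> [|[l [h e]]]; last by rewrite -(cls_tr h) e cls_0.
by rewrite -(cls_0 Z j) => /cls_eq_level [l [h e]]; exists l, h; rewrite e mcomp0r.
Qed.

Lemma pullD X Z W (x y : pts X Z) (g : mor W Z) : pull (x + y) g = pull x g + pull y g.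
Proof.
have [j [f [f' [-> ->]]]] := clsP2 x y.
by rewrite -clsD !pullE mcompDl clsD.
Qed.

Lemma pullN X Z W (x : pts X Z) (g : mor W Z) : pull (- x) g = - pull x g.
Proof. by have [j [f ->]] := clsP x; rewrite -clsN !pullE mcompNl clsN. Qed.

Lemma pullB X Z W (x y : pts X Z) (g : mor W Z) : pull (x - y) g = pull x g - pull y g.
Proof. by rewrite pullD pullN. Qed.

Lemma pull0 X Z W (g : mor W Z) : pull (0 : pts X Z) g = 0.
Proof. by rewrite -(cls_0 Z (some_idx X)) pullE mcomp0l cls_0. Qed.

Lemma pullDr X Z W (x : pts X Z) (g h : mor W Z) : pull x (g + h) = pull x g + pull x h.
Proof. by have [j [f ->]] := clsP x; rewrite !pullE mcompDr clsD. Qed.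

Lemma pullNr X Z W (x : pts X Z) (g : mor W Z) : pull x (- g) = - pull x g.
Proof. by have [j [f ->]] := clsP x; rewrite !pullE mcompN clsN. Qed.

Lemma pull0r X Z W (x : pts X Z) : pull x (0 : mor W Z) = 0.
Proof. by have [j [f ->]] := clsP x; rewrite pullE mcomp0r cls_0. Qed.

Lemma pullBr X Z W (x : pts X Z) (g h : mor W Z) : pull x (g - h) = pull x g - pull x h.
Proof. by rewrite pullDr pullNr. Qed.

Lemma pull_sum X Z W (x : pts X Z) n (g : 'I_n -> mor W Z) :
  pull x (\sum_i g i) = \sum_i pull x (g i).
Proof.
elim/big_rec2: _ => [|i u v _ <-]; first exact: pull0r.
exact: pullDr.
Qed.

Lemma pull_suml X Z W n (x : 'I_n -> pts X Z) (g : mor W Z) :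
  pull (\sum_i x i) g = \sum_i pull (x i) g.
Proof.
elim/big_rec2: _ => [|i u v _ <-]; first exact: pull0.
exact: pullD.
Qed.

Lemma pullMn X Z W (x : pts X Z) (g : mor W Z) n : pull (x *+ n) g = pull x g *+ n.
Proof. by elim: n => [|n IH]; rewrite ?mulr0n ?pull0 // !mulrS pullD IH. Qed.

Lemma epi_pull_eq0 X Z W (x : pts X Z) (e : mor W Z) : epi e -> pull x e = 0 -> x = 0.
Proof.
have [j [f ->]] := clsP x; rewrite pullE => ee /cls_eq0 [l [h e0]].
apply/cls_eq0; exists l, h; apply: ee; by rewrite -mcompA e0 mcomp0l.
Qed.

Lemma pts_mulrn_eq0 X Z (x : pts X Z) n : n%:R != 0 :> k -> x *+ n = 0 -> x = 0.
Proof.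
have [j [f ->]] := clsP x => n0.
have -> : cls f *+ n = cls (f *+ n).
  by elim: n {n0} => [|n IH]; rewrite ?mulr0n ?cls_0 // !mulrS clsD IH.
move/cls_eq0=> [l [h e]]; apply/cls_eq0; exists l, h.
by move: e; rewrite -scaler_nat mcompZr => /eqP; rewrite scaler_eq0 (negPf n0) => /eqP.
Qed.

Definition taut X (j : idx X) : pts X (X j) := cls (idm (X j)).

Lemma cls_taut X Z (j : idx X) (f : mor Z (X j)) : cls f = pull (taut j) f.
Proof. by rewrite /taut pullE mcomp1m. Qed.

Lemma taut_tr X (j j' : idx X) (h : ile j j') : pull (taut j') (tr h) = taut j.
Proof. by rewrite -cls_taut -[tr h]mcompm1 cls_tr. Qed.

Fact push_sig X Y Z : {F : indHom X Y -> pts X Z -> pts Y Z |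
  forall f x, F f x = cls (cp f (projT1 (rep x)) \oc projT2 (rep x))}.
Proof. by exists (fun f x => cls (cp f (projT1 (rep x)) \oc projT2 (rep x))). Qed.

Definition push X Y Z (f : indHom X Y) (x : pts X Z) : pts Y Z :=
  sval (push_sig X Y Z) f x.

Lemma pushE X Y Z (f : indHom X Y) (j : idx X) (g : mor Z (X j)) :
  push f (cls g) = cls (cp f j \oc g).
Proof.
have /cls_eq [l [h [h' e]]] := repK (cls g).
rewrite /push (svalP (push_sig _ _ _)); set j' := projT1 _ in h e *; set g' := projT2 _ in e *.
have E (i i' : idx X) (u : ile i i') (v : mor Z (X i)) :
    cls (cp f i' \oc (tr u \oc v)) = cls (cp f i \oc v).
  by apply/esym/cls_eq; rewrite mcompA; apply: germ_comp; apply: cp_compat.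
by rewrite -(E _ _ h) -(E _ _ h') e.
Qed.

Lemma push_pull X Y Z W (f : indHom X Y) (x : pts X Z) (g : mor W Z) :
  push f (pull x g) = pull (push f x) g.
Proof. by have [j [u ->]] := clsP x; rewrite pullE !pushE pullE mcompA. Qed.

Lemma pushD X Y Z (f : indHom X Y) (x y : pts X Z) :
  push f (x + y) = push f x + push f y.
Proof.
have [j [u [v [-> ->]]]] := clsP2 x y.
by rewrite -clsD !pushE mcompDr clsD.
Qed.

Lemma push0 X Y Z (f : indHom X Y) : push f (0 : pts X Z) = 0.
Proof. by rewrite -(cls_0 Z (some_idx X)) pushE mcomp0r cls_0. Qed.

Lemma pushN X Y Z (f : indHom X Y) (x : pts X Z) : push f (- x) = - push f x.
Proof. by apply/eqP; rewrite -addr_eq0 -pushD addNr push0. Qed.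

Lemma pushB X Y Z (f : indHom X Y) (x y : pts X Z) :
  push f (x - y) = push f x - push f y.
Proof. by rewrite pushD pushN. Qed.

Lemma push_comp X Y S Z (g : indHom Y S) (f : indHom X Y) (x : pts X Z) :
  push (icomp g f) x = push g (push f x).
Proof. by have [j [u ->]] := clsP x; rewrite !pushE /= mcompA. Qed.

Lemma push_iid X Z (x : pts X Z) : push (iid X) x = x.
Proof. by have [j [u ->]] := clsP x; rewrite !pushE /= mcomp1m. Qed.

Lemma push_taut X Y (f : indHom X Y) j : push f (taut j) = cls (cp f j).
Proof. by rewrite pushE mcompm1. Qed.

Lemma ieq_push X Y (f g : indHom X Y) :
  ieq f g <-> forall Z (x : pts X Z), push f x = push g x.
Proof.
split=> [e Z x|e j]; last by apply/cls_eq; rewrite -!push_taut.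
by have [j [u ->]] := clsP x; rewrite !pushE; apply/cls_eq/germ_comp/e.
Qed.

Lemma izero_hom_push X Y (f : indHom X Y) :
  izero_hom f <-> forall Z (x : pts X Z), push f x = 0.
Proof.
split=> [e Z x|e j]; last by apply/cls_eq0; rewrite -push_taut.
have [j [u ->]] := clsP x; rewrite cls_taut push_pull push_taut.
by have /cls_eq0 -> := e j; rewrite pull0.
Qed.

Lemma izero_obP X : izero_ob X <-> forall Z (x : pts X Z), x = 0.
Proof.
rewrite /izero_ob izero_hom_push; split=> e Z x; first by rewrite -[x]push_iid e.
exact: e.
Qed.

(** Yoneda: X is the colimit of its terms, so a morphism out of X is a compatible family of points
    of Y over them. *)
Lemma indHom_of_pts X Y (phi : forall j, pts Y (X j)) :
  (forall j j' (h : ile j j'), pull (phi j') (tr h) = phi j) ->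
  exists f : indHom X Y, forall j, push f (taut j) = phi j.
Proof.
move=> H.
have compat i i' (h : ile i i') :
    germ_eq (projT2 (rep (phi i))) (projT2 (rep (phi i')) \oc tr h).
  by apply/cls_eq; rewrite -pullE !repK H.
exists (IndHom compat) => j; by rewrite push_taut repK.
Qed.

Definition ofpt X Z (x : pts X Z) : indHom (icst Z) X := iof (projT2 (rep x)).

Definition cst Z W (f : mor W Z) : pts (icst Z) W := @cls (icst Z) W tt f.

Lemma cstP Z W (x : pts (icst Z) W) : exists f, x = cst f.
Proof. by have [[] [f ->]] := clsP x; exists f. Qed.

Lemma push_ofpt X Z W (x : pts X Z) (f : mor W Z) : push (ofpt x) (cst f) = pull x f.
Proof. by rewrite /cst pushE /= -[in RHS](repK x) pullE. Qed.

Lemma push_iof X Z W (j : idx X) (f : mor Z (X j)) (g : mor W Z) :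
  push (iof f) (cst g) = cls (f \oc g).
Proof. by rewrite /cst pushE. Qed.

(** A point over Z is a morphism from the constant ind-object [icst Z], so a monomorphism can be
    tested on it. *)
Lemma imono_inj X Y (f : indHom X Y) :
  imono f -> forall Z (x y : pts X Z), push f x = push f y -> x = y.
Proof.
move=> mf Z x y e.
have /ieq_push/(_ Z (cst (idm Z))) : ieq (ofpt x) (ofpt y).
  apply: mf; apply/ieq_push => W u; have [g ->] := cstP u.
  by rewrite !push_comp !push_ofpt !push_pull e.
by rewrite !push_ofpt !pull_id.
Qed.

Lemma inj_imono X Y (f : indHom X Y) :
  (forall Z (x : pts X Z), push f x = 0 -> x = 0) -> imono f.
Proof.
move=> inj S g h /ieq_push e; apply/ieq_push => Z x.
apply/eqP; rewrite -subr_eq0; apply/eqP/inj.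
by rewrite pushB -!push_comp e subrr.
Qed.

(** Injectivity of [i] makes the lifts of the tautological points unique, hence compatible with the
    transition morphisms, so that they glue. *)
Lemma ifactorsP X Y S (f : indHom X S) (i : indHom Y S) :
  (forall W (x y : pts Y W), push i x = push i y -> x = y) ->
  ifactors f i <-> forall W (x : pts X W), exists y, push i y = push f x.
Proof.
move=> inj; split=> [[g /ieq_push e] W x | H].
  by exists (push g x); rewrite -push_comp.
have H' j := cid (H _ (taut j)).
have [|g eg] := @indHom_of_pts X Y (fun j => projT1 (H' j)).
  move=> j j' h; apply: inj; rewrite push_pull.
  by case: (H' j) => y /= ->; case: (H' j') => y' /= ->; rewrite -push_pull taut_tr.
exists g; apply/ieq_push => W x; have [j [u ->]] := clsP x.
rewrite cls_taut !push_pull push_comp eg.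
by case: (H' j) => y /= ->.
Qed.

Lemma iisoP X Y (i : indHom X Y) :
  (forall W (x y : pts X W), push i x = push i y -> x = y) ->
  (forall W (y : pts Y W), exists x, push i x = y) -> is_iiso i.
Proof.
move=> inj surj.
have [|g eg] := (ifactorsP (iid Y) inj).2; first by move=> W x; rewrite push_iid.
exists g; split=> //; apply/ieq_push => W x; apply: inj.
by rewrite push_iid push_comp -push_comp; move/ieq_push: eg => ->; rewrite push_iid.
Qed.

End Points.

(** * Subsheaves of points and ind-subobjects *)

Section Sheaves.
Variables (k : fieldType) (C : symTensorCat k).
Implicit Types (X Y : indObj C) (Z W : C).

Definition psub X := forall Z, pts X Z -> Prop.

Record sheaf X (P : psub X) : Prop := Sheaf {
  sheaf0 : forall Z, P Z 0;
  sheafD : forall Z (x y : pts X Z), P Z x -> P Z y -> P Z (x + y);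
  sheafN : forall Z (x : pts X Z), P Z x -> P Z (- x);
  sheaf_pull : forall Z W (x : pts X Z) (g : mor W Z), P Z x -> P W (pull x g);
  sheaf_loc : forall Z W (x : pts X Z) (e : mor W Z), epi e -> P W (pull x e) -> P Z x
}.

Lemma sheafB X (P : psub X) : sheaf P ->
  forall Z (x y : pts X Z), P Z x -> P Z y -> P Z (x - y).
Proof. by move=> sP Z x y px py; apply: sheafD => //; apply: sheafN. Qed.

Lemma sheafMn X (P : psub X) : sheaf P ->
  forall Z (x : pts X Z) n, P Z x -> P Z (x *+ n).
Proof.
move=> sP Z x n px; elim: n => [|n IH]; first exact: sheaf0.
by rewrite mulrS; apply: sheafD.
Qed.

(** The inductive form yields spans without constructing sums and images in the ind-completion, and
    [gen_sheaf_min] serves as their induction principle. *)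
Inductive gen_sheaf X (S : psub X) : psub X :=
| gen_sheaf_in Z (x : pts X Z) : S Z x -> gen_sheaf S x
| gen_sheaf0 Z : gen_sheaf S (0 : pts X Z)
| gen_sheafD Z (x y : pts X Z) : gen_sheaf S x -> gen_sheaf S y -> gen_sheaf S (x + y)
| gen_sheafN Z (x : pts X Z) : gen_sheaf S x -> gen_sheaf S (- x)
| gen_sheaf_pull Z W (x : pts X Z) (g : mor W Z) : gen_sheaf S x -> gen_sheaf S (pull x g)
| gen_sheaf_loc Z W (x : pts X Z) (e : mor W Z) : epi e -> gen_sheaf S (pull x e) -> gen_sheaf S x.

Lemma gen_sheaf_sheaf X (S : psub X) : sheaf (gen_sheaf S).
Proof.
split; [exact: gen_sheaf0 | exact: gen_sheafD | exact: gen_sheafN | exact: gen_sheaf_pull |].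
exact: gen_sheaf_loc.
Qed.

Lemma gen_sheaf_min X (S P : psub X) : sheaf P -> (forall Z x, S Z x -> P Z x) ->
  forall Z x, gen_sheaf S (x : pts X Z) -> P Z x.
Proof.
move=> sP sub Z x; elim=> {Z x}.
- exact: sub.
- exact: sheaf0.
- by move=> Z x y _ px _ py; apply: sheafD.
- by move=> Z x _ px; apply: sheafN.
- by move=> Z W x g _ px; apply: sheaf_pull.
- by move=> Z W x e ee _ px; apply: sheaf_loc ee px.
Qed.

Section Representable.
Variables (X : indObj C) (P : psub X).
Hypothesis sP : sheaf P.

(* The representing system is indexed by the monomorphisms Z -> X_j lying in P; the
   transition morphisms are then unique. *)
Record subidx := Subidx {
  six : idx X;
  sob : C;
  sin : mor sob (X six);
  sin_mono : mono sin;
  sin_P : P (cls sin)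
}.

Definition subile (a b : subidx) : Prop :=
  exists m : mor (sob a) (sob b), exists h : ile (six a) (six b),
    sin b \oc m = tr h \oc sin a.

Definition subtr a b (h : subile a b) : mor (sob a) (sob b) := projT1 (cid h).

Lemma tr_irr (i j : idx X) (h h' : ile i j) : tr h = tr h'.
Proof. by rewrite -[tr h]mcomp1m -(tr_id (ile_refl j)) (tr_comp _ _ h'). Qed.

Lemma subtrP a b (h : subile a b) (h' : ile (six a) (six b)) :
  sin b \oc subtr h = tr h' \oc sin a.
Proof. by rewrite /subtr; case: cid => m /= [h'' ->]; rewrite (tr_irr h' h''). Qed.

Lemma subile_ile a b : subile a b -> ile (six a) (six b).
Proof. by case=> m [h _]. Qed.

(** Descent along the epimorphic part of [f] puts the image of [f] into the indexing system. *)
Lemma sub_image Z j (f : mor Z (X j)) : P (cls f) ->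
  exists a (h : ile (six a) j) (h' : ile j (six a)) e, tr h' \oc f = sin a \oc e /\ epi e.
Proof.
move=> pf; have [I [m [e [mm ee ef]]]] := image_factor f.
have pm : P (cls m) by apply: (sheaf_loc sP ee); rewrite pullE -ef.
exists (Subidx mm pm), (ile_refl j), (ile_refl j), e.
by rewrite tr_id mcomp1m.
Qed.

Fact subile_refl a : subile a a.
Proof. by exists (idm _), (ile_refl _); rewrite mcompm1 tr_id mcomp1m. Qed.

Fact subile_trans a b c : subile a b -> subile b c -> subile a c.
Proof.
move=> hab hbc; have h1 := subile_ile hab; have h2 := subile_ile hbc.
exists (subtr hbc \oc subtr hab), (ile_trans h1 h2).
rewrite mcompA (subtrP _ h2) -mcompA (subtrP _ h1) mcompA.
by rewrite (tr_comp _ _ (ile_trans h1 h2)).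
Qed.

Fact subile_directed a b : exists c, subile a c /\ subile b c.
Proof.
have [l [h h']] := ile_directed (six a) (six b).
pose Ab := stc_ab C.
(* An upper bound is the image of the sum of the two subobjects, taken at a common level. *)
pose f := tr h \oc sin a \oc pr1 Ab _ _ + tr h' \oc sin b \oc pr2 Ab _ _.
have pf : P (cls f).
  rewrite clsD -(pullE (tr h \oc sin a)) -(pullE (tr h' \oc sin b)) !cls_tr.
  by apply: (sheafD sP); apply: (sheaf_pull sP); exact: sin_P.
have [c [u [u' [e [ef _]]]]] := sub_image pf.
exists c; split.
  exists (e \oc in1 Ab _ _), (ile_trans h u').
  rewrite mcompA -ef -mcompA mcompDl -!mcompA pr1_in1 pr2_in1 !mcomp0r addr0 mcompm1.
  by rewrite mcompA (tr_comp _ _ (ile_trans h u')).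
exists (e \oc in2 Ab _ _), (ile_trans h' u').
rewrite mcompA -ef -mcompA mcompDl -!mcompA pr1_in2 pr2_in2 !mcomp0r add0r mcompm1.
by rewrite mcompA (tr_comp _ _ (ile_trans h' u')).
Qed.

Fact subidx_inh : inhabited subidx.
Proof.
have [j] := idx_nonempty X.
have [|a _] := @sub_image (zero_ob (stc_ab C)) j 0; last exact: inhabits a.
by rewrite cls_0; apply: sheaf0.
Qed.

Fact subtr_id a (h : subile a a) : subtr h = idm _.
Proof.
by apply: (sin_mono (s := a)); rewrite (subtrP _ (ile_refl _)) tr_id mcomp1m mcompm1.
Qed.

Fact subtr_comp a b c (hab : subile a b) (hbc : subile b c) (hac : subile a c) :
  subtr hbc \oc subtr hab = subtr hac.
Proof.
have h1 := subile_ile hab; have h2 := subile_ile hbc; have h3 := subile_ile hac.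
apply: (sin_mono (s := c)).
rewrite (subtrP _ h3) mcompA (subtrP _ h2) -mcompA (subtrP _ h1) mcompA.
by rewrite (tr_comp _ _ h3).
Qed.

Definition subobj : indObj C :=
  IndObj subile_refl subile_trans subile_directed subidx_inh subtr_id subtr_comp.

Fact subinc_compat a b (h : @ile _ _ subobj a b) :
  germ_eq (sin a) (sin b \oc tr h).
Proof.
have h' := subile_ile h.
by exists (six b), h', (ile_refl _); rewrite (subtrP _ h') tr_id mcomp1m.
Qed.

Definition subinc : indHom subobj X := IndHom subinc_compat.

(** By image factorization each member of [P] is a point of some indexed subobject. For injectivity,
    a point of [sob a] that dies at a later level of X dies in the image of [sob a] at that level,
    and this image belongs to the system. *)
Lemma sheaf_representable :
  exists (K : indObj C) (i : indHom K X),
    imono i /\ forall Z (x : pts X Z), P x <-> exists y, push i y = x.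
Proof.
exists subobj, subinc; split.
  apply: inj_imono => Z x; have [a [f ->]] := clsP x.
  rewrite pushE => /cls_eq0 [l [h /= e]].
  have [|b [u [u' [g [eg _]]]]] := @sub_image _ _ (tr h \oc sin a).
    by rewrite cls_tr; apply: sin_P.
  have hab : subile a b.
    exists g, (ile_trans h u').
    by rewrite -eg mcompA (tr_comp _ _ (ile_trans h u')).
  apply/cls_eq0; exists b, hab.
  apply: (mono_eq0 (sin_mono (s := b))); rewrite mcompA.
  rewrite (subtrP _ (ile_trans h u')) -(tr_comp h u') -!mcompA; move: e => ->.
  by rewrite mcomp0r.
move=> Z x; split=> [|[y <-]].
  have [j [f ->]] := clsP x => pf; have [a [h [h' [e [ef _]]]]] := sub_image pf.
  by exists (@cls _ _ subobj _ a e); rewrite pushE /= -ef cls_tr.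
have [a [f ->]] := clsP y; rewrite pushE -pullE.
exact: (sheaf_pull sP _ (sin_P a)).
Qed.

End Representable.

(** For descent, the preimage of x o e restricts to zero on the kernel of e by injectivity. From
    some level on it therefore factors through e, which is the cokernel of its kernel. *)
Lemma imono_sheaf (K X : indObj C) (i : indHom K X) : imono i ->
  sheaf (fun Z (x : pts X Z) => exists y, push i y = x).
Proof.
move=> mi; split.
- by move=> Z; exists 0; rewrite push0.
- by move=> Z _ _ [x <-] [y <-]; exists (x + y); rewrite pushD.
- by move=> Z _ [x <-]; exists (- x); rewrite pushN.
- by move=> Z W _ g [x <-]; exists (pull x g); rewrite push_pull.
move=> Z W x e ee [y ey]; pose kap := ker_in (stc_ab C) e.
have : pull y kap = 0.
  apply: (imono_inj mi); rewrite push_pull ey push0 pull_comp.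
  by have [-> _] := kerP (stc_ab C) e; rewrite pull0r.
have [l [f ef]] := clsP y; rewrite ef pullE => /cls_eq0 [m [h e0]].
have [|f' ef'] := @epi_descent _ _ _ _ _ e (tr h \oc f) ee; first by rewrite -mcompA.
exists (cls f'); apply/eqP; rewrite -subr_eq0; apply/eqP; apply: (epi_pull_eq0 ee).
by rewrite pullB -push_pull pullE -ef' cls_tr -ef ey subrr.
Qed.

End Sheaves.

(** * Multiplication of points *)

Section Algebras.
Variables (k : fieldType) (C : symTensorCat k).
Implicit Types (X Y : indObj C) (Z W : C).
Local Notation M := (stc_mon C).
Local Notation "'\1'" := (unit_ob M).
Local Notation alpha := (assoc M).

Fact ptens_sig X Y Z W : {f : pts X Z -> pts Y W -> pts (itens X Y) (Z \oX W) |
  forall x y, f x y = @cls _ _ (itens X Y) _ (projT1 (rep x), projT1 (rep y))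
    (projT2 (rep x) \ox projT2 (rep y))}.
Proof. by eexists=> x y; reflexivity. Qed.

Definition ptens X Y Z W (x : pts X Z) (y : pts Y W) : pts (itens X Y) (Z \oX W) :=
  sval (ptens_sig X Y Z W) x y.

Lemma ptensE X Y Z W (i : idx X) (j : idx Y) (f : mor Z (X i)) (g : mor W (Y j)) :
  ptens (cls f) (cls g) = @cls _ _ (itens X Y) _ (i, j) (f \ox g).
Proof.
have /cls_eq [l [h [h' e]]] := repK (cls f).
have /cls_eq [m [u [u' e']]] := repK (cls g).
rewrite /ptens (svalP (ptens_sig _ _ _ _)).
apply/cls_eq; exists (l, m), (conj h u), (conj h' u') => /=.
by rewrite -!tensm_comp e e'.
Qed.

Lemma ptens_pull X Y Z W Z' W' (x : pts X Z) (y : pts Y W) (f : mor Z' Z) (g : mor W' W) :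
  ptens (pull x f) (pull y g) = pull (ptens x y) (f \ox g).
Proof.
have [i [u ->]] := clsP x; have [j [v ->]] := clsP y.
by rewrite !pullE !ptensE pullE tensm_comp.
Qed.

Lemma ptensDl X Y Z W (x x' : pts X Z) (y : pts Y W) :
  ptens (x + x') y = ptens x y + ptens x' y.
Proof.
have [i [u [v [-> ->]]]] := clsP2 x x'; have [j [w ->]] := clsP y.
by rewrite -clsD !ptensE tensmDl clsD.
Qed.

Lemma ptensDr X Y Z W (x : pts X Z) (y y' : pts Y W) :
  ptens x (y + y') = ptens x y + ptens x y'.
Proof.
have [i [u [v [-> ->]]]] := clsP2 y y'; have [j [w ->]] := clsP x.
by rewrite -clsD !ptensE tensmDr clsD.
Qed.

Lemma ptens0l X Y Z W (y : pts Y W) : ptens (0 : pts X Z) y = 0.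
Proof. by apply: (@addrI _ (ptens 0 y)); rewrite -ptensDl !addr0. Qed.

Lemma ptens0r X Y Z W (x : pts X Z) : ptens x (0 : pts Y W) = 0.
Proof. by apply: (@addrI _ (ptens x 0)); rewrite -ptensDr !addr0. Qed.

Lemma ptensNl X Y Z W (x : pts X Z) (y : pts Y W) : ptens (- x) y = - ptens x y.
Proof. by apply/eqP; rewrite -addr_eq0 -ptensDl addNr ptens0l. Qed.

Lemma ptensNr X Y Z W (x : pts X Z) (y : pts Y W) : ptens x (- y) = - ptens x y.
Proof. by apply/eqP; rewrite -addr_eq0 -ptensDr addNr ptens0r. Qed.

Lemma push_ptens X Y X' Y' Z W (x : pts X Z) (y : pts Y W) (f : indHom X X')
    (g : indHom Y Y') :
  push (itensm f g) (ptens x y) = ptens (push f x) (push g y).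
Proof.
have [i [u ->]] := clsP x; have [j [v ->]] := clsP y.
by rewrite !ptensE !pushE ptensE /= tensm_comp.
Qed.

Lemma ptensP X Y Z (z : pts (itens X Y) Z) :
  exists W W' (x : pts X W) (y : pts Y W') f, z = pull (ptens x y) f.
Proof.
have [[i j] [f ->]] := clsP z; exists (X i), (Y j), (taut i), (taut j), f.
by rewrite /taut ptensE tensm1 pullE mcomp1m.
Qed.

Lemma push_iassoc X Y S Z W V (x : pts X Z) (y : pts Y W) (z : pts S V) :
  push (iassoc X Y S) (ptens (ptens x y) z) =
  pull (ptens x (ptens y z)) (alpha Z W V).
Proof.
have [i [u ->]] := clsP x; have [j [v ->]] := clsP y; have [l [w ->]] := clsP z.
by rewrite !ptensE pushE pullE /= assoc_nat.
Qed.

Lemma push_ilunit X Z W (f : mor W \1) (x : pts X Z) :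
  push (ilunit X) (ptens (cst f) x) = pull x (lunit M Z \oc (f \ox idm Z)).
Proof.
have [i [u ->]] := clsP x; rewrite ptensE pushE pullE /= mcompA -lunit_nat.
by rewrite -mcompA -tens_rl.
Qed.

Lemma push_irunit X Z W (f : mor W \1) (x : pts X Z) :
  push (irunit X) (ptens x (cst f)) = pull x (runit M Z \oc (idm Z \ox f)).
Proof.
have [i [u ->]] := clsP x; rewrite ptensE pushE pullE /= mcompA -runit_nat.
by rewrite -mcompA -tens_lr.
Qed.

Lemma push_iinterchange X Y S T Z W V U (x : pts X Z) (y : pts Y W) (z : pts S V)
    (t : pts T U) :
  push (iinterchange X Y S T) (ptens (ptens x y) (ptens z t)) =
  pull (ptens (ptens x z) (ptens y t)) (ic Z W V U).
Proof.
have [i [f ->]] := clsP x; have [j [g ->]] := clsP y.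
have [i' [f' ->]] := clsP z; have [j' [g' ->]] := clsP t.
by rewrite !ptensE pushE pullE ic_interchange /= interchange_nat.
Qed.

Definition mul (A : indAlgData C) Z W (x : pts A Z) (y : pts A W) : pts A (Z \oX W) :=
  push (imul A) (ptens x y).

Definition one (A : indAlgData C) : pts A \1 := push (iunit A) (cst (idm \1)).

Section MulTheory.
Variable A : indAlgData C.

Lemma mul_pull Z W Z' W' (x : pts A Z) (y : pts A W) (f : mor Z' Z) (g : mor W' W) :
  mul (pull x f) (pull y g) = pull (mul x y) (f \ox g).
Proof. by rewrite /mul ptens_pull push_pull. Qed.

Lemma mul_pulll Z W Z' (x : pts A Z) (y : pts A W) (f : mor Z' Z) :
  mul (pull x f) y = pull (mul x y) (f \ox idm W).
Proof. by rewrite -mul_pull pull_id. Qed.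

Lemma mul_pullr Z W W' (x : pts A Z) (y : pts A W) (f : mor W' W) :
  mul x (pull y f) = pull (mul x y) (idm Z \ox f).
Proof. by rewrite -mul_pull pull_id. Qed.

Lemma mulDl Z W (x x' : pts A Z) (y : pts A W) : mul (x + x') y = mul x y + mul x' y.
Proof. by rewrite /mul ptensDl pushD. Qed.

Lemma mulDr Z W (x : pts A Z) (y y' : pts A W) : mul x (y + y') = mul x y + mul x y'.
Proof. by rewrite /mul ptensDr pushD. Qed.

Lemma mul0l Z W (y : pts A W) : mul (0 : pts A Z) y = 0.
Proof. by rewrite /mul ptens0l push0. Qed.

Lemma mul0x Z W (x : pts A Z) : mul x (0 : pts A W) = 0.
Proof. by rewrite /mul ptens0r push0. Qed.

Lemma mulNl Z W (x : pts A Z) (y : pts A W) : mul (- x) y = - mul x y.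
Proof. by rewrite /mul ptensNl pushN. Qed.

Lemma mulNx Z W (x : pts A Z) (y : pts A W) : mul x (- y) = - mul x y.
Proof. by rewrite /mul ptensNr pushN. Qed.

Lemma mulBl Z W (x x' : pts A Z) (y : pts A W) : mul (x - x') y = mul x y - mul x' y.
Proof. by rewrite mulDl mulNl. Qed.

Lemma mulBr Z W (x : pts A Z) (y y' : pts A W) : mul x (y - y') = mul x y - mul x y'.
Proof. by rewrite mulDr mulNx. Qed.

Lemma mulMnr Z W (x : pts A Z) (y : pts A W) n : mul x (y *+ n) = mul x y *+ n.
Proof. by elim: n => [|n IH]; rewrite ?mulr0n ?mul0x // !mulrS mulDr IH. Qed.

Lemma unitE W (f : mor W \1) : push (iunit A) (cst f) = pull (one A) f.
Proof. by rewrite /one -push_pull pullE mcomp1m. Qed.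

(** By [ptensP] external products of points suffice to test equality of morphisms out of a tensor
    product. *)
Lemma is_algebraP : is_algebra A <->
  [/\ forall Z W V (x : pts A Z) (y : pts A W) (z : pts A V),
        mul (mul x y) z = pull (mul x (mul y z)) (alpha Z W V),
      forall Z (x : pts A Z), mul (one A) x = pull x (lunit M Z)
    & forall Z (x : pts A Z), mul x (one A) = pull x (runit M Z)].
Proof.
split=> [[/ieq_push assA /ieq_push lA /ieq_push rA] | [assA lA rA]].
  split=> [Z W V x y z|Z x|Z x].
  - have := assA _ (ptens (ptens x y) z).
    by rewrite !push_comp push_iassoc !push_pull !push_ptens !push_iid.
  - have := lA _ (ptens (cst (idm \1)) x).
    by rewrite push_comp push_ptens push_iid push_ilunit tensm1 mcompm1.
  - have := rA _ (ptens x (cst (idm \1))).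
    by rewrite push_comp push_ptens push_iid push_irunit tensm1 mcompm1.
split; apply/ieq_push => Z u; have [W [W' [x [y [f ->]]]]] := ptensP u;
  rewrite !push_pull; congr (pull _ f).
- have [V [V' [x1 [x2 [g ->]]]]] := ptensP x.
  rewrite -[y]pull_id ptens_pull !push_pull; congr (pull _ _).
  rewrite !push_comp push_iassoc push_pull !push_ptens !push_iid.
  rewrite push_pull; exact: assA.
- have [g ->] := cstP x; rewrite push_comp push_ptens push_iid push_ilunit unitE.
  by rewrite -/(mul _ _) mul_pulll lA pull_comp.
- have [g ->] := cstP y; rewrite push_comp push_ptens push_iid push_irunit unitE.
  by rewrite -/(mul _ _) mul_pullr rA pull_comp.
Qed.

Lemma is_idealP (K : indObj C) (i : indHom K A) : is_ideal i <->
  [/\ imono i,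
      forall Z W (x : pts A Z) (y : pts K W), exists t, push i t = mul x (push i y)
    & forall Z W (x : pts A Z) (y : pts K W), exists t, push i t = mul (push i y) x].
Proof.
split=> [[mi]|[mi H1 H2]].
  move=> /(ifactorsP _ (imono_inj mi)) H1 /(ifactorsP _ (imono_inj mi)) H2.
  split=> // Z W x y.
    have [t et] := H1 _ (ptens x y); exists t.
    by rewrite et push_comp push_ptens push_iid.
  have [t et] := H2 _ (ptens y x); exists t.
  by rewrite et push_comp push_ptens push_iid.
split=> //; apply/(ifactorsP _ (imono_inj mi)) => Z u;
  have [W [W' [x [y [f ->]]]]] := ptensP u.
  have [t et] := H1 _ _ x y; exists (pull t f).
  by rewrite !push_pull et push_comp push_ptens push_iid.
have [t et] := H2 _ _ y x; exists (pull t f).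
by rewrite !push_pull et push_comp push_ptens push_iid.
Qed.

End MulTheory.

Section HomTheory.
Variables (A B : indAlgData C) (q : indHom A B).
Hypothesis hq : is_alg_hom q.

Lemma push_mul Z W (x : pts A Z) (y : pts A W) :
  push q (mul x y) = mul (push q x) (push q y).
Proof.
have [/ieq_push e _] := hq; have := e _ (ptens x y).
by rewrite !push_comp push_ptens.
Qed.

Lemma push_one : push q (one A) = one B.
Proof.
have [_ /ieq_push e] := hq.
by have := e _ (cst (idm \1)); rewrite push_comp.
Qed.

End HomTheory.

(** * The tensor product of two algebras on points *)

Section TensorProduct.
Variables R A : indAlgData C.
Local Notation RA := (alg_tens R A).

Lemma mul_ptens Z W Z' W' (r : pts R Z) (a : pts A W) (r' : pts R Z') (a' : pts A W') :
  @mul RA _ _ (ptens r a) (ptens r' a') = pull (ptens (mul r r') (mul a a')) (ic Z W Z' W').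
Proof.
by rewrite /mul /= push_comp push_iinterchange push_pull push_ptens.
Qed.

Lemma one_ptens : one RA = pull (ptens (one R) (one A)) (lunitV M \1).
Proof.
rewrite /one /= push_comp.
have -> : push (iof (X := \1) (Y := itens (icst \1) (icst \1)) (j := (tt, tt))
    (lunitV M \1)) (cst (idm \1)) =
  pull (ptens (cst (idm \1)) (cst (idm \1))) (lunitV M \1).
  by rewrite push_iof ptensE pullE tensm1 mcomp1m mcompm1.
by rewrite push_pull push_ptens.
Qed.

End TensorProduct.

Section TensorAlgebra.
Variables R A : indAlgData C.
Hypotheses (algR : is_algebra R) (algA : is_algebra A).
Local Notation RA := (alg_tens R A).

Definition inA Z (a : pts A Z) : pts RA Z := pull (ptens (one R) a) (lunitV M Z).
Definition inR Z (r : pts R Z) : pts RA Z := pull (ptens r (one A)) (runitV M Z).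

Lemma inA_mul W Z Z' (a0 : pts A W) (r : pts R Z) (a : pts A Z') :
  mul (inA a0) (ptens r a : pts RA _) = pull (ptens r (mul a0 a)) (sw W Z Z').
Proof.
have [_ lR _] := (is_algebraP R).1 algR.
rewrite /inA mul_pulll mul_ptens lR -[mul a0 a]pull_id ptens_pull pull_id !pull_comp.
by rewrite -ic_1l mcompA.
Qed.

Lemma mul_inA W Z Z' (a0 : pts A W) (r : pts R Z) (a : pts A Z') :
  mul (ptens r a : pts RA _) (inA a0) = pull (ptens r (mul a a0)) (alpha Z Z' W).
Proof.
have [_ _ rR] := (is_algebraP R).1 algR.
rewrite /inA mul_pullr mul_ptens rR -[mul a a0]pull_id ptens_pull pull_id !pull_comp.
by rewrite -ic_1r mcompA.
Qed.

Lemma one_inA : one RA = inA (one A).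
Proof. exact: one_ptens. Qed.

Lemma alg_tens_algebra : is_algebra RA.
Proof.
have [assR lR rR] := (is_algebraP R).1 algR.
have [assA lA rA] := (is_algebraP A).1 algA.
apply/is_algebraP; split.
- move=> Z W V x y z.
  have [Z1 [Z2 [r1 [a1 [f ->]]]]] := ptensP x.
  have [W1 [W2 [r2 [a2 [g ->]]]]] := ptensP y.
  have [V1 [V2 [r3 [a3 [h ->]]]]] := ptensP z.
  rewrite !mul_pull pull_comp -assoc_nat -[in RHS]pull_comp; congr (pull _ _).
  rewrite !mul_ptens mul_pulll mul_pullr !mul_ptens assR assA ptens_pull !pull_comp.
  by rewrite -mcompA ic_assoc.
- move=> Z x; have [Z1 [Z2 [r [a [f ->]]]]] := ptensP x.
  rewrite mul_pullr one_inA inA_mul lA -[r in LHS]pull_id ptens_pull !pull_comp.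
  by rewrite -sw_lunit -!mcompA (rewr_comp (sw_sym _ _ _)) mcomp1m lunit_nat.
move=> Z x; have [Z1 [Z2 [r [a [f ->]]]]] := ptensP x.
rewrite mul_pulll one_inA mul_inA rA -[r in LHS]pull_id ptens_pull !pull_comp.
by rewrite runit_assoc runit_nat.
Qed.

Lemma inA_mul_inA Z W (a : pts A Z) (b : pts A W) : mul (inA a) (inA b) = inA (mul a b).
Proof.
by rewrite {2}/inA mul_pullr inA_mul pull_comp -sw_unit (rewr_comp (sw_sym _ _ _)) mcomp1m.
Qed.

Lemma inA_pull Z W (a : pts A Z) (f : mor W Z) : inA (pull a f) = pull (inA a) f.
Proof.
by rewrite /inA -{1}[one R]pull_id ptens_pull !pull_comp lunitV_nat.
Qed.

Lemma inAB Z (a b : pts A Z) : inA (a - b) = inA a - inA b.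
Proof. by rewrite /inA ptensDr ptensNr pullB. Qed.

Lemma inR_pull Z W (r : pts R Z) (f : mor W Z) : inR (pull r f) = pull (inR r) f.
Proof. by rewrite /inR -{1}[one A]pull_id ptens_pull !pull_comp runitV_nat. Qed.

Lemma inRD Z (a b : pts R Z) : inR (a + b) = inR a + inR b.
Proof. by rewrite /inR ptensDl pullD. Qed.

Lemma inRN Z (a : pts R Z) : inR (- a) = - inR a.
Proof. by rewrite /inR ptensNl pullN. Qed.

Lemma inR_mul_inA Z W (r : pts R Z) (a : pts A W) : mul (inR r) (inA a) = ptens r a.
Proof.
have [_ lA _] := (is_algebraP A).1 algA.
rewrite {1}/inR mul_pulll mul_inA lA -[r in LHS]pull_id ptens_pull !pull_comp.
by rewrite -mcompA triangleV -tens1_comp lunitVK tensm1 pull_id.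
Qed.

(** The two factors commute up to braiding; hence bracketing with V annihilates R. *)
Lemma inA_mul_inR Z W (r : pts R Z) (a : pts A W) :
  mul (inA a) (inR r) = pull (mul (inR r) (inA a)) (braid M W Z).
Proof.
have [_ _ rA] := (is_algebraP A).1 algA.
rewrite {1}/inR mul_pullr inA_mul rA -[r in LHS]pull_id ptens_pull !pull_comp.
by rewrite -mcompA sw_braid inR_mul_inA.
Qed.

Lemma inR_mul_inR Z W (r : pts R Z) (s : pts R W) : mul (inR r) (inR s) = inR (mul r s).
Proof.
have [_ lA _] := (is_algebraP A).1 algA.
rewrite {1 2}/inR mul_pull mul_ptens lA -[mul r s]pull_id ptens_pull !pull_comp.
by rewrite -mcompA ic_unitR pull_id.
Qed.

Lemma inR_one : inR (one R) = one RA.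
Proof. 
rewrite one_ptens /inR; congr (pull _ _).
by apply: (retraction_cancel (lunitK M _)); rewrite lunitVK lunit_unit runitVK.
Qed.

End TensorAlgebra.

End Algebras.

(** * The Euler operator *)

Section Commutators.
Variables (k : fieldType) (C : symTensorCat k).
Local Notation M := (stc_mon C).
Local Notation "'\1'" := (unit_ob M).
Local Notation alpha := (assoc M).
Local Notation alphaV := (assocV M).
Local Notation br := (braid M).
Implicit Types X Y Z W : C.
Variables (A : indAlgData C) (algA : is_algebra A).

Lemma pull_iso_inj (T : indObj C) Z W (x y : pts T Z) (f : mor W Z) (f' : mor Z W) :
  f \oc f' = idm Z -> pull x f = pull y f -> x = y.
Proof. by move=> e eq; rewrite -[x]pull_id -e -pull_comp eq pull_comp e pull_id. Qed.

Lemma mul_assoc Z W V (x : pts A Z) (y : pts A W) (z : pts A V) :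
  mul (mul x y) z = pull (mul x (mul y z)) (alpha Z W V).
Proof. by have [-> _ _] := (is_algebraP A).1 algA. Qed.

Lemma mul_onel Z (x : pts A Z) : mul (one A) x = pull x (lunit M Z).
Proof. by have [_ -> _] := (is_algebraP A).1 algA. Qed.

Lemma mul_oner Z (x : pts A Z) : mul x (one A) = pull x (runit M Z).
Proof. by have [_ _ ->] := (is_algebraP A).1 algA. Qed.

Fact comm_sig Z W : {f : pts A Z -> pts A W -> pts A (Z \oX W) |
  forall a x, f a x = mul a x - pull (mul x a) (br Z W)}.
Proof. by eexists=> a x; reflexivity. Qed.

Definition comm Z W (a : pts A Z) (x : pts A W) : pts A (Z \oX W) :=
  sval (comm_sig Z W) a x.

Lemma commE Z W (a : pts A Z) (x : pts A W) :
  comm a x = mul a x - pull (mul x a) (br Z W).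
Proof. exact: (svalP (comm_sig Z W)). Qed.

Lemma comm_pullr Z W W' (a : pts A Z) (x : pts A W) (f : mor W' W) :
  comm a (pull x f) = pull (comm a x) (idm Z \ox f).
Proof. by rewrite !commE mul_pullr mul_pulll pull_comp -braid_nat -pull_comp pullB. Qed.

Lemma comm_pull Z W Z' W' (a : pts A Z) (x : pts A W) (g : mor Z' Z) (f : mor W' W) :
  comm (pull a g) (pull x f) = pull (comm a x) (g \ox f).
Proof. by rewrite !commE !mul_pull pull_comp -braid_nat -pull_comp pullB. Qed.

Lemma commD Z W (a : pts A Z) (x y : pts A W) : comm a (x + y) = comm a x + comm a y.
Proof. by rewrite !commE mulDr mulDl pullD opprD addrACA. Qed.

Lemma comm0 Z W (a : pts A Z) : comm a (0 : pts A W) = 0.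
Proof. by rewrite !commE mul0x mul0l pull0 subr0. Qed.

Lemma commN Z W (a : pts A Z) (x : pts A W) : comm a (- x) = - comm a x.
Proof. by apply/eqP; rewrite -addr_eq0 -commD addNr comm0. Qed.

Section Pair.
Variables (X Y : C) (a : pts A X) (b : pts A Y) (be : mor (X \oX Y) \1).
Hypothesis ab : comm a b = pull (one A) be.

(** Exchange of two letters at the head of a word, the shape in which the commutation relations are
    used. *)
Lemma mul_comm Z (x : pts A Z) :
  mul a (mul b x) = pull (mul b (mul a x)) (sw X Y Z) + pull x (ct be Z).
Proof.
apply: (pull_iso_inj (assocVK M _ _ _)).
rewrite -mul_assoc pullD !pull_comp swE ctE -!pull_comp -mul_assoc -mul_pulll.
rewrite -mul_onel -mul_pulll -ab -mulDl commE.
by rewrite addrCA subrr addr0.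
Qed.

Lemma comm_mul Z (x : pts A Z) :
  comm a (mul b x) = pull (mul b (comm a x)) (sw X Y Z) + pull x (ct be Z).
Proof.
rewrite !commE mul_comm mulBr pullB mul_assoc pull_comp hexagon_sw mul_pullr pull_comp.
by rewrite addrAC.
Qed.

End Pair.

(** * Filtration by word length and the effect of vanishing symmetric powers *)

Section Stage.
Variables (U U' : C) (u : pts A U) (u' : pts A U').
Variables (be : mor (U' \oX U) \1) (bU : mor (U \oX U) \1) (eta : mor \1 (U \oX U')).
Hypothesis u'u : comm u' u = pull (one A) be.
Hypothesis uu : comm u u = pull (one A) bU.
Hypothesis zig :
  runit M U \oc (idm U \ox be) \oc alpha U U' U \oc (eta \ox idm U) = lunit M U.

Fact euler_sig Z : {f : pts A Z -> pts A Z |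
  forall x, f x = pull (mul u (comm u' x)) (cz eta Z)}.
Proof. by eexists=> x; reflexivity. Qed.

(* The Euler operator sum_i u_i [u'_i, x]. *)
Definition euler Z (x : pts A Z) : pts A Z := sval (euler_sig Z) x.

Lemma eulerE Z (x : pts A Z) : euler x = pull (mul u (comm u' x)) (cz eta Z).
Proof. exact: (svalP (euler_sig Z)). Qed.

Lemma euler_pull Z W (x : pts A Z) (f : mor W Z) : euler (pull x f) = pull (euler x) f.
Proof. by rewrite !eulerE comm_pullr mul_pullr !pull_comp cz_nat. Qed.

Lemma eulerD Z (x y : pts A Z) : euler (x + y) = euler x + euler y.
Proof. by rewrite !eulerE commD mulDr pullD. Qed.

Lemma euler0 Z : euler (0 : pts A Z) = 0.
Proof. by rewrite !eulerE comm0 mul0x pull0. Qed.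

Lemma eulerN Z (x : pts A Z) : euler (- x) = - euler x.
Proof. by rewrite !eulerE commN mulNx pullN. Qed.

(** The first term comes from the bracket of u' with u and the zigzag identity. The last one comes
    from exchanging two letters u; it depends only on [u', x], so it is of lower filtration. *)
Lemma euler_mul Z (x : pts A Z) :
  euler (mul u x) = mul u x + mul u (euler x) +
    pull (comm u' x) (ct bU (U' \oX Z) \oc ((idm U \ox sw U' U Z) \oc cz eta (U \oX Z))).
Proof.
rewrite !eulerE (comm_mul u'u) mulDr pullD !mul_pullr !pull_comp (cz_ct zig) pull_id.
rewrite [in LHS](mul_comm uu) pullD !pull_comp cz_sw [LHS]addrC addrA.
by [].
Qed.

Variable P : psub A.
Hypothesis sP : sheaf P.
Hypothesis u'P : forall Z (x : pts A Z), P x -> comm u' x = 0.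

Inductive step (S : psub A) : psub A :=
| step_P Z (x : pts A Z) : P x -> step S x
| step_U Z (x : pts A Z) : S Z x -> step S (mul u x).

(* [filt n] is locally spanned by the words u ... u x with x in P and *fewer* than n letters
   u, so that [filt 0] is zero. *)
Fixpoint filt (n : nat) : psub A :=
  if n is n'.+1 then gen_sheaf (step (filt n')) else (fun Z x => x = 0).

Lemma filt_sheaf n : sheaf (filt n).
Proof.
case: n => [|n]; last exact: gen_sheaf_sheaf.
split=> //= [Z x y -> ->|Z x ->|Z W x g ->|Z W x e ee].
- exact: addr0.
- exact: oppr0.
- exact: pull0.
- exact: epi_pull_eq0.
Qed.

Lemma filt_step_mono S S' : (forall Z (x : pts A Z), S Z x -> S' Z x) ->
  forall Z (x : pts A Z), gen_sheaf (step S) x -> gen_sheaf (step S') x.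
Proof.
move=> sub; apply: gen_sheaf_min; first exact: gen_sheaf_sheaf.
move=> Z x []; first by move=> *; apply/gen_sheaf_in/step_P.
by move=> Z' y /sub Sy; apply/gen_sheaf_in/step_U.
Qed.

Lemma filtS n Z (x : pts A Z) : filt n x -> filt n.+1 x.
Proof.
elim: n Z x => [Z x -> |n IH]; first exact: gen_sheaf0.
exact: filt_step_mono.
Qed.

Lemma filt_mul n Z (x : pts A Z) : filt n x -> filt n.+1 (mul u x).
Proof. by move=> fx; apply/gen_sheaf_in/step_U. Qed.

Lemma filt_P n Z (x : pts A Z) : P x -> filt n.+1 x.
Proof. by move=> fx; apply/gen_sheaf_in/step_P. Qed.

Lemma filt_le m n Z (x : pts A Z) : (m <= n)%N -> filt m x -> filt n x.
Proof.
move/subnK <-; elim: (n - m)%N => [|d IH] // /IH.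
exact: filtS.
Qed.

Lemma filt_union_sheaf : sheaf (fun Z (x : pts A Z) => exists n, filt n x).
Proof.
split=> [Z|Z x y [n fx] [m fy]|Z x [n fx]|Z W x g [n fx]|Z W x e ee [n fx]].
- by exists 0%N.
- exists (maxn n m); apply: (sheafD (filt_sheaf _)).
    exact: filt_le (leq_maxl _ _) fx.
  exact: filt_le (leq_maxr _ _) fy.
- by exists n; apply: (sheafN (filt_sheaf _)).
- by exists n; apply: (sheaf_pull (filt_sheaf _)).
by exists n; apply: (sheaf_loc (filt_sheaf _) ee).
Qed.

Lemma filt_min (Q : psub A) : sheaf Q -> (forall Z (x : pts A Z), P x -> Q _ x) ->
  (forall Z (x : pts A Z), Q _ x -> Q _ (mul u x)) ->
  forall n Z (x : pts A Z), filt n x -> Q _ x.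
Proof.
move=> sQ PQ uQ; elim=> [Z x -> |n IH]; first exact: sheaf0.
apply: (gen_sheaf_min sQ) => Z x [] {}Z {}x; first exact: PQ.
by move=> /IH; apply: uQ.
Qed.

(* On words with n letters u the Euler operator is multiplication by n, modulo shorter
   words. *)
Lemma filt_euler n Z (x : pts A Z) : filt n.+1 x ->
  filt n (comm u' x) /\ filt n (euler x - x *+ n).
Proof.
elim: n Z x => [|n IH].
  (* Since [filt 0] is zero, both claims are equations here. *)
  apply: gen_sheaf_min.
    split=> /= [Z|Z x y [dx ex] [dy ey]|Z x [dx ex]|Z W x g [dx ex]|Z W x e ee [dx ex]].
    - by rewrite comm0 euler0 subr0.
    - rewrite commD dx dy addr0 eulerD mulr0n subr0.
      by rewrite -(subr0 (euler x)) ex -(subr0 (euler y)) ey addr0.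
    - by rewrite commN dx oppr0 eulerN mulr0n subr0 -(subr0 (euler x)) ex oppr0.
    - by rewrite comm_pullr dx pull0 euler_pull mulr0n subr0 -(subr0 (euler x)) ex pull0.
    - move: dx ex; rewrite comm_pullr euler_pull !mulr0n !subr0.
      move/(epi_pull_eq0 (epi_tensl ee)) => ->.
      by move/(epi_pull_eq0 ee) => ->.
  move=> Z x [] {}Z {}x => [Px|->] /=.
    by rewrite !eulerE (u'P Px) mul0x pull0 subr0.
  by rewrite mul0x comm0 euler0 subr0.
apply: gen_sheaf_min.
  have sF := filt_sheaf n.+1.
  split=> /= [Z|Z x y [dx ex] [dy ey]|Z x [dx ex]|Z W x g [dx ex]|Z W x e ee [dx ex]].
  - by rewrite comm0 euler0 mul0rn subr0; split; apply: gen_sheaf0.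
  - by rewrite commD eulerD mulrnDl opprD addrACA; split; apply: gen_sheafD.
  - by rewrite commN eulerN mulNrn -opprD; split; apply: gen_sheafN.
  - by rewrite comm_pullr euler_pull -pullMn -pullB; split; apply: gen_sheaf_pull.
  - move: dx ex; rewrite comm_pullr euler_pull -pullMn -pullB => dx ex; split.
      exact: (gen_sheaf_loc (epi_tensl ee) dx).
    exact: (gen_sheaf_loc ee ex).
move=> Z x [] {}Z {}x.
  move=> Px; rewrite eulerE (u'P Px) mul0x pull0 sub0r.
  split; first exact: (sheaf0 (filt_sheaf n.+1)).
  apply: (sheafN (filt_sheaf n.+1)); apply: (sheafMn (filt_sheaf n.+1)); exact: filt_P.
move=> Fx; have [dx ex] := IH _ _ Fx.
have sF := filt_sheaf n.+1; split.
  rewrite (comm_mul u'u); apply: (sheafD sF).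
    exact: (sheaf_pull sF _ (filt_mul dx)).
  exact: (sheaf_pull sF).
rewrite euler_mul addrAC mulrS opprD addrA; apply: (sheafD sF).
  rewrite (addrAC (mul u x)) subrr add0r -mulMnr -mulBr.
  exact: filt_mul.
exact: (sheaf_pull sF _ (filtS dx)).
Qed.

Fixpoint upow (n : nat) : pts A (tpow U n) :=
  if n is n'.+1 then mul u (upow n') else one A.

Lemma upow_mul_filt n Z (x : pts A Z) : P x -> filt n.+1 (mul (upow n) x).
Proof.
move=> Px; elim: n => [|n IH] /=.
  by rewrite mul_onel; apply: gen_sheaf_pull; exact: (@filt_P 0%N).
by rewrite mul_assoc; apply: gen_sheaf_pull; exact: (@filt_mul n.+1).
Qed.

(* Modulo shorter words u commutes with itself, so the words of length n in u factor through
   S^n U. *)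
Lemma upow_swap n i Z (x : pts A Z) : P x -> (i.+1 < n)%N ->
  filt n.-1 (mul (pull (upow n) (idm (tpow U n) - swap U n i)) x).
Proof.
move=> Px; elim: n i => [|[|n] IH] // [|i] lt.
  have -> : pull (upow n.+2) (idm (tpow U n.+2) - swap U n.+2 0) =
     pull (upow n) (ct bU (tpow U n)).
    have -> : swap U n.+2 0 = sw U U (tpow U n) by rewrite /sw locked_withE.
    rewrite pullBr pull_id; apply/eqP; rewrite subr_eq addrC; apply/eqP.
    exact: mul_comm uu _ _.
  rewrite mul_pulll; apply: (sheaf_pull (filt_sheaf n.+1)).
  exact: upow_mul_filt.
have -> : pull (upow n.+2) (idm (tpow U n.+2) - swap U n.+2 i.+1) =
   mul u (pull (upow n.+1) (idm _ - swap U n.+1 i)).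
  by rewrite mul_pullr tensmDr tensNr tensm1.
rewrite mul_assoc; apply: (sheaf_pull (filt_sheaf n.+1)); apply: filt_mul.
exact: IH.
Qed.

Lemma copow_map_filt m W Y Z (w : pts A Y) (x : pts A Z) n (h : nat -> mor W Y) :
  (forall i, (i < n)%N -> filt m (mul (pull w (h i)) x)) ->
  filt m (mul (pull w (copow_map n h)) x).
Proof.
have sF := filt_sheaf m.
elim: n h => [|n IH] h H /=; first by rewrite pull0r mul0l; apply: (sheaf0 sF).
rewrite pullDr mulDl -!pull_comp; apply: (sheafD sF).
  by rewrite mul_pulll; apply: (sheaf_pull sF); apply: H.
rewrite mul_pulll; apply: (sheaf_pull sF); apply: IH => i lt.
exact: H.
Qed.

(** If S^n U = 0, the maps id - swap jointly form an epimorphism onto the n-th tensor power, so by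
    descent it suffices to treat them one by one. The index [n.-1] records that a contraction
    removes two letters. *)
Lemma upow_filt n Z (x : pts A Z) : is_zero_ob (sym_pow U n) -> P x ->
  filt n.-1 (mul (upow n) x).
Proof.
move=> /coker0_epi ep Px; apply: (sheaf_loc (filt_sheaf _) (epi_tensr ep)).
rewrite -mul_pulll; apply: copow_map_filt => i lt.
by apply: upow_swap => //; case: n lt {ep}.
Qed.

(** Rebracketing only. Memberships are stable under [pull], so the structural morphism [g] need not
    be named. *)
Lemma upow_mulu n Z (x : pts A Z) :
  exists g, mul (upow n) (mul u x) = pull (mul (upow n.+1) x) g.
Proof.
have e m : upow m.+1 = mul u (upow m) by [].
elim: n => [|n [g IH]].
  exists (alphaV _ _ _ \oc ((idm U \ox lunitV M Z) \oc lunit M (U \oX Z))).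
  rewrite e mul_assoc !mul_onel mul_pullr !pull_comp -?mcompA (rewr_comp (assocVK M _ _ _)) mcomp1m.
  by rewrite (rewr_comp (esym (tens1_comp _ _ _))) lunitVK tensm1 mcomp1m.
rewrite {1}e mul_assoc IH (e n.+1).
exists (alphaV _ _ _ \oc ((idm U \ox g) \oc alpha _ _ _)).
rewrite (mul_assoc u (upow n.+1)) mul_pullr !pull_comp -?mcompA.
by rewrite (rewr_comp (assocVK M _ _ _)) mcomp1m.
Qed.

(** The letters of the word move one at a time into the prefix while j + n stays constant. A word of
    exactly p letters ends as [upow p] times an element of [P], where [upow_filt] applies; every
    other word has fewer than p letters. *)
Lemma filt_collapse p n Z (x : pts A Z) : (0 < p)%N -> is_zero_ob (sym_pow U p) ->
  filt n x -> forall j, (j + n = p.+1)%N -> filt p (mul (upow j) x).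
Proof.
move=> p0 zp; elim: n Z x => [Z x -> j _|n IH].
  by rewrite mul0x; apply: (sheaf0 (filt_sheaf p)).
have sF := filt_sheaf p.
apply: gen_sheaf_min.
  split=> [Z j _|Z x y px py j e|Z x px j e|Z W x g px j e|Z W x f ef px j e].
  - by rewrite mul0x; apply: (sheaf0 sF).
  - by rewrite mulDr; apply: (sheafD sF); [apply: px | apply: py].
  - by rewrite mulNx; apply: (sheafN sF); apply: px.
  - by rewrite mul_pullr; apply: (sheaf_pull sF); apply: px.
  - apply: (sheaf_loc sF (epi_tensl ef)); rewrite -mul_pullr; exact: px.
move=> Z x [] {}Z {}x => [Px|Fx] j e.
  case: n IH e => [|n] IH e.
    have -> : j = p by rewrite addn1 in e; case: e.
    apply: (@filt_le p.-1); first exact: leq_pred.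
    exact: upow_filt.
  apply: (@filt_le j.+1); last exact: upow_mul_filt.
  by rewrite -ltnS -e addnS ltnS addnS ltnS leq_addr.
have [g ->] := upow_mulu j x; apply: (sheaf_pull sF); apply: IH => //.
by rewrite addSnnS.
Qed.

(** At n = p this is [filt_collapse] with empty prefix; prefixing letters propagates the inclusion
    to larger n. *)
Lemma filt_stable p n Z (x : pts A Z) : (0 < p)%N -> is_zero_ob (sym_pow U p) ->
  (p <= n)%N -> filt n.+1 x -> filt n x.
Proof.
move=> p0 zp /subnK <-; elim: (n - p)%N Z x => [|d IH] Z x.
  move=> Fx; have := filt_collapse p0 zp Fx (j := 0%N) erefl.
  rewrite /= mul_onel => /(sheaf_pull (filt_sheaf _) (lunitV M Z)).
  by rewrite pull_comp lunitVK pull_id.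
exact: filt_step_mono.
Qed.

Hypothesis symU : forall p, p \in [pchar k] -> is_zero_ob (sym_pow U p).
Variable J : psub A.
Hypothesis sJ : sheaf J.
Hypothesis u'J : forall Z (x : pts A Z), J x -> J (comm u' x).
Hypothesis PJ : forall Z (x : pts A Z), P x -> J x -> x = 0.

(* A minimal n with J meeting [filt n.+1] nontrivially is impossible: [u', -] lowers n, so it
   kills x, hence n x is a combination of shorter words; if n = 0 in k then words of length
   n are themselves combinations of shorter ones, since S^p U = 0. *)
Lemma stage n Z (x : pts A Z) : filt n x -> J x -> x = 0.
Proof.
elim: n Z x => [|n IH] Z x //.
have [-> Fx|n0 Fx Jx] := posnP n.
  apply: PJ; move: Z x Fx; apply: (gen_sheaf_min sP) => Z x [] {}Z {}x //= ->.
  by rewrite mul0x; apply: (sheaf0 sP).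
have [nk|nk] := eqVneq (n%:R : k) 0.
  have /natf0_pchar : n%:R == 0 :> k by apply/eqP.
  move=> /(_ n0) [p pk]; apply: IH => //.
  apply: (filt_stable (prime_gt0 (pcharf_prime pk)) (symU pk)) Fx.
  apply: dvdn_leq => //.
  by rewrite (dvdn_pcharf pk) nk.
have [dx ex] := filt_euler Fx.
have ex0 : euler x = 0 by rewrite eulerE (IH _ _ dx (u'J Jx)) mul0x pull0.
apply: (pts_mulrn_eq0 nk); apply: IH; last exact: sheafMn.
by rewrite -[_ *+ _]opprK; apply: (sheafN (filt_sheaf _)); rewrite -sub0r -ex0.
Qed.

End Stage.

End Commutators.

(** Bookkeeping for [wickhom_weyl_ideal]: A and B are the two orders of a pair of letters, a and p
    the mixed terms, d the double derivation, c a contraction with half the form. *)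
Lemma addr_cancel12 (G : zmodType) (A a p c d B : G) :
  A + a + p + c + d - B - p - a + c - d - c - c = A - B.
Proof.
by rewrite (ACl (1*6*(2*8)*(3*7)*(4*11)*(5*10)*(9*12)))%AC /= !subrr !addr0.
Qed.

(** * Points of the tensor algebra *)

Section TensorAlgebraPoints.
Variables (k : fieldType) (C : symTensorCat k).
Local Notation M := (stc_mon C).
Local Notation "'\1'" := (unit_ob M).
Local Notation alpha := (assoc M).
Local Notation alphaV := (assocV M).
Local Notation br := (braid M).
Variable V : C.
Local Notation F := (tpow V).
Local Notation T := (talg V).
Implicit Types X Y Z W : C.

Definition talg_in n : pts T (F n) := @cls _ _ T _ n (tin F n n).

Lemma talg_inE N n : (n <= N)%N -> @cls _ _ T _ N (tin F N n) = talg_in n.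
Proof.
move=> le; rewrite /talg_in -(@cls_tr _ _ T _ n N le) /=; congr cls.
by rewrite tr_tin.
Qed.

Lemma talg_decomp Z N (f : mor Z (bigbip F N)) :
  @cls _ _ T _ N f = \sum_(n < N.+1) pull (talg_in n) (tpr F N n \oc f).
Proof.
rewrite -[f in LHS]mcomp1m -tin_tpr_sum mcomp_suml.
have -> : forall m (g : 'I_m -> mor Z (bigbip F N)),
    @cls _ _ T _ N (\sum_i g i) = \sum_i cls (g i : mor Z (T N)).
  by move=> m g; elim/big_rec2: _ => [|i x y _ <-]; [exact: cls_0 | exact: clsD].
apply: eq_bigr => i _; rewrite -mcompA.
by rewrite -pullE talg_inE // -ltnS.
Qed.

(** A point of T(V) lives at a finite level, where it is the sum of its homogeneous components; each
    of these is pulled back from a tautological point. *)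
Lemma talg_ind (P : psub T) :
  (forall Z, P Z 0) -> (forall Z (x y : pts T Z), P Z x -> P Z y -> P Z (x + y)) ->
  (forall Z W (x : pts T Z) (g : mor W Z), P Z x -> P W (pull x g)) ->
  (forall n, P _ (talg_in n)) -> forall Z (x : pts T Z), P Z x.
Proof.
move=> P0 PD Pp Pt Z x; have [N [f ->]] := clsP x; rewrite talg_decomp.
by elim/big_ind: _ => [||i _] //; [exact: PD | exact: Pp].
Qed.

Lemma mul_talg_in a b : mul (talg_in a) (talg_in b) = pull (talg_in (a + b)) (concat V a b).
Proof.
rewrite /mul ptensE pushE pullE; congr cls.
rewrite mcomp_suml (bigD1 ord_max) //= [X in _ + X]big1 ?addr0; last first.
  move=> i /eqP ne; rewrite mcomp_suml big1 // => j _.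
  rewrite -mcompA -tensm_comp tpr_tin_neq ?tensm0l ?mcomp0r // => e.
  by apply: ne; apply: val_inj.
rewrite mcomp_suml (bigD1 ord_max) //= [X in _ + X]big1 ?addr0; last first.
  move=> i /eqP ne.
  rewrite -mcompA -tensm_comp [X in _ \ox X]tpr_tin_neq ?tensm0r ?mcomp0r // => e.
  by apply: ne; apply: val_inj.
by rewrite -mcompA -tensm_comp !tpr_tin // tensm1 mcompm1.
Qed.

Lemma talg_one : one T = talg_in 0.
Proof. by rewrite /one push_iof mcomp1m. Qed.

Fact talg_gen_sig : {v : pts T V | v = pull (talg_in 1) (runitV M V)}.
Proof. by eexists; reflexivity. Qed.

Definition talg_gen : pts T V := sval talg_gen_sig.

Lemma talg_gen_in n : mul talg_gen (talg_in n) = talg_in n.+1.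
Proof.
rewrite /talg_gen (svalP talg_gen_sig) mul_pulll mul_talg_in pull_comp /= -mcompA triangleV.
rewrite -tens1_comp.
by rewrite lunitVK tensm1 pull_id.
Qed.

Lemma talg_one_mul Z (x : pts T Z) : mul (talg_in 0) x = pull x (lunit M Z).
Proof.
move: Z x; apply: talg_ind => [Z|Z x y ex ey|Z W x g ex|n].
- by rewrite mul0x pull0.
- by rewrite mulDr ex ey pullD.
- by rewrite mul_pullr ex !pull_comp lunit_nat.
- by rewrite mul_talg_in.
Qed.

(** With a single letter in front, associativity is the recursive clause of [concat]. Words grow by
    prefixing letters, so this is the case that occurs. *)
Lemma talg_gen_mul_assoc Z W (x : pts T Z) (y : pts T W) :
  mul (mul talg_gen x) y = pull (mul talg_gen (mul x y)) (alpha V Z W).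
Proof.
move: Z x; apply: talg_ind => [Z|Z x x' ex ey|Z Z' x g ex|n].
- by rewrite mul0x !mul0l mul0x pull0.
- by rewrite mulDr 2!mulDl ex ey mulDr pullD.
- by rewrite mul_pullr !mul_pulll ex mul_pullr !pull_comp assoc_nat.
move: W y; apply: talg_ind => [W|W y y' ex ey|W W' y g ex|m].
- by rewrite !mul0x pull0.
- by rewrite !mulDr ex ey pullD.
- by rewrite !mul_pullr ex !pull_comp -tensm1 assoc_nat.
by rewrite talg_gen_in (mul_talg_in n.+1) mul_talg_in mul_pullr talg_gen_in pull_comp.
Qed.

Fact comp_sig n Z : {f : pts T Z -> mor Z (F n) |
  forall x, f x = tpr F (projT1 (rep x)) n \oc projT2 (rep x)}.
Proof. by eexists=> x; reflexivity. Qed.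

Definition comp n Z (x : pts T Z) : mor Z (F n) := sval (comp_sig n Z) x.

Lemma compE n Z N (f : mor Z (bigbip F N)) :
  comp n (@cls _ _ T _ N f) = tpr F N n \oc f.
Proof.
rewrite /comp (svalP (comp_sig _ _)); have /cls_eq [l [h [h' /= e]]] := repK (@cls _ _ T _ N f).
have E m m' (u : (m <= m')%N) (g : mor Z (bigbip F m)) :
    tpr F m n \oc g = tpr F m' n \oc (tbip_tr F m m' \oc g).
  by rewrite mcompA tpr_tr.
by rewrite (E _ _ h) (E _ _ h') e.
Qed.

Lemma compD n Z (x y : pts T Z) : comp n (x + y) = comp n x + comp n y.
Proof.
have [j [f [g [-> ->]]]] := clsP2 x y.
by rewrite -clsD !compE mcompDr.
Qed.

Lemma comp0 n Z : comp n (0 : pts T Z) = 0.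
Proof. by apply: (@addrI _ (comp n 0)); rewrite -compD !addr0. Qed.

Lemma compN n Z (x : pts T Z) : comp n (- x) = - comp n x.
Proof. by apply/eqP; rewrite -addr_eq0 -compD addNr comp0. Qed.

Lemma comp_pull n Z W (x : pts T Z) (g : mor W Z) : comp n (pull x g) = comp n x \oc g.
Proof. by have [j [f ->]] := clsP x; rewrite pullE !compE mcompA. Qed.

Lemma comp0_gen Z (x : pts T Z) : comp 0 (mul talg_gen x) = 0.
Proof.
move: Z x; apply: talg_ind => [Z|Z x y ex ey|Z W x g ex|n].
- by rewrite mul0x comp0.
- by rewrite mulDr compD ex ey addr0.
- by rewrite mul_pullr comp_pull ex mcomp0l.
by rewrite talg_gen_in compE; exact: (@tpr_tin_neq _ C F n.+1 0 n.+1).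
Qed.

Lemma comp0_sheaf : sheaf (fun Z (x : pts T Z) => comp 0 x = 0).
Proof.
split=> [Z|Z x y ex ey|Z x ex|Z W x g ex|Z W x e ee].
- exact: comp0.
- by rewrite compD ex ey addr0.
- by rewrite compN ex oppr0.
- by rewrite comp_pull ex mcomp0l.
by rewrite comp_pull => ex; apply: ee; rewrite ex mcomp0l.
Qed.

Section Lift.
Variables (X : indObj C) (Q : C).

Lemma talg_lift (w : forall n, pts X (F n)) :
  exists f : indHom T X, forall n, push f (talg_in n) = w n.
Proof.
pose phi N : pts X (bigbip F N) := \sum_(n < N.+1) pull (w n) (tpr F N n).
have phi_tin N n : (n <= N)%N -> pull (phi N) (tin F N n) = w n.
  move=> le; have lt : (n < N.+1)%N by [].
  rewrite /phi pull_suml (bigD1 (Ordinal lt)) //= pull_comp tpr_tin // pull_id.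
  rewrite big1 ?addr0 // => i /eqP ne; rewrite pull_comp tpr_tin_neq ?pull0r // => e.
  by apply: ne; apply: val_inj.
have [|f ef] := @indHom_of_pts _ _ T X phi.
  move=> N N' /= h; rewrite /tbip_tr pull_sum; apply: eq_bigr => i _.
  rewrite -pull_comp phi_tin //; apply: leq_trans h.
  by rewrite -ltnS.
exists f => n; rewrite /talg_in cls_taut push_pull ef.
exact: phi_tin.
Qed.

(** The parameter object Q is there for derivations indexed by V, which are morphisms out of V (x)
    T(V). *)
Lemma talg_lift_tens (w : forall n, pts X (Q \oX F n)) :
  exists f : indHom (itens (icst Q) T) X,
    forall n, push f (ptens (cst (idm Q)) (talg_in n)) = w n.
Proof.
pose phi N : pts X (Q \oX bigbip F N) :=
  \sum_(n < N.+1) pull (w n) (idm Q \ox tpr F N n).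
have phi_tin N n : (n <= N)%N -> pull (phi N) (idm Q \ox tin F N n) = w n.
  move=> le; have lt : (n < N.+1)%N by [].
  rewrite /phi pull_suml (bigD1 (Ordinal lt)) //= pull_comp -tens1_comp tpr_tin //.
  rewrite tensm1 pull_id big1 ?addr0 // => i /eqP ne.
  rewrite pull_comp -tens1_comp tpr_tin_neq ?tensm0r ?pull0r // => e.
  by apply: ne; apply: val_inj.
have [|f ef] := @indHom_of_pts _ _ (itens (icst Q) T) X (fun a => phi a.2).
  move=> [[] N] [[] N'] [h0 /= h]; rewrite /tbip_tr.
  have -> : idm Q \ox (\sum_(n < N.+1) tin F N' n \oc tpr F N n) =
     \sum_(n < N.+1) (idm Q \ox tin F N' n) \oc (idm Q \ox tpr F N n).
    elim/big_rec2: _ => [|i u v _ <-]; first exact: tensm0r.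
    by rewrite tensmDr tens1_comp.
  rewrite pull_sum; apply: eq_bigr => i _.
  rewrite -pull_comp phi_tin //; apply: leq_trans h.
  by rewrite -ltnS.
exists f => n; rewrite /cst /talg_in ptensE cls_taut push_pull ef.
exact: phi_tin.
Qed.

End Lift.

(** * Contraction derivations of the tensor algebra *)

Section Derivation.
Variable b : mor (V \oX V) \1.

(* The derivation v |-> [v, -] of the tensor algebra that extends the form b. *)
Fixpoint dpow (n : nat) : pts T (V \oX F n) :=
  if n is n'.+1 then
    pull (mul talg_gen (dpow n')) (sw V V (F n')) + pull (talg_in n') (ct b (F n'))
  else 0.

Definition dhom := projT1 (cid (talg_lift_tens dpow)).

Fact der_sig Z : {f : pts T Z -> pts T (V \oX Z) |
  forall x, f x = push dhom (ptens (cst (idm V)) x)}.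
Proof. by eexists=> x; reflexivity. Qed.

Definition der Z (x : pts T Z) : pts T (V \oX Z) := sval (der_sig Z) x.

Lemma derE Z (x : pts T Z) : der x = push dhom (ptens (cst (idm V)) x).
Proof. exact: (svalP (der_sig Z)). Qed.

Lemma der_tinp n : der (talg_in n) = dpow n.
Proof. by rewrite derE /dhom; case: cid. Qed.

Lemma derD Z (x y : pts T Z) : der (x + y) = der x + der y.
Proof. by rewrite !derE ptensDr pushD. Qed.

Lemma der0 Z : der (0 : pts T Z) = 0.
Proof. by rewrite !derE ptens0r push0. Qed.

Lemma derN Z (x : pts T Z) : der (- x) = - der x.
Proof. by apply/eqP; rewrite -addr_eq0 -derD addNr der0. Qed.

Lemma derB Z (x y : pts T Z) : der (x - y) = der x - der y.
Proof. by rewrite derD derN. Qed.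

Lemma der_pull Z W (x : pts T Z) (g : mor W Z) : der (pull x g) = pull (der x) (idm V \ox g).
Proof. by rewrite !derE -push_pull -ptens_pull pull_id. Qed.

Lemma der_gen Z (x : pts T Z) :
  der (mul talg_gen x) = pull (mul talg_gen (der x)) (sw V V Z) + pull x (ct b Z).
Proof.
move: Z x; apply: talg_ind => [Z|Z x y ex ey|Z W x g ex|n].
- by rewrite mul0x !der0 mul0x !pull0 addr0.
- by rewrite mulDr !derD ex ey mulDr !pullD addrACA.
- by rewrite mul_pullr !der_pull ex mul_pullr !pullD !pull_comp ct_nat sw_nat.
by rewrite talg_gen_in (der_tinp n.+1) der_tinp.
Qed.

Lemma ct_swV Z : ct b (V \oX Z) \oc (idm V \ox sw V V Z) =
  (idm V \ox ct b Z) \oc sw V V (V \oX Z).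
Proof.
apply: (section_cancel (f := idm V \ox sw V V Z) (f' := idm V \ox sw V V Z)).
  by rewrite -tens1_comp sw_sym tensm1.
by rewrite -!mcompA -tens1_comp sw_sym tensm1 mcompm1 ct_sw.
Qed.

(** The two terms in which one derivation contracts the leading letter are exchanged by [sw]; the
    term in which neither does is handled by Yang-Baxter and the assumption on x. *)
Lemma der_comm_gen Z (x : pts T Z) : der (der x) = pull (der (der x)) (sw V V Z) ->
  der (der (mul talg_gen x)) = pull (der (der (mul talg_gen x))) (sw V V (V \oX Z)).
Proof.
move=> IH; rewrite der_gen derD !der_pull der_gen !pullD !pull_comp.
move: (der (der x)) (der x) IH => d2 d1 IH.
rewrite ct_swV -!mcompA sw_sym mcompm1 -!addrA; congr (_ + _); last exact: addrC.
by rewrite -yang_baxter -[in RHS]pull_comp -mul_pullr -IH.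
Qed.

Lemma der_comm Z (x : pts T Z) : der (der x) = pull (der (der x)) (sw V V Z).
Proof.
move: Z x; apply: talg_ind => [Z|Z x y ex ey|Z W x g ex|n].
- by rewrite !der0 pull0.
- by rewrite !derD pullD -ex -ey.
- by rewrite !der_pull {1}ex !pull_comp sw_nat.
elim: n => [|n IH]; first by rewrite der_tinp /= !der0 pull0.
by rewrite -talg_gen_in; apply: der_comm_gen.
Qed.

End Derivation.

(** * The ideal of Weyl relations *)

Section WeylIdeal.
Variable b : mor (V \oX V) \1.

Definition weyl_relator Z (x : pts T Z) : pts T (V \oX (V \oX Z)) :=
  mul talg_gen (mul talg_gen x) - pull (mul talg_gen (mul talg_gen x)) (sw V V Z) - pull x (ct b Z).

(* It is two-sided, since the relator may be followed by any x. *)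
Inductive weyl_ideal : psub T :=
| weyl_ideal_rel Z (x : pts T Z) : weyl_ideal (weyl_relator x)
| weyl_ideal_mul Z (x : pts T Z) : weyl_ideal x -> weyl_ideal (mul talg_gen x)
| weyl_ideal0 Z : weyl_ideal (0 : pts T Z)
| weyl_idealD Z (x y : pts T Z) : weyl_ideal x -> weyl_ideal y -> weyl_ideal (x + y)
| weyl_idealN Z (x : pts T Z) : weyl_ideal x -> weyl_ideal (- x)
| weyl_ideal_pull Z W (x : pts T Z) (g : mor W Z) : weyl_ideal x -> weyl_ideal (pull x g)
| weyl_ideal_loc Z W (x : pts T Z) (e : mor W Z) : epi e -> weyl_ideal (pull x e) -> weyl_ideal x.

Lemma weyl_ideal_sheaf : sheaf weyl_ideal.
Proof.
split; [exact: weyl_ideal0 | exact: weyl_idealD | exact: weyl_idealN | |].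
  exact: weyl_ideal_pull.
exact: weyl_ideal_loc.
Qed.

Lemma weyl_ideal_min (P : psub T) : sheaf P -> (forall Z (x : pts T Z), P _ (weyl_relator x)) ->
  (forall Z (x : pts T Z), weyl_ideal x -> P _ x -> P _ (mul talg_gen x)) -> 
  forall Z (x : pts T Z), weyl_ideal x -> P _ x.
Proof.
move=> sP Pr Pm Z x; elim=> {Z x} //.
- exact: sheaf0.
- by move=> Z x y _ px _ py; apply: sheafD.
- by move=> Z x _ px; apply: sheafN.
- by move=> Z W x g _ px; apply: sheaf_pull.
- by move=> Z W x e ee _ px; apply: sheaf_loc ee px.
Qed.

Lemma weyl_ideal_mull Z W (x : pts T Z) (t : pts T W) : weyl_ideal t -> weyl_ideal (mul x t).
Proof.
move=> wt; move: Z x; apply: talg_ind => [Z|Z x y ex ey|Z W' x g ex|n].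
- by rewrite mul0l; apply: weyl_ideal0.
- by rewrite mulDl; apply: weyl_idealD.
- by rewrite mul_pulll; apply: weyl_ideal_pull.
elim: n => [|n IH]; first by rewrite talg_one_mul; apply: weyl_ideal_pull.
by rewrite -talg_gen_in talg_gen_mul_assoc; apply: weyl_ideal_pull; apply: weyl_ideal_mul.
Qed.

Lemma weyl_relator_mul Z W (x : pts T Z) (y : pts T W) :
  mul (weyl_relator x) y =
  pull (weyl_relator (mul x y)) ((idm V \ox alpha V Z W) \oc alpha V (V \oX Z) W).
Proof.
rewrite /weyl_relator !mulBl !mul_pulll !talg_gen_mul_assoc mul_pullr !pullB !pull_comp.
by rewrite ct_tail -!mcompA sw_tail.
Qed.

Lemma weyl_ideal_mulr Z W (y : pts T W) (x : pts T Z) : weyl_ideal x -> weyl_ideal (mul x y).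
Proof.
move: Z x; apply: weyl_ideal_min => [|Z x|Z x _ wx].
- split=> [Z|Z x x' ex ey|Z x ex|Z Z' x g ex|Z Z' x e ee ex].
  + by rewrite mul0l; apply: weyl_ideal0.
  + by rewrite mulDl; apply: weyl_idealD.
  + by rewrite mulNl; apply: weyl_idealN.
  + by rewrite mul_pulll; apply: weyl_ideal_pull.
  by apply: (weyl_ideal_loc (epi_tensr ee)); rewrite -mul_pulll.
- by rewrite weyl_relator_mul; apply: weyl_ideal_pull; apply: weyl_ideal_rel.
by rewrite talg_gen_mul_assoc; apply: weyl_ideal_pull; apply: weyl_ideal_mul.
Qed.

Lemma weyl_rel_pt Z (g : mor Z (V \oX V)) :
  push (weyl_rel b) (cst g) = pull (weyl_relator (one T)) (tpow2 V \oc g).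
Proof.
transitivity (pull (pull (talg_in 2) (tpow2 V \oc (idm _ - br V V)) - pull (talg_in 0) b) g).
  rewrite /weyl_rel push_iof -(@pullE _ _ T); congr (pull _ g).
  rewrite (@clsB _ _ T); congr (_ - _).
    rewrite -mcompA; apply/esym.
    exact: (@pullE _ _ T _ _ 2 (tin F 2 2)).
  rewrite -(@talg_inE 2 0) //; apply/esym.
  exact: (@pullE _ _ T _ _ 2 (tin F 2 0)).
rewrite -[RHS]pull_comp; congr (pull _ g).
rewrite /weyl_relator talg_one (talg_gen_in 0) (talg_gen_in 1) !pullB !pull_comp.
rewrite /tpow2 sw_runitV ct_runit.
by rewrite -pullBr mcompDr mcompN mcompm1.
Qed.

End WeylIdeal.

(* For b' = b / 2, letting v act by v + [v, -]_b' satisfies the Weyl relation for b modulo the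
   ideal of the symmetric algebra. Applying these operators to 1 and taking the degree 0
   part is Wick's formula; it is a functional on T(V) that sends 1 to 1 and kills the Weyl
   ideal. *)
Section WickOrdering.
Variables (b b' : mor (V \oX V) \1).
Hypothesis b'_skew : b' \oc br V V = - b'.
Hypothesis b'_half : b = b' + b'.
Local Notation D := (der b').

(** The derivation of a relator on x is, up to a permutation of factors, the relator on the
    derivation of x: the terms contracting one of the two letters are symmetric in these letters and
    cancel. *)
Lemma weyl_ideal0_der Z (x : pts T Z) : weyl_ideal 0 x -> weyl_ideal 0 (D x).
Proof.
move: Z x; apply: weyl_ideal_min => [|Z x|Z x wx wdx].
- split=> [Z|Z x x' ex ey|Z x ex|Z Z' x g ex|Z Z' x e ee ex].
  + by rewrite der0; apply: weyl_ideal0.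
  + by rewrite derD; apply: weyl_idealD.
  + by rewrite derN; apply: weyl_idealN.
  + by rewrite der_pull; apply: weyl_ideal_pull.
  by apply: (weyl_ideal_loc (epi_tensl ee)); rewrite -der_pull.
- have E : D (mul talg_gen (mul talg_gen x)) =
      pull (mul talg_gen (mul talg_gen (D x))) ((idm V \ox sw V V Z) \oc sw V V (V \oX Z)) +
      pull (mul talg_gen x) ((idm V \ox ct b' Z) \oc sw V V (V \oX Z) + ct b' (V \oX Z)).
    by rewrite !der_gen mulDr !mul_pullr !pullD !pull_comp pullDr addrA.
  rewrite /weyl_relator ct0 pull0r subr0 derB der_pull E pullD !pull_comp.
  rewrite mcompDl -!mcompA ct_sw ct_swV [ct b' _ + _]addrC opprD addrACA subrr addr0.
  rewrite yang_baxter -[X in _ - X]pull_comp -pullB; apply: weyl_ideal_pull.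
  by have := weyl_ideal_rel 0 (D x); rewrite /weyl_relator ct0 pull0r subr0.
rewrite der_gen; apply: weyl_idealD; last exact: weyl_ideal_pull.
by apply: weyl_ideal_pull; apply: weyl_ideal_mul.
Qed.

Fixpoint wick (n : nat) : pts T (F n) :=
  if n is n'.+1 then mul talg_gen (wick n') + D (wick n') else talg_in 0.

Definition wickhom := projT1 (cid (talg_lift wick)).

Lemma wickhom_tinp n : push wickhom (talg_in n) = wick n.
Proof. by rewrite /wickhom; case: cid. Qed.

Lemma wickhom_gen Z (x : pts T Z) :
  push wickhom (mul talg_gen x) = mul talg_gen (push wickhom x) + D (push wickhom x).
Proof.
move: Z x; apply: talg_ind => [Z|Z x y ex ey|Z W x g ex|n].
- by rewrite mul0x !push0 mul0x der0 addr0.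
- by rewrite mulDr 2!pushD ex ey mulDr derD addrACA.
- by rewrite mul_pullr !push_pull ex mul_pullr der_pull pullD.
by rewrite talg_gen_in (wickhom_tinp n.+1) wickhom_tinp.
Qed.

(** In the difference of the two orders the mixed terms cancel, the double derivations cancel by
    [der_comm], and skewness turns the contractions with [b'] into 2 b' = b, which the relator
    subtracts. What survives is the relator for the zero form. *)
Lemma wickhom_weyl_ideal Z (x : pts T Z) : weyl_ideal b x -> weyl_ideal 0 (push wickhom x).
Proof.
move: Z x; apply: weyl_ideal_min => [|Z x|Z x _ wx].
- split=> [Z|Z x x' ex ey|Z x ex|Z Z' x g ex|Z Z' x e ee ex].
  + by rewrite push0; apply: weyl_ideal0.
  + by rewrite pushD; apply: weyl_idealD.
  + by rewrite pushN; apply: weyl_idealN.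
  + by rewrite push_pull; apply: weyl_ideal_pull.
  by apply: (weyl_ideal_loc ee); rewrite -push_pull.
- rewrite /weyl_relator !pushB !push_pull !wickhom_gen; move: (push wickhom x) => y.
  rewrite mulDr derD der_gen !pullD !pull_comp sw_sym pull_id ct_braid b'_skew ctN.
  rewrite pullNr -der_comm b'_half ctD pullDr !opprD opprK !addrA.
  rewrite addr_cancel12.
  by have := weyl_ideal_rel 0 y; rewrite /weyl_relator ct0 pull0r subr0.
by rewrite wickhom_gen; apply: weyl_idealD; [apply: weyl_ideal_mul | apply: weyl_ideal0_der].
Qed.

Lemma vacuum : exists la : indHom T (icst \1),
  push la (one T) = cst (idm \1) /\
  forall Z (x : pts T Z), weyl_ideal b x -> push la x = 0.
Proof.
have [la ela] := talg_lift (fun n => cst (comp 0 (wick n))).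
have E Z (x : pts T Z) : push la x = cst (comp 0 (push wickhom x)).
  move: Z x; apply: talg_ind => [Z|Z x y ex ey|Z W x g ex|n].
  - by rewrite !push0 comp0 /cst cls_0.
  - by rewrite !pushD compD ex ey /cst clsD.
  - by rewrite !push_pull comp_pull ex /cst pullE.
  by rewrite ela wickhom_tinp.
exists la; split=> [|Z x wx]; first by rewrite talg_one (ela 0%N) /= compE /= mcomp1m.
suff e0 : comp 0 (push wickhom x) = 0 by rewrite E e0 /cst cls_0.
move: Z x wx {E} => Z x /wickhom_weyl_ideal; move: (push wickhom x) => y {x}.
(* Relators for the zero form consist of words with a leading letter, so they have no component in
   degree 0. *)
move: Z y; apply: weyl_ideal_min; first exact: comp0_sheaf.
  move=> Z x; rewrite /weyl_relator ct0 pull0r subr0 compD compN comp_pull !comp0_gen.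
  by rewrite mcomp0l subr0.
by move=> Z x _ _; rewrite comp0_gen.
Qed.

End WickOrdering.

End TensorAlgebraPoints.

(** * Simplicity *)

Section WeylAlgebra.
Variables (k : fieldType) (C : symTensorCat k).
Local Notation M := (stc_mon C).
Local Notation "'\1'" := (unit_ob M).
Variables (V : C) (B : mor (V \oX V) \1) (A : indAlgData C).
Hypothesis weylA : is_weyl_algebra B A.
Local Notation T := (talg V).

Lemma weyl_is_algebra : is_algebra A.
Proof. by have [K [i [q []]]] := weylA. Qed.

(** Besides being an algebra, A enters the sequel only through these facts: the relation, induction
    along words, and a functional showing that the unit survives. *)
Lemma weyl_generators : exists a : pts A V,
  [/\ comm a a = pull (one A) B,
      forall P : psub A, sheaf P -> P _ (one A) ->
        (forall Z (x : pts A Z), P _ x -> P _ (mul a x)) ->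
        forall Z (x : pts A Z), P _ x
    & skew_form B -> 2%N \notin [pchar k] ->
      exists h : indHom A (icst \1), push h (one A) = cst (idm \1)].
Proof.
have [K [i [q [[idK facK minK] algA hq [q0 uni]]]]] := weylA.
have mi : imono i by case: idK.
have /izero_hom_push qi0 := q0.
exists (push q (talg_gen V)); split.
- have /(ifactorsP _ (imono_inj mi)) fac := facK.
  have [y ey] := fac _ (cst (idm (V \oX V))).
  have := qi0 _ y; rewrite push_comp ey weyl_rel_pt push_pull /weyl_relator !pushB !push_pull.
  rewrite !(push_mul hq) (push_one hq) mcompm1 !pullB !pull_comp /tpow2 sw_runitV ct_runit.
  rewrite (mul_oner algA) mul_pullr !pull_comp.
  have e : (idm V \ox runit M V) \oc (idm V \ox runitV M V) = idm _.
    by rewrite -tens1_comp runitVK tensm1.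
  rewrite e (rewr_comp e) mcomp1m pull_id => /eqP; rewrite subr_eq0 => /eqP <-.
  by rewrite commE.
- move=> P sP P1 Pa.
  have Pq Z (t : pts T Z) : P _ (push q t).
    move: Z t; apply: talg_ind => [Z|Z x y px py|Z W x g px|n].
    + by rewrite push0; apply: sheaf0.
    + by rewrite pushD; apply: sheafD.
    + by rewrite push_pull; apply: sheaf_pull.
    elim: n => [|n IH]; first by rewrite -talg_one (push_one hq).
    by rewrite -talg_gen_in (push_mul hq); apply: Pa.
  (* The quotient morphism [q] factors through the subobject [m] defined by [P]. The factorization
     kills the ideal and descends to h on A; uniqueness forces m o h to be the identity, so [m] is
     everything. *)
  have [Im [m [mm PIm]]] := sheaf_representable sP.
  have [g /ieq_push eg] : ifactors q m.
    apply/(ifactorsP _ (imono_inj mm)) => Z x; exact/PIm.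
  have gi0 : izero_hom (icomp g i).
    apply/izero_hom_push => Z x; apply: (imono_inj mm).
    by rewrite push0 (push_comp g i) -(push_comp m g) eg -(push_comp q i) qi0.
  have [h [/ieq_push hq' _]] := uni _ g gi0.
  have [h0 [_ uniq]] := uni _ q q0.
  have e1 : ieq (icomp m h) h0.
    apply: uniq; apply/ieq_push => Z x.
    by rewrite (push_comp (icomp m h)) (push_comp m h) -(push_comp h q) hq' -push_comp eg.
  have e2 : ieq (iid A) h0.
    by apply: uniq; apply/ieq_push => Z x; rewrite push_comp push_iid.
  move=> Z x; apply/PIm; exists (push h x); rewrite -push_comp.
  by move/ieq_push: e1 => ->; move/ieq_push: e2 => <-; rewrite push_iid.
move=> skB two.
pose b' : mor (V \oX V) \1 := 2^-1 *: B.
have b'_skew : b' \oc braid M V V = - b' by rewrite mcompZl skB scalerN.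
have two0 : (2 : k) != 0 by move: two; rewrite inE /=.
have b'_half : B = b' + b'.
  rewrite /b' -scalerDl -[2^-1]mul1r -mulrDl -[1 + 1]/(2%:R).
  by rewrite mulfV // scale1r.
have [la [la1 la0]] := vacuum b'_skew b'_half.
(* [weyl_ideal B] is a two-sided ideal containing the relation, so it contains K by minimality;
   hence [la] vanishes on K and descends to A. *)
have [K' [i' [mi' weyl_idealK']]] := sheaf_representable (weyl_ideal_sheaf B).
have idK' : is_ideal i'.
  apply/is_idealP; split=> // Z W x y.
    by apply/weyl_idealK'; apply: weyl_ideal_mull; apply/weyl_idealK'; exists y.
  by apply/weyl_idealK'; apply: weyl_ideal_mulr; apply/weyl_idealK'; exists y.
have facK' : ifactors (weyl_rel B) i'.
  apply/(ifactorsP _ (imono_inj mi')) => Z x; have [g ->] := cstP x.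
  apply/weyl_idealK'; rewrite weyl_rel_pt; apply: weyl_ideal_pull; exact: weyl_ideal_rel.
have /(ifactorsP _ (imono_inj mi')) sub := minK _ _ idK' facK'.
have lai : izero_hom (icomp la i).
  apply/izero_hom_push => Z x; rewrite push_comp; apply: la0; apply/weyl_idealK'.
  exact: sub.
have [h [/ieq_push eh _]] := uni _ la lai.
exists h; rewrite -la1 -eh push_comp.
by rewrite (push_one hq).
Qed.

End WeylAlgebra.

Section Simplicity.
Variables (k : fieldType) (C : symTensorCat k).
Local Notation M := (stc_mon C).
Local Notation "'\1'" := (unit_ob M).
Local Notation alpha := (assoc M).
Local Notation br := (braid M).
Variables (R A : indAlgData C).
Hypotheses (simR : simple_algebra R).
Variables (V : C) (B : mor (V \oX V) \1).
Hypothesis weylA : is_weyl_algebra B A.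
Hypothesis skB : skew_form B.
Hypothesis two : 2%N \notin [pchar k].
Local Notation RA := (alg_tens R A).

Let algR : is_algebra R. Proof. by case: simR. Qed.
Let algA : is_algebra A := weyl_is_algebra weylA.
Let algRA : is_algebra RA := alg_tens_algebra algR algA.

(* The ideal J meets R in an ideal of R, so it suffices to treat ideals meeting R trivially. *)
Lemma simple_criterion :
  (forall w : pts RA V,
    comm w w = pull (one RA) B ->
    (forall P : psub RA, sheaf P -> (forall Z (r : pts R Z), P _ (inR A r)) ->
      (forall Z (x : pts RA Z), P _ x -> P _ (mul w x)) ->
      forall Z (x : pts RA Z), P _ x) ->
    forall P : psub RA, sheaf P -> (forall Z (r : pts R Z), P _ (inR A r)) ->
    (forall Z (x : pts RA Z), P _ x -> comm w x = 0) ->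
    forall J : psub RA, sheaf J ->
    (forall Z W (x : pts RA Z) (y : pts RA W), J _ y -> J _ (mul x y)) ->
    (forall Z W (x : pts RA Z) (y : pts RA W), J _ y -> J _ (mul y x)) ->
    (forall Z (x : pts RA Z), P _ x -> J _ x -> x = 0) ->
    forall Z (x : pts RA Z), J _ x -> x = 0) ->
  simple_algebra RA.
Proof.
move=> crit.
have [a [aa gen /(_ skB two) [h h1]]] := weyl_generators weylA.
(* The unit-preserving functional on A gives a retraction of R (x) A onto R. It shows that R (x) A
   is nonzero and that R is closed under descent. *)
pose ret := icomp (irunit R) (itensm (iid R) h).
have retR Z (r : pts R Z) : push ret (inR A r) = r.
  rewrite /inR push_pull /ret push_comp push_ptens push_iid h1 push_irunit.
  by rewrite tensm1 mcompm1 pull_comp runitVK pull_id.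
split=> //.
  move=> /izero_obP z; have [_ nz _] := simR; apply: nz; apply/izero_obP => Z x.
  by rewrite -[x]retR (z _ (inR A x)) push0.
move=> K i idK; have [mi Jl Jr] := (is_idealP i).1 idK.
pose J : psub RA := fun Z x => exists y, push i y = x.
have sJ : sheaf J by exact: imono_sheaf.
have JL Z W (x : pts RA Z) (y : pts RA W) : J _ y -> J _ (mul x y).
  by case=> t <-; apply: Jl.
have JRr Z W (x : pts RA Z) (y : pts RA W) : J _ y -> J _ (mul y x).
  by case=> t <-; apply: Jr.
pose JR : psub R := fun Z r => J _ (inR A r).
have sJR : sheaf JR.
  rewrite /JR; split=> [Z|Z x y jx jy|Z x jx|Z W x g jx|Z W x e ee].
  - by rewrite /inR ptens0l pull0; apply: (sheaf0 sJ).
  - by rewrite inRD; apply: (sheafD sJ).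
  - by rewrite inRN; apply: (sheafN sJ).
  - by rewrite inR_pull; apply: (sheaf_pull sJ).
  - by rewrite inR_pull; apply: (sheaf_loc sJ).
have [K' [i' [mi' JRK]]] := sheaf_representable sJR.
have idK' : is_ideal i'.
  apply/is_idealP; split=> // Z W x y; apply/JRK; rewrite /JR -inR_mul_inR //.
    by apply: JL; apply/JRK; exists y.
  by apply: JRr; apply/JRK; exists y.
have [_ _ /(_ _ _ idK') [/izero_obP z|[g [_ /ieq_push gi]]]] := simR; last first.
  (* If the trace of J on R is all of R, then J contains 1. *)
  right; apply: (iisoP (imono_inj mi)) => W y.
  have J1 : J _ (one RA).
    rewrite -inR_one; apply/JRK; exists (push g (one R)).
    by rewrite -push_comp gi push_iid.
  have := sheaf_pull sJ (runitV M W) (JL _ _ y _ J1).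
  by rewrite (mul_oner algRA) pull_comp runitVK pull_id.
left; apply/izero_obP => Z y; apply: (imono_inj mi); rewrite push0.
have JR0 W (r : pts R W) : JR _ r -> r = 0 by move=> /JRK [t <-]; rewrite (z _ t) push0.
pose w := inA R a.
have ww : comm w w = pull (one RA) B.
  rewrite commE /w (inA_mul_inA algR) -inA_pull -inAB -commE aa.
  by rewrite inA_pull -one_inA.
have genRA : forall P : psub RA, sheaf P -> (forall Z (r : pts R Z), P _ (inR A r)) ->
    (forall Z (x : pts RA Z), P _ x -> P _ (mul w x)) ->
    forall Z (x : pts RA Z), P _ x.
  move=> P sP PR Pw W x; have [X [Y [r [b [f ->]]]]] := ptensP x.
  apply: (sheaf_pull sP); move: X r {x f}.
  suff H W' (b' : pts A W') : forall X (r : pts R X), P _ (ptens r b' : pts RA _) by [].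
  move: W' b'; apply: gen.
  - split=> [W'|W' x x' px px'|W' x px|W' W'' x g px|W' W'' x e ee px] X r.
    + by rewrite ptens0r; apply: (sheaf0 sP).
    + by rewrite ptensDr; apply: (sheafD sP).
    + by rewrite ptensNr; apply: (sheafN sP).
    + by rewrite -[r]pull_id ptens_pull; apply: (sheaf_pull sP).
    apply: (sheaf_loc sP (epi_tensl ee)).
    by rewrite -ptens_pull pull_id.
  - move=> X r; have := sheaf_pull sP (runit M X) (PR _ r).
    by rewrite /inR pull_comp runitK pull_id.
  move=> W' x px X r.
  have := sheaf_pull sP (sw X V W') (Pw _ _ (px X r)).
  by rewrite (inA_mul algR) pull_comp sw_sym pull_id.
pose P : psub RA := fun Z x => exists r, x = inR A r.
apply: (crit w ww genRA P _ _ _ J sJ JL JRr); last by exists y.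
- split=> [W|W _ _ [r ->] [s ->]|W _ [r ->]|W W' _ g [r ->]|W W' x e ee [r er]].
  + by exists 0; rewrite /inR ptens0l pull0.
  + by exists (r + s); rewrite inRD.
  + by exists (- r); rewrite inRN.
  + by exists (pull r g); rewrite inR_pull.
  (* If x lies in R after an epimorphism, the retraction supplies the element of R that x must
     be. *)
  exists (push ret x); apply/eqP; rewrite -subr_eq0; apply/eqP.
  apply: (epi_pull_eq0 ee); rewrite pullB -inR_pull -push_pull er retR subrr.
  by [].
- by move=> W r; exists r.
- by move=> W _ [r ->]; rewrite commE (inA_mul_inR algR algA) subrr.
by move=> W _ [r ->] /JR0 ->; rewrite /inR ptens0l pull0.
Qed.

End Simplicity.

(** * Non-degenerate forms, and W plus its dual *)

Section TwoParts.
Variables (k : fieldType) (C : symTensorCat k).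
Local Notation M := (stc_mon C).
Local Notation Ab := (stc_ab C).
Local Notation "'\1'" := (unit_ob M).
Local Notation br := (braid M).
Local Notation Dl X := (dual (stc_rigid C) X).
Variables (R : indAlgData C) (simR : simple_algebra R).
Hypothesis two : 2%N \notin [pchar k].

Lemma comm_closed (A : indAlgData C) (J : psub A) : sheaf J ->
  (forall Z W (x : pts A Z) (y : pts A W), J _ y -> J _ (mul x y)) ->
  (forall Z W (x : pts A Z) (y : pts A W), J _ y -> J _ (mul y x)) ->
  forall Z W (x : pts A Z) (y : pts A W), J _ y -> J _ (comm x y).
Proof.
move=> sJ Jl Jr Z W x y jy; rewrite commE; apply: (sheafB sJ); first exact: Jl.
by apply: (sheaf_pull sJ); apply: Jr.
Qed.

Lemma simple_nondegenerate (V : C) (B : mor (V \oX V) \1) (A : indAlgData C) :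
  skew_form B -> nondegenerate_form B ->
  (forall p : nat, p \in [pchar k] -> is_zero_ob (sym_pow V p)) ->
  is_weyl_algebra B A -> simple_algebra (alg_tens R A).
Proof.
move=> skB /nondegenerate_zig [eta zig] symV weylA.
have algR : is_algebra R by case: simR.
have algRA := alg_tens_algebra algR (weyl_is_algebra weylA).
apply: (simple_criterion simR weylA skB two) => w ww gen P sP PR wP J sJ Jl Jr PJ.
have wJ := comm_closed sJ Jl Jr.
move=> Z x.
have [n fx] : exists n, filt w P n x.
  move: Z x; apply: gen; first exact: filt_union_sheaf.
    by move=> Z r; exists 1%N; apply: filt_P.
  by move=> Z x [n fx]; exists n.+1; apply: filt_mul.
(* Here V plays both roles: u = u' = w, and B serves both as the pairing and as the commutator form
   of the letters. *)
exact: (stage algRA ww ww zig sP wP symV sJ (fun Z x => @wJ _ _ _ x) PJ fx).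
Qed.

Lemma pairing_form_skew (W : C) : skew_form (pairing_form W).
Proof.
rewrite /skew_form /pairing_form /= mcompDl mcompNl opprB -!mcompA -!braid_nat.
by rewrite (rewr_comp (braid_sym M _ _)) mcomp1m.
Qed.

Lemma simple_pairing (W : C) (A : indAlgData C) :
  (forall p : nat, p \in [pchar k] ->
     is_zero_ob (sym_pow W p) /\ is_zero_ob (sym_pow (Dl W) p)) ->
  is_weyl_algebra (pairing_form W) A -> simple_algebra (alg_tens R A).
Proof.
move=> symW weylA.
have algR : is_algebra R by case: simR.
have algRA := alg_tens_algebra algR (weyl_is_algebra weylA).
apply: (simple_criterion simR weylA (pairing_form_skew W) two).
move=> w ww gen P sP PR wP J sJ Jl Jr PJ.
have wJ := comm_closed sJ Jl Jr.
set V := bip Ab W (Dl W) in w ww gen wP *.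
set p := pr1 Ab W (Dl W); set q := pr2 Ab W (Dl W).
pose i1 := in1 Ab W (Dl W); pose i2 := in2 Ab W (Dl W).
have pi1 : p \oc i1 = idm _ := pr1_in1 _ _ _.
have pi2 : p \oc i2 = 0 := pr1_in2 _ _ _.
have qi1 : q \oc i1 = 0 := pr2_in1 _ _ _.
have qi2 : q \oc i2 = idm _ := pr2_in2 _ _ _.
pose u1 := pull w i1; pose u2 := pull w i2.
have comm_u X Y (f : mor X V) (g : mor Y V) :
    comm (pull w f) (pull w g) = pull (one _) (pairing_form W \oc (f \ox g)).
  by rewrite comm_pull ww pull_comp.
have c11 : comm u1 u1 = pull (one _) 0.
  rewrite comm_u; congr (pull _ _); rewrite mcompDl mcompNl -!mcompA -!tensm_comp.
  by rewrite qi1 pi1 tensm0l tensm0r !mcomp0r subr0.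
have c22 : comm u2 u2 = pull (one _) 0.
  rewrite comm_u; congr (pull _ _); rewrite mcompDl mcompNl -!mcompA -!tensm_comp.
  by rewrite qi2 pi2 tensm0l tensm0r !mcomp0r subr0.
have c21 : comm u2 u1 = pull (one _) (ev (stc_rigid C) W).
  rewrite comm_u; congr (pull _ _); rewrite mcompDl mcompNl -!mcompA -!tensm_comp.
  by rewrite qi2 pi1 pi2 qi1 tensm0l tensm1 !mcomp0r mcompm1 subr0.
have c12 : comm u1 u2 = pull (one _) (- (ev (stc_rigid C) W \oc br W (Dl W))).
  rewrite comm_u; congr (pull _ _); rewrite mcompDl mcompNl -!mcompA -!tensm_comp.
  by rewrite qi1 pi2 pi1 qi2 tensm0l tensm1 !mcomp0r mcompm1 sub0r.
have uP X (f : mor X V) Z (x : pts (alg_tens R A) Z) : P _ x -> comm (pull w f) x = 0.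
  by move=> Px; rewrite -[x]pull_id comm_pull wP // pull0.
have sym1 r : r \in [pchar k] -> is_zero_ob (sym_pow W r) by case/symW.
have sym2 r : r \in [pchar k] -> is_zero_ob (sym_pow (Dl W) r) by case/symW.
(* The letters are those of W^*, which commute among themselves; bracketing with W lowers their
   number. *)
have stage2 := stage algRA c12 c22 (dual_zig W) sP (@uP _ i1) sym2 sJ
  (fun Z x => @wJ _ _ _ x) PJ.
(* P2 is spanned over R by the words in W^* alone: J misses it by bracketing with W, and then
   misses everything by bracketing with W^*. *)
pose P2 : psub (alg_tens R A) := fun Z x => exists n, filt u2 P n x.
have sP2 : sheaf P2 by exact: filt_union_sheaf.
(* The form vanishes on W^* (x) W^*, so a bracket with W^* passes through the letters of W^* and
   reaches [P], where it is zero. *)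
have u2P2 Z (x : pts (alg_tens R A) Z) : P2 _ x -> comm u2 x = 0.
  case=> n; move: n Z x; apply: (filt_min (Q := fun Z x => comm u2 x = 0)) => //.
  - split=> [Z|Z x y ex ey|Z x ex|Z Z' x g ex|Z Z' x e ee].
    + exact: comm0.
    + by rewrite commD ex ey addr0.
    + by rewrite commN ex oppr0.
    + by rewrite comm_pullr ex pull0.
    by rewrite comm_pullr; apply: epi_pull_eq0; apply: epi_tensl.
  - by move=> Z x; apply: uP.
  move=> Z x ex; rewrite (comm_mul algRA c22) ex mul0x pull0 ct0 pull0r.
  exact: addr0.
have P2J Z (x : pts (alg_tens R A) Z) : P2 _ x -> J _ x -> x = 0.
  by case=> n; apply: stage2.
have stage1 := stage algRA c21 c11 (zigzag (stc_rigid C) W) sP2 u2P2 sym1 sJ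
  (fun Z x => @wJ _ _ _ x) P2J.
move=> Z x.
have [n fx] : exists n, filt u1 P2 n x; last exact: stage1 fx.
move: Z x; apply: gen; first exact: filt_union_sheaf.
  by move=> Z r; exists 1%N; apply: filt_P; exists 1%N; apply: filt_P.
(* Left multiplication by W^* does not raise the number of letters in W: the new letter passes
   through them, at the cost of contractions that shorten the word, until [P2] absorbs it. *)
have u2F n Z (x : pts (alg_tens R A) Z) : filt u1 P2 n x -> filt u1 P2 n (mul u2 x).
  elim: n Z x => [Z x ->|n IH]; first by rewrite mul0x.
  have sF := filt_sheaf u1 P2 n.+1.
  apply: gen_sheaf_min.
    split=> [Z|Z x y fx fy|Z x fx|Z Z' x g fx|Z Z' x e ee fx].
    - by rewrite mul0x; apply: (sheaf0 sF).
    - by rewrite mulDr; apply: (sheafD sF).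
    - by rewrite mulNx; apply: (sheafN sF).
    - by rewrite mul_pullr; apply: (sheaf_pull sF).
    by apply: (sheaf_loc sF (epi_tensl ee)); rewrite -mul_pullr.
  move=> Z x [] {}Z {}x => [[m fx]|fx].
    by apply: filt_P; exists m.+1; apply: filt_mul.
  rewrite (mul_comm algRA c21); apply: (sheafD sF); apply: (sheaf_pull sF).
    by apply: filt_mul; apply: IH.
  exact: filtS.
move=> Z x [n fx]; exists n.+1.
(* The component of w in W adds one letter in W, the component in W^* adds none. *)
have -> : w = pull u1 p + pull u2 q.
  by rewrite !pull_comp -pullDr bip_id pull_id.
have sF := filt_sheaf u1 P2 n.+1.
rewrite mulDl (mul_pulll u1) (mul_pulll u2); apply: (sheafD sF); apply: (sheaf_pull sF).
  exact: filt_mul.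
by apply: u2F; apply: filtS.
Qed.

End TwoParts.

Theorem proposition3p1 (k : closedFieldType) (hk : 2%N \notin [pchar k])
    (C : symTensorCat k) (R : indAlgData C) (hR : simple_algebra R) :
  (forall (V : C) (B : mor (V \oX V) (unit_ob (stc_mon C))),
     skew_form B -> nondegenerate_form B ->
     (forall p : nat, p \in [pchar k] -> is_zero_ob (sym_pow V p)) ->
     forall A : indAlgData C, is_weyl_algebra B A ->
       simple_algebra (alg_tens R A))
  /\
  (forall W : C,
     (forall p : nat, p \in [pchar k] ->
        is_zero_ob (sym_pow W p) /\
        is_zero_ob (sym_pow (dual (stc_rigid C) W) p)) ->
     forall A : indAlgData C, is_weyl_algebra (pairing_form W) A ->
       simple_algebra (alg_tens R A)).
Proof.
split=> [V B skB ndB symV A weylA | W symW A weylA].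
  exact: (simple_nondegenerate hR hk skB ndB symV weylA).
exact: (simple_pairing hR hk symW weylA).
Qed.
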